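(* Let $A=(a_1\le\cdots\le a_n)$ be positive integers and let $1<i<n$ be such that $a_i\ne a_{i+1}$ and $a_{i-1}>1$. Put $A_i=(a_1,\ldots,a_{i-2},\,a_{i-1}-a_i+a_{i+1},\,a_{i+2},\ldots,a_n)\in\mathbb N^{n-2}$ and $A_{i-1,i}=(a_1,\ldots,a_{i-2},a_{i-1}-1,a_i+1,a_{i+1},\ldots,a_n)$. Then, with respect to the embedding $M^{A_i}\hookrightarrow S_{i,i+1}(A)$, there is an isomorphism of $\mathfrak{sl}_2\otimes\mathbb C[t]$-modules $$S_{i,i+1}(A)/M^{A_i}\simeq S_{i,i+1}(A_{i-1,i}).$$
   Context: Fusion products. Let $e,h,f$ be the standard basis of $\mathfrak{sl}_2(\mathbb C)$ and write $x_j=x\otimes t^j$. For positive integers $A=(a_1,\ldots,a_n)$ choose pairwise distinct $z_1,\ldots,z_n\in\mathbb C$, let $\mathbb C^{a}$ be the $a$-dimensional irreducible $\mathfrak{sl}_2$-module, and $\mathbb C^{a_i}(z_i)$ the $\mathfrak{sl}_2\otimes\mathbb C[t]$-module on which $x_j$ acts as $z_i^jx$. Let $\overline{v_A}\in\bigotimes_i\mathbb C^{a_i}(z_i)$ be the tensor product of lowest weight vectors and $F_s$ the span of all $x^{(1)}_{i_1}\cdots x^{(k)}_{i_k}\overline{v_A}$ with $x^{(j)}\in\mathfrak{sl}_2$, $i_1+\cdots+i_k\le s$. The fusion product is the associated graded $\mathfrak{sl}_2\otimes\mathbb C[t]$-module $M^A=\bigoplus_sF_s/F_{s-1}$, with $v_A$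 the image of $\overline{v_A}$. Known facts: up to isomorphism $M^A$ is independent of the $z_i$ and of the order of the $a_i$; $\mathfrak{sl}_2\otimes t^j$ acts by $0$ for $j\ge n$; $M^A=\mathbb C[e_0,\ldots,e_{n-1}]v_A\simeq\mathbb C[e_0,\ldots,e_{n-1}]/I_A$ with $I_A$ generated by $\sum_{i_1+\cdots+i_k=s}e_{n-1-i_1}\cdots e_{n-1-i_k}$ for $k\ge1$, $s<N_A(k):=\sum_{j=1}^n\max(k+1-a_j,0)$; $\dim M^A=\prod a_i$. Submodules $S_{i,i+1}(A)$. For $A$ with $a_i\le a_{i+1}$ let $A_{i,i+1}=(a_1,\ldots,a_{i-1},a_i-1,a_{i+1}+1,a_{i+2},\ldots,a_n)$. There is a surjection of $\mathfrak{sl}_2\otimes\mathbb C[t]$-modules $M^A\to M^{A_{i,i+1}}$, $v_A\mapsto v_{A_{i,i+1}}$ (since $I_A\subset I_{A_{i,i+1}}$), and $S_{i,i+1}(A)$ is its kernel. Embedding $M^{A_i}\hookrightarrow S_{i,i+1}(A)$. Let $e_{(n)}(z)=\sum_{j=0}^{n-1}e_jz^{n-1-j}$ and let $[\,\cdot\,]_N$ denote the coefficient of $z^N$. The submodule of $M^A$ generated over $\mathfrak{sl}_2\otimes\mathbb C[t]$ by the vector $[e_{(n)}(z)^{a_i-1}]_{N_A(a_i-1)}v_A$ lies in $S_{i,i+1}(A)$ and is isomorphic to $M^{A_i}$, this vector corresponding to the cyclic vector $v_{A_i}$. *)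

(* Defs.v *)
From HB Require Import structures.
From mathcomp Require Import all_boot all_order all_algebra.
From mathcomp Require Import ring.
From mathcomp Require Import boolp reals complex.

Set Implicit Arguments.
Unset Strict Implicit.
Unset Printing Implicit Defensive.

Import Order.TTheory GRing.Theory Num.Theory.
Local Open Scope ring_scope.


Inductive sl2 : Type := sl2e | sl2h | sl2f.

(* [x, y] = (sl2_br F x y).1 * (sl2_br F x y).2; the brackets of two basis
   elements are all multiples of basis elements. *)
Definition sl2_br (F : pzRingType) (x y : sl2) : F * sl2 :=
  match x, y with
  | sl2e, sl2f => (1, sl2h)
  | sl2f, sl2e => (-1, sl2h)
  | sl2h, sl2e => (2%:R, sl2e)
  | sl2e, sl2h => (- 2%:R, sl2e)
  | sl2h, sl2f => (- 2%:R, sl2f)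
  | sl2f, sl2h => (2%:R, sl2f)
  | _, _ => (0, sl2h)
  end.

(* [act M x j] is the action of x_j = x (x) t^j. *)
Record sl2t_mod (F : fieldType) := Sl2tMod {
  carrier :> vectType F;
  act : sl2 -> nat -> 'End(carrier);
  act_br : forall (x y : sl2) (i j : nat) (u : carrier),
    act x i (act y j u) - act y j (act x i u)
    = (sl2_br F x y).1 *: act (sl2_br F x y).2 (i + j) u
}.
Arguments act {F} M x j : rename.

Record mod_hom (F : fieldType) (M N : sl2t_mod F) := ModHom {
  mod_hom_fun :> 'Hom(M, N);
  mod_homP : forall x j u,
    mod_hom_fun (act M x j u) = act N x j (mod_hom_fun u)
}.

Definition mod_iso (F : fieldType) (M N : sl2t_mod F) : Prop :=
  exists f : mod_hom M N, lker f = 0%VS /\ limg f = fullv.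

Record submod (F : fieldType) (M : sl2t_mod F) := Submod {
  submod_vs :> {vspace M};
  submodP : forall x j u, u \in submod_vs -> act M x j u \in submod_vs
}.

Section Submodules.
Variable F : fieldType.

Lemma ker_subproof (M N : sl2t_mod F) (f : mod_hom M N) x j u :
  u \in lker f -> act M x j u \in lker f.
Proof. by rewrite !memv_ker mod_homP => /eqP ->; rewrite linear0. Qed.

Definition ker_submod (M N : sl2t_mod F) (f : mod_hom M N) : submod M :=
  Submod (@ker_subproof M N f).

Lemma img_subproof (M N : sl2t_mod F) (f : mod_hom M N) x j u :
  u \in limg f -> act N x j u \in limg f.
Proof.
by case/memv_imgP=> w _ ->; rewrite -mod_homP memv_img // memvf.
Qed.

Definition img_submod (M N : sl2t_mod F) (f : mod_hom M N) : submod N :=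
  Submod (@img_subproof M N f).

Section SubmodMod.
Variables (M : sl2t_mod F) (D : submod M).

Definition sub_act x j : 'End(subvs_of D) :=
  (linfun (vsproj D) \o act M x j \o linfun vsval)%VF.

Lemma sub_actE x j (u : subvs_of D) : vsval (sub_act x j u) = act M x j (vsval u).
Proof.
by rewrite /sub_act !comp_lfunE !lfunE /= vsprojK // submodP // subvsP.
Qed.

Lemma sub_act_br x y i j (u : subvs_of D) :
  sub_act x i (sub_act y j u) - sub_act y j (sub_act x i u)
  = (sl2_br F x y).1 *: sub_act (sl2_br F x y).2 (i + j) u.
Proof. by apply: subvs_inj; rewrite linearB linearZ /= !sub_actE act_br. Qed.

Definition submod_mod : sl2t_mod F := Sl2tMod sub_act_br.
End SubmodMod.

(* The quotient of (the image of) D by K, realised on the complement D :\: K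
   of D :&: K in D; [quo_proj] is the canonical projection, see [quo_projP],
   [quo_proj_surj] and [quo_proj_act]. *)
Section Quotient.
Variables (M : sl2t_mod F) (D K : submod M).

Definition quo_proj : 'Hom(M, subvs_of (D :\: K)%VS) :=
  (linfun (vsproj (D :\: K)) \o addv_pi1 D K)%VF.

Lemma quo_projE u : vsval (quo_proj u) = addv_pi1 D K u.
Proof. by rewrite /quo_proj comp_lfunE lfunE /= vsprojK // memv_pi. Qed.

Lemma quo_proj_rep u : u \in D -> u - vsval (quo_proj u) \in K.
Proof.
move=> uD; rewrite quo_projE.
have /addv_pi1_pi2 {1}<- : u \in (D + K)%VS by rewrite -[u]addr0 memv_add ?mem0v.
by rewrite addrAC subrr add0r memv_pi2.
Qed.

Lemma quo_proj_repK (w : subvs_of (D :\: K)%VS) : quo_proj (vsval w) = w.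
Proof.
apply: subvs_inj; rewrite quo_projE /addv_pi1 daddv_pi_id ?subvsP //.
by rewrite capv_diff.
Qed.

Lemma quo_repD (w : subvs_of (D :\: K)%VS) : vsval w \in D.
Proof. exact: (subvP (diffvSl D K) _ (subvsP w)). Qed.

Lemma quo_projP u : u \in D -> (quo_proj u == 0) = (u \in K).
Proof.
move=> uD; apply/eqP/idP => [q0|uK].
  by have := quo_proj_rep uD; rewrite q0 [vsval 0]linear0 subr0.
have wK : vsval (quo_proj u) \in K.
  by rewrite -[vsval _](subKr u) rpredB // quo_proj_rep.
apply: subvs_inj; rewrite linear0; apply/eqP; rewrite -memv0 -(capv_diff D K).
by rewrite memv_cap subvsP.
Qed.

Lemma quo_proj_surj (w : subvs_of (D :\: K)%VS) :
  exists2 u, u \in D & quo_proj u = w.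
Proof. by exists (vsval w); [exact: quo_repD | exact: quo_proj_repK]. Qed.

Definition quo_act x j : 'End(subvs_of (D :\: K)%VS) :=
  (quo_proj \o act M x j \o linfun vsval)%VF.

Lemma quo_actE x j w : quo_act x j w = quo_proj (act M x j (vsval w)).
Proof. by rewrite /quo_act comp_lfunE (comp_lfunE quo_proj) [linfun vsval w]lfunE. Qed.

Lemma quo_proj_act x j u :
  u \in D -> quo_proj (act M x j u) = quo_act x j (quo_proj u).
Proof.
move=> uD; rewrite quo_actE; apply/eqP.
have uK := quo_proj_rep uD; set r := vsval _ in uK *.
have -> : act M x j u = act M x j (u - r) + act M x j r by rewrite -linearD subrK.
have urD : u - r \in D by rewrite rpredB // quo_repD.
have /eqP q0 : quo_proj (act M x j (u - r)) == 0.
  by rewrite quo_projP ?submodP.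
by rewrite [quo_proj (_ + _)]linearD /= q0 add0r.
Qed.

Lemma quo_act_br x y i j (u : subvs_of (D :\: K)%VS) :
  quo_act x i (quo_act y j u) - quo_act y j (quo_act x i u)
  = (sl2_br F x y).1 *: quo_act (sl2_br F x y).2 (i + j) u.
Proof.
have [v vD <-] := quo_proj_surj u.
by rewrite -!quo_proj_act ?submodP // -linearB /= act_br linearZ.
Qed.

Definition quo_mod : sl2t_mod F := Sl2tMod quo_act_br.
End Quotient.

End Submodules.


Section Span.
Variables (F : fieldType) (V : vectType F).
Implicit Types (P : V -> Prop) (U : {vspace V}).

Definition is_span P U : Prop :=
  (forall v, P v -> v \in U) /\
  (forall W : {vspace V}, (forall v, P v -> v \in W) -> (U <= W)%VS).

Lemma is_span_exists P : exists U, is_span P U.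
Proof.
pose Q d := `[< exists U : {vspace V}, (forall v, P v -> v \in U) /\ \dim U = d >].
have exQ : exists d, Q d.
  by exists (\dim (fullv : {vspace V})); apply/asboolP; exists fullv; split=> // v _;
     rewrite memvf.
case: (ex_minnP exQ) => d /asboolP[U [PU dU]] dmin.
exists U; split=> // W PW.
have PUW v : P v -> v \in (U :&: W)%VS by move=> Pv; rewrite memv_cap PU ?PW.
have : (d <= \dim (U :&: W)%VS)%N by apply: dmin; apply/asboolP; exists (U :&: W)%VS.
rewrite -dU => le_dim.
have /eqP <- : (U :&: W == U)%VS by rewrite eqEdim capvSl.
exact: capvSr.
Qed.

Definition vspan P : {vspace V} := sval (cid (is_span_exists P)).

Lemma vspanP P : is_span P (vspan P).
Proof. exact: svalP (cid _). Qed.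

Lemma chain_stable (U : nat -> {vspace V}) :
  (forall s, (U s <= U s.+1)%VS) -> exists N, forall s, (N <= s)%N -> U s = U N.
Proof.
move=> homoU; pose Q d := `[< exists s, \dim (U s) = d >].
have exQ : exists d, Q d by exists (\dim (U 0)); apply/asboolP; exists 0%N.
have ubQ d : Q d -> (d <= \dim (fullv : {vspace V}))%N.
  by move=> /asboolP[s <-]; rewrite dimvS ?subvf.
case: (ex_maxnP exQ ubQ) => d /asboolP[N dN] dmax.
exists N => s leNs; apply/esym/eqP; rewrite eqEdim dN dmax ?andbT.
  elim: s leNs => [|s IHs]; first by rewrite leqn0 => /eqP ->.
  by rewrite leq_eqVlt => /predU1P[->//|] /IHs /subv_trans; apply.
by apply/asboolP; exists s.
Qed.
End Span.

Section AssociatedGraded.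
Variables (F : fieldType) (M : sl2t_mod F) (v : M).

Definition act_word (w : seq (sl2 * nat)) (u : M) : M :=
  foldr (fun p : sl2 * nat => act M p.1 p.2) u w.

Definition deg_word (w : seq (sl2 * nat)) : nat := (\sum_(p <- w) p.2)%N.

Definition filt (s : nat) : {vspace M} :=
  vspan (fun u => exists w, (deg_word w <= s)%N /\ u = act_word w v).

(* F_{s-1}, with F_{-1} = 0. *)
Definition filt_pred (s : nat) : {vspace M} :=
  if s is s'.+1 then filt s' else 0%VS.

Lemma filt_mono s : (filt s <= filt s.+1)%VS.
Proof.
have [_] := vspanP (fun u => exists w, (deg_word w <= s)%N /\ u = act_word w v).
apply=> u [w [ws uE]].
have [+ _] := vspanP (fun u => exists w, (deg_word w <= s.+1)%N /\ u = act_word w v).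
by apply; exists w; split=> //; exact: leqW.
Qed.

Lemma filt_pred_sub s : (filt_pred s <= filt s)%VS.
Proof. by case: s => [|s]; [exact: sub0v | exact: filt_mono]. Qed.

Lemma filt_act s x j u : u \in filt s -> act M x j u \in filt (s + j).
Proof.
have [_] := vspanP (fun u => exists w, (deg_word w <= s)%N /\ u = act_word w v).
move=> /(_ (act M x j @^-1: filt (s + j))%VS) H us.
rewrite memv_preim; apply: (subvP (H _) _ us) => {us}u [w [ws ->]].
rewrite -memv_preim.
have [+ _] := vspanP (fun u => exists w, (deg_word w <= s + j)%N /\ u = act_word w v).
apply; exists ((x, j) :: w); split=> //.
by rewrite /deg_word big_cons /= addnC leq_add2r.
Qed.

Lemma filt_pred_act s x j u :
  u \in filt_pred s -> act M x j u \in filt_pred (s + j).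
Proof.
case: s => [|s] /=; last exact: filt_act.
by rewrite memv0 => /eqP ->; rewrite linear0 mem0v.
Qed.

(* F_s / F_{s-1} = 0 for s > filt_bound, so the direct sum of the
   F_s / F_{s-1} may be restricted to s <= filt_bound. *)
Definition filt_bound : nat := sval (cid (chain_stable filt_mono)).

Lemma filt_boundP s : (filt_bound < s)%N -> filt s = filt_pred s.
Proof.
case: s => // s lt_s; have H := svalP (cid (chain_stable filt_mono)).
by rewrite /= (H s) // (H s.+1) // ltnW.
Qed.

(* M (x) F[T] / (T^(filt_bound + 1)) with x_j acting as x_j (x) T^j. The
   associated graded module is the subquotient of it given by the families
   (u_s) with u_s in F_s, modulo those with u_s in F_{s-1}. *)
Local Notation famT := {ffun 'I_filt_bound.+1 -> M}.

Definition fam_fun (x : sl2) (j : nat) (u : famT) : famT :=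
  [ffun s : 'I_filt_bound.+1 => if (j <= s)%N then act M x j (u (inord (s - j))) else 0].

Lemma fam_fun_linear x j : linear (fam_fun x j).
Proof.
move=> a u w; apply/ffunP=> s; rewrite !ffunE; case: leqP => _.
  by rewrite linearP.
by rewrite scaler0 addr0.
Qed.
HB.instance Definition _ x j :=
  GRing.isLinear.Build F famT famT _ (fam_fun x j) (fam_fun_linear x j).

Definition fam_act x j : 'End(famT) := linfun (fam_fun x j).

Lemma fam_actE x j (u : famT) s : fam_act x j u s =
  if (j <= s)%N then act M x j (u (inord (s - j))) else 0.
Proof. by rewrite [fam_act x j u]lfunE ffunE. Qed.

Lemma fam_act2 x y i j (u : famT) s : fam_act x i (fam_act y j u) s =
  if (i + j <= s)%N then act M x i (act M y j (u (inord (s - (i + j))))) else 0.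
Proof.
rewrite fam_actE; have slt := ltn_ord s.
have [le_is|lt_si] := leqP i s; last by rewrite leqNgt (leq_trans lt_si) ?leq_addr.
rewrite fam_actE inordK ?(leq_ltn_trans (leq_subr _ _)) // leq_subRL //.
by rewrite subnDA; case: ifP => // _; rewrite linear0.
Qed.

Lemma fam_act_br x y i j (u : famT) :
  fam_act x i (fam_act y j u) - fam_act y j (fam_act x i u)
  = (sl2_br F x y).1 *: fam_act (sl2_br F x y).2 (i + j) u.
Proof.
apply/ffunP=> s; rewrite 2!ffunE !fam_act2 [RHS]ffunE fam_actE (addnC j i).
by case: leqP => _; [rewrite act_br | rewrite subrr scaler0].
Qed.

Definition fam_mod : sl2t_mod F := Sl2tMod fam_act_br.

Definition fam_in (U : nat -> {vspace M}) : {vspace fam_mod} :=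
  vspan (fun u : famT => forall s : 'I_filt_bound.+1, u s \in U s).

Lemma fam_inP (U : nat -> {vspace M}) (u : famT) :
  reflect (forall s : 'I_filt_bound.+1, u s \in U s) (u \in fam_in U).
Proof.
pose coord_fun (s : 'I_filt_bound.+1) (u : famT) : M := u s.
have coord_lin s : linear (coord_fun s) by move=> a x y; rewrite /coord_fun !ffunE.
have [inU minU] := vspanP (fun u : famT => forall s : 'I_filt_bound.+1, u s \in U s).
apply: (iffP idP) => [uU s|]; last exact: inU.
pose L := GRing.isLinear.Build F famT M _ _ (coord_lin s).
pose f : {linear famT -> M} := HB.pack (coord_fun s) L.
have fE w : linfun f w = w s by rewrite lfunE.
have : u \in (linfun f @^-1: U s)%VS.
  by apply: (subvP (minU _ _) _ uU) => w wU; rewrite -memv_preim fE.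
by rewrite -memv_preim fE.
Qed.

Lemma fam_in_act (U : nat -> {vspace M}) :
  (forall s x j u, u \in U s -> act M x j u \in U (s + j)%N) ->
  forall x j u, u \in fam_in U -> act fam_mod x j u \in fam_in U.
Proof.
move=> UP x j u /fam_inP uU; apply/fam_inP => s.
rewrite [X in X \in _]fam_actE; case: leqP => [le_js|_]; last exact: mem0v.
have slt := ltn_ord s.
by have := UP _ x j _ (uU (inord (s - j))); rewrite inordK ?(leq_ltn_trans (leq_subr _ _)) // subnK.
Qed.

Definition gr_num : submod fam_mod := Submod (fam_in_act filt_act).
Definition gr_den : submod fam_mod := Submod (fam_in_act filt_pred_act).

Definition gr_mod : sl2t_mod F := quo_mod gr_num gr_den.

Definition fam_single (s : nat) (y : M) : famT :=
  [ffun t : 'I_filt_bound.+1 => if t == s :> nat then y else 0].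

Definition gr_vec : gr_mod := quo_proj gr_num gr_den (fam_single 0 v).

Lemma fam_single_linear s : linear (fam_single s).
Proof.
move=> c x y; apply/ffunP=> t; rewrite !ffunE.
by case: eqP => // _; rewrite scaler0 addr0.
Qed.
HB.instance Definition _ s :=
  GRing.isLinear.Build F M famT _ (fam_single s) (fam_single_linear s).

Lemma fam_single_in (U : nat -> {vspace M}) s y :
  y \in U s -> fam_single s y \in fam_in U.
Proof.
move=> yU; apply/fam_inP => t; rewrite ffunE.
by case: eqP => [->|_]; rewrite ?mem0v.
Qed.

Lemma fam_single_act x j s y :
  act fam_mod x j (fam_single s y) = fam_single (s + j) (act M x j y).
Proof.
apply/ffunP=> t; rewrite [LHS]fam_actE !ffunE; have tlt := ltn_ord t.
case: leqP => [le_jt|lt_tj].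
  rewrite inordK ?(leq_ltn_trans (leq_subr _ _)) //.
  by rewrite -(eqn_add2r j) subnK //; case: eqP => // _; rewrite linear0.
by case: eqP => // tE; move: lt_tj; rewrite tE ltnNge leq_addl.
Qed.

Lemma filt_word w : act_word w v \in filt (deg_word w).
Proof.
have [+ _] := vspanP (fun u => exists w', (deg_word w' <= deg_word w)%N /\ u = act_word w' v).
by apply; exists w.
Qed.

(* v_A is cyclic: a homomorphism is determined by its value on it. *)
Lemma gr_hom_unique (N : sl2t_mod F) (f g : mod_hom gr_mod N) :
  f gr_vec = g gr_vec -> forall x, f x = g x.
Proof.
move=> fg; pose pr : 'Hom(fam_mod, gr_mod) := quo_proj gr_num gr_den.
have word w : f (pr (fam_single (deg_word w) (act_word w v))) =
              g (pr (fam_single (deg_word w) (act_word w v))).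
  elim: w => [|[x j] w IHw]; first by rewrite /deg_word big_nil.
  rewrite /deg_word big_cons /= addnC -fam_single_act.
  have wD : fam_single (deg_word w) (act_word w v) \in gr_num.
    exact/fam_single_in/filt_word.
  have -> : pr (act fam_mod x j (fam_single (deg_word w) (act_word w v)))
          = act gr_mod x j (pr (fam_single (deg_word w) (act_word w v))).
    exact: quo_proj_act.
  by rewrite (mod_homP f) (mod_homP g) IHw.
have single s y : y \in filt s -> f (pr (fam_single s y)) = g (pr (fam_single s y)).
  move=> ys; pose h := ((mod_hom_fun f - mod_hom_fun g) \o pr \o linfun (fam_single s))%VF.
  have hE u : h u = f (pr (fam_single s u)) - g (pr (fam_single s u)).
    by rewrite /h !comp_lfunE add_lfunE opp_lfunE [linfun _ u]lfunE.
  apply/eqP; rewrite -subr_eq0 -hE -memv_ker; apply: subvP ys.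
  have [_ + ] := vspanP (fun u => exists w, (deg_word w <= s)%N /\ u = act_word w v).
  apply=> u [w [ws ->]]; rewrite memv_ker hE subr_eq0.
  move: ws; rewrite leq_eqVlt => /predU1P[<-|lt_ws]; first by rewrite word.
  suff -> : pr (fam_single s (act_word w v)) = 0 by rewrite !linear0.
  have wF : act_word w v \in filt_pred s.
    case: (s) lt_ws => // s'; rewrite ltnS => ws /=.
    have [+ _] := vspanP (fun u => exists w, (deg_word w <= s')%N /\ u = act_word w v).
    by apply; exists w.
  apply/eqP; rewrite quo_projP; first exact/fam_single_in.
  exact/fam_single_in/(subvP (filt_pred_sub s)).
move=> x; have [u /fam_inP uD <-] := quo_proj_surj x.
have -> : u = \sum_(s < filt_bound.+1) fam_single s ((u : famT) s).
  apply/ffunP=> t; rewrite sum_ffunE (bigD1 t) //= ffunE eqxx big1 ?addr0 // => s st.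
  by rewrite ffunE val_eqE eq_sym (negbTE st).
rewrite !linear_sum; apply: eq_bigr => s _; exact: single.
Qed.

End AssociatedGraded.


(* The a-dimensional irreducible module: in the basis u_0, .., u_(a-1) with
   u_0 of lowest weight,
     e u_k = u_(k+1),  h u_k = (2k - (a-1)) u_k,  f u_k = k (a-k) u_(k-1).
   The k-th column of the matrix holds the coordinates of x u_k. *)
Definition irr (F : fieldType) (a : nat) (x : sl2) : 'M[F]_a :=
  match x with
  | sl2e => \matrix_(m, k) (m == k.+1 :> nat)%:R
  | sl2h => diag_mx (\row_k ((k.*2)%:R - (a.-1)%:R))
  | sl2f => \matrix_(m, k) ((k * (a - k))%:R *+ (k == m.+1 :> nat))
  end.

Lemma irr_br (F : fieldType) a x y :
  irr F a x *m irr F a y - irr F a y *m irr F a x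
  = (sl2_br F x y).1 *: irr F a (sl2_br F x y).2.
Proof.
have HE : irr F a sl2h *m irr F a sl2e - irr F a sl2e *m irr F a sl2h
          = 2%:R *: irr F a sl2e.
  rewrite /= mul_diag_mx mul_mx_diag; apply/matrixP=> m k; rewrite !mxE.
  case: eqP => [->|_]; last by rewrite !mulr0 mul0r subrr.
  rewrite !mulr1 mul1r doubleS -(addn2 k.*2) natrD; ring.
have HF : irr F a sl2h *m irr F a sl2f - irr F a sl2f *m irr F a sl2h
          = (- 2%:R) *: irr F a sl2f.
  rewrite /= mul_diag_mx mul_mx_diag; apply/matrixP=> m k; rewrite !mxE.
  case: eqP => [->|_]; last by rewrite !mulr0n mul0r !mulr0 subrr.
  rewrite mulr1n doubleS -(addn2 m.*2) natrD; move: (_ * _)%:R => c; ring.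
have EF : irr F a sl2e *m irr F a sl2f - irr F a sl2f *m irr F a sl2e
          = irr F a sl2h.
  apply/matrixP=> m k; rewrite !mxE /=.
  have -> : \sum_j (irr F a sl2e) m j * (irr F a sl2f) j k
            = (k * (a - k))%:R *+ (m == k).
    case: (posnP k) => [k0|kp].
      rewrite k0 mul0n mul0rn big1 // => l _.
      by rewrite !mxE k0 mul0n mul0rn mulr0.
    have lk : (k.-1 < a)%N by apply: leq_ltn_trans (leq_pred _) (ltn_ord k).
    rewrite (bigD1 (Ordinal lk)) //= !mxE /= prednK // eqxx mulr1n.
    rewrite big1 ?addr0 => [|l]; first by rewrite mulr_natl.
    rewrite -val_eqE /= => nl; rewrite !mxE.
    rewrite [(k == _ :> nat)](_ : _ = false) ?mulr0n ?mulr0 //.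
    by apply: contraNF nl => /eqP ->.
  have -> : \sum_j (irr F a sl2f) m j * (irr F a sl2e) j k
            = (k.+1 * (a - k.+1))%:R *+ (m == k).
    have [lk|lk] := ltnP k.+1 a.
      rewrite (bigD1 (Ordinal lk)) //= !mxE /= eqxx mulr1 eqSS eq_sym.
      rewrite big1 ?addr0 // => l.
      rewrite -val_eqE /= => nl; rewrite !mxE.
      by rewrite (negbTE nl) mulr0.
    have -> : (a - k.+1)%N = 0%N by apply/eqP; rewrite subn_eq0.
    rewrite muln0 mul0rn big1 // => l _; rewrite !mxE.
    rewrite [(l == k.+1 :> nat)](_ : _ = false) ?mulr0 //.
    by apply/eqP=> lE; move: (ltn_ord l); rewrite lE ltnNge lk.
  case: (m =P k) => [->|_]; last by rewrite !mulr0n subrr.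
  rewrite !mulr1n.
  move: (k : nat) (ltn_ord k) => {}k; case: (ltnP k a) => // /subnKC <- _.
  rewrite addSn; move: (a - k.+1)%N => r.
  rewrite subSS subSn ?leq_addr // addKn /= -addnn !natrM !natrD -!natr1; ring.
case: x y => [] []; rewrite ?subrr ?[(_, _).1]/= ?scale0r //.
- by rewrite -opprB HE scaleNr.
- by rewrite EF scale1r.
- by rewrite -opprB EF scaleN1r.
- by rewrite -opprB HF scaleNr opprK.
Qed.

Section Tensor.
Variables (F : fieldType) (n : nat) (d : 'I_n -> nat).

Definition tidx : finType := {dffun forall i : 'I_n, 'I_(d i)}.

(* A tensor is given by its coordinates on the products of basis vectors. *)
Definition tens : vectType F := {ffun tidx -> F^o}.

Definition tupd (m : tidx) (i : 'I_n) (k : 'I_(d i)) : tidx :=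
  [ffun l : 'I_n => dfwith m k l].

(* X acting on the i-th tensor factor. *)
Definition tloc_fun (i : 'I_n) (X : 'M[F]_(d i)) (u : tens) : tens :=
  [ffun m : tidx => \sum_(k < d i) X (m i) k * u (tupd m k)].

Lemma tloc_fun_linear i X : linear (@tloc_fun i X).
Proof.
move=> c u w; apply/ffunP=> m; rewrite !ffunE scaler_sumr -big_split /=.
by apply: eq_bigr => k _; rewrite !ffunE mulrDr /GRing.scale /= mulrCA.
Qed.
HB.instance Definition _ i X :=
  GRing.isLinear.Build F tens tens _ (@tloc_fun i X) (@tloc_fun_linear i X).

Definition tloc i (X : 'M[F]_(d i)) : 'End(tens) := linfun (@tloc_fun i X).

Lemma tlocE i (X : 'M[F]_(d i)) u m :
  tloc X u m = \sum_(k < d i) X (m i) k * u (tupd m k).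
Proof. by rewrite [tloc X u]lfunE ffunE. Qed.

Lemma tupd_in m i (k : 'I_(d i)) : tupd m k i = k.
Proof. by rewrite ffunE dfwith_in. Qed.

Lemma tupd_out m i (k : 'I_(d i)) l : i != l -> tupd m k l = m l.
Proof. by move=> il; rewrite ffunE dfwith_out. Qed.

Lemma tupdK m i (k k' : 'I_(d i)) : tupd (tupd m k) k' = tupd m k'.
Proof.
apply/ffunP=> l; have [<-|il] := eqVneq i l; first by rewrite !tupd_in.
by rewrite !tupd_out.
Qed.

Lemma tupdC m i l (k : 'I_(d i)) (k' : 'I_(d l)) : i != l ->
  tupd (tupd m k) k' = tupd (tupd m k') k.
Proof.
move=> il; apply/ffunP=> p.
have [<-|ip] := eqVneq i p; first by rewrite tupd_out ?tupd_in // eq_sym.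
rewrite [RHS]tupd_out //; have [<-|lp] := eqVneq l p; first by rewrite !tupd_in.
by rewrite !tupd_out.
Qed.

Lemma tloc_mul i (X Y : 'M[F]_(d i)) u : tloc X (tloc Y u) = tloc (X *m Y) u.
Proof.
apply/ffunP=> m; rewrite !tlocE.
under eq_bigr => k _.
  rewrite tlocE mulr_sumr.
  under eq_bigr => k' _ do rewrite tupd_in tupdK mulrA.
  over.
rewrite exchange_big /=; apply: eq_bigr => k _.
by rewrite mxE mulr_suml.
Qed.

Lemma tloc_comm i l (X : 'M[F]_(d i)) (Y : 'M[F]_(d l)) u :
  i != l -> tloc X (tloc Y u) = tloc Y (tloc X u).
Proof.
move=> il; apply/ffunP=> m; rewrite !tlocE.
under eq_bigr => k _.
  rewrite tlocE mulr_sumr.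
  under eq_bigr => k' _ do rewrite tupd_out // tupdC // mulrCA.
  over.
rewrite exchange_big /=; apply: eq_bigr => k _.
rewrite tlocE mulr_sumr; apply: eq_bigr => k' _.
by rewrite tupd_out // eq_sym.
Qed.

Lemma tloc_linear i c (X Y : 'M[F]_(d i)) u :
  tloc (c *: X + Y) u = c *: tloc X u + tloc Y u.
Proof.
apply/ffunP=> m; rewrite 2!ffunE !tlocE scaler_sumr -big_split /=.
by apply: eq_bigr => k _; rewrite !mxE mulrDl -mulrA.
Qed.

Variable z : 'I_n -> F.

Definition tens_act (x : sl2) (j : nat) : 'End(tens) :=
  \sum_(i < n) z i ^+ j *: tloc (irr F (d i) x).

Lemma tens_act_br x y i j u :
  tens_act x i (tens_act y j u) - tens_act y j (tens_act x i u)
  = (sl2_br F x y).1 *: tens_act (sl2_br F x y).2 (i + j) u.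
Proof.
have actE x' j' w :
    tens_act x' j' w = \sum_p z p ^+ j' *: tloc (irr F (d p) x') w.
  by rewrite /tens_act sum_lfunE; apply: eq_bigr => p _; rewrite scale_lfunE.
have act2 x' y' i' j' : tens_act x' i' (tens_act y' j' u) =
    \sum_p \sum_q (z p ^+ i' * z q ^+ j') *:
       tloc (irr F (d p) x') (tloc (irr F (d q) y') u).
  rewrite actE; apply: eq_bigr => p _; rewrite actE linear_sum scaler_sumr /=.
  by apply: eq_bigr => q _; rewrite linearZ /= scalerA.
rewrite !act2 [X in _ - X]exchange_big /= -sumrB actE scaler_sumr.
apply: eq_bigr => p _; rewrite -sumrB (bigD1 p) //= big1 ?addr0 => [|q qp].
  rewrite !tloc_mul exprD [z p ^+ j * _]mulrC -scalerBr.
  rewrite [RHS]scalerA [_.1 * _]mulrC -[RHS]scalerA.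
  congr (_ *: _); rewrite addrC -scaleN1r -tloc_linear scaleN1r addrC irr_br.
  rewrite -[X in tloc X u]addr0 tloc_linear [X in _ + X](_ : _ = 0) ?addr0 //.
  by apply/ffunP=> m; rewrite tlocE ffunE big1 // => k _; rewrite mxE mul0r.
by rewrite (tloc_comm _ _ _ (negbT (negbTE qp))) [z q ^+ j * _]mulrC subrr.
Qed.

Definition tens_mod : sl2t_mod F := Sl2tMod tens_act_br.

Definition tens_low : tens_mod :=
  ([ffun m : tidx => [forall i, m i == 0%N :> nat]%:R] : tens).

End Tensor.

Definition eval_points (F : fieldType) (A : seq nat) (z : seq F) : bool :=
  (size z == size A) && uniq z.

Definition eval_mod (F : fieldType) (A : seq nat) (z : seq F) : sl2t_mod F :=
  @tens_mod F (size A) (fun i => nth 0%N A i) (fun i => z`_i).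

Definition fusion (F : fieldType) (A : seq nat) (z : seq F) : sl2t_mod F :=
  gr_mod (tens_low _ _ : eval_mod A z).

Definition fusion_vec (F : fieldType) (A : seq nat) (z : seq F) : fusion A z :=
  gr_vec (tens_low _ _ : eval_mod A z).


(* Entries of A are numbered from 1, as in A = (a_1, .., a_n). *)
Definition ent (A : seq nat) (i : nat) : nat := nth 0%N A i.-1.

(* A_{i,i+1} *)
Definition seq_shift (A : seq nat) (i : nat) : seq nat :=
  take i.-1 A ++ (ent A i - 1)%N :: (ent A i.+1 + 1)%N :: drop i.+1 A.

(* A_i = (a_1, .., a_(i-2), a_(i-1) - a_i + a_(i+1), a_(i+2), .., a_n) *)
Definition seq_contract (A : seq nat) (i : nat) : seq nat :=
  take i.-2 A ++ (ent A i.-1 + ent A i.+1 - ent A i)%N :: drop i.+1 A.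

(* N_A(k) *)
Definition NA (A : seq nat) (k : nat) : nat := (\sum_(a <- A) (k.+1 - a))%N.

(* [e_(n)(z)^k]_N u, where e_(n)(z) = \sum_(p < n) e_(n-1-p) z^p. *)
Definition epow_coef (F : fieldType) (M : sl2t_mod F) (n k N : nat) (u : M) : M :=
  \sum_(s : k.-tuple 'I_n | (\sum_(p <- s) (p : nat))%N == N)
    act_word [seq (sl2e, (n.-1 - (p : nat))%N) | p : 'I_n <- s] u.

(* [e_(n)(z)^(a_i - 1)]_{N_A(a_i - 1)} v_A *)
Definition emb_vec (F : fieldType) (A : seq nat) (i : nat) (z : seq F) : fusion A z :=
  epow_coef (size A) (ent A i - 1) (NA A (ent A i - 1)) (fusion_vec A z).

(* p is the surjection M^A -> M^B sending v_A to v_B; by [gr_hom_unique] there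
   is at most one such p. *)
Definition canonical_surj (F : fieldType) (A B : seq nat) (zA zB : seq F)
    (p : mod_hom (fusion A zA) (fusion B zB)) : Prop :=
  p (fusion_vec A zA) = fusion_vec B zB /\ limg p = fullv.

(* iota is the embedding of M^{A_i} into the submodule S of M^A. *)
Definition canonical_emb (F : fieldType) (A : seq nat) (i : nat) (zC zA : seq F)
    (S : submod (fusion A zA))
    (iota : mod_hom (fusion (seq_contract A i) zC) (fusion A zA)) : Prop :=
  [/\ lker iota = 0%VS, iota (fusion_vec (seq_contract A i) zC) = emb_vec A i zA
    & (limg iota <= S)%VS].

(* Main.v *)
Require Import Defs.
From HB Require Import structures.
From mathcomp Require Import all_boot all_order all_algebra.
From mathcomp Require Import boolp reals complex.
From mathcomp Require Import ssrcomplements mpoly.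
From mathcomp Require Import ring lra zify.

Set Implicit Arguments.
Unset Strict Implicit.
Unset Printing Implicit Defensive.

Import Order.TTheory GRing.Theory Num.Theory.
Local Open Scope ring_scope.

(* View M^A as a cyclic module over the polynomial ring in e_0, .., e_(n-1).
   Two dimension estimates carry the argument. First, a cyclic module whose
   generator satisfies the relations of I_A has dimension at most the product of
   the a_j. Second, if the generator also kills [e_(n)(z)^(a_i - 1)] in degree
   N_A(a_i - 1), the estimate improves by dim M^(A_i). Both follow by induction
   from interpolation: if a functional lam kills the coefficients of E^k below
   N(k), then lam((E^(m-t))_(D-j) (E^t)_j) has, as a function of j, moments that
   are polynomial in t, which forces many of these numbers to vanish.

   Since M^A attains the first estimate, any vector u of a module N satisfying
   the relations of v_A is the image of v_A: the submodule of M^A x N generated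
   by (v_A, u) is the graph of a homomorphism. With B = A_(i-1,i) this gives
   p : M^A -> M^(A_(i,i+1)), q : M^B -> M^(B_(i,i+1)) and r : M^A -> M^B with
   r (ker p) contained in ker q. The first estimate modulo r (ker p) shows
   r (ker p) = ker q, so ker p :&: ker r has dimension dim M^(A_i); by the second
   estimate it is generated by the embedding vector, hence is M^(A_i). *)

(** * Interpolation *)

(** The polynomial dependence on t comes from X d/dX: applied b times to E^t it gives a combination
    of C(t, r) E^(t-r), r <= b, with coefficients free of t, and multiplication by E^(m-t) removes t
    from the exponent. The symmetry (t, j) -> (m-t, D-j) doubles every zero row: if the rows below s
    vanish, 2s rows do, and a row s with at most 2s possible places must vanish too. This is the
    origin of the term 2t in the bounds. In the dimension estimates a pair a <= e is spread to a-1,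
    e+1, leaving a submodule of type e-a+1, according to a e = (a-1)(e+1) + (e-a+1). The obstacle is
    the second estimate, where the additional relation has to survive each spreading. When two
    entries equal g, convexity of N gives one degree too few; interpolation over sliding windows,
    with the additional relation used in one extreme row, recovers it. *)

Section PolyFun.
Variables (F : numFieldType) (m : nat).

(** Agreement is asked only for t <= m, the rows of [bcoef], where m - t is not truncated. *)
Definition polyfun (d : nat) (phi : nat -> F) : Prop :=
  exists2 p : {poly F}, (size p <= d.+1)%N &
    forall t, (t <= m)%N -> phi t = p.[t%:R].

Lemma polyfun_ext d phi psi :
  (forall t, (t <= m)%N -> phi t = psi t) -> polyfun d psi -> polyfun d phi.
Proof. by move=> e [p sp pE]; exists p => // t tm; rewrite e // pE. Qed.

Lemma polyfunD d phi psi :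
  polyfun d phi -> polyfun d psi -> polyfun d (fun t => phi t + psi t).
Proof.
move=> [p sp pE] [q sq qE]; exists (p + q) => [|t tm].
  by rewrite (leq_trans (size_polyD _ _)) // geq_max sp.
by rewrite hornerD pE // qE.
Qed.

Lemma polyfunZ d c phi : polyfun d phi -> polyfun d (fun t => c * phi t).
Proof.
move=> [p sp pE]; exists (c *: p) => [|t tm]; last by rewrite hornerZ pE.
exact: leq_trans (size_scale_leq _ _) sp.
Qed.

Lemma polyfun_sum d (I : Type) (r : seq I) (phi : I -> nat -> F) :
  (forall i, polyfun d (phi i)) -> polyfun d (fun t => \sum_(i <- r) phi i t).
Proof.
move=> H; elim: r => [|i r IHr].
  by exists 0 => [|t _]; rewrite ?size_poly0 ?big_nil ?horner0.
apply: (@polyfun_ext _ _ (fun t => phi i t + \sum_(j <- r) phi j t)).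
  by move=> t _; rewrite big_cons.
exact: polyfunD.
Qed.

Lemma polyfun_widen d d' phi : (d <= d')%N -> polyfun d phi -> polyfun d' phi.
Proof. by move=> le [p sp pE]; exists p => //; apply: leq_trans sp _. Qed.

Lemma polyfun_mulX d phi : polyfun d phi -> polyfun d.+1 (fun t => t%:R * phi t).
Proof.
move=> [p sp pE]; exists ('X * p) => [|t tm]; last by rewrite hornerM hornerX pE.
have [->|p0] := eqVneq p 0; first by rewrite mulr0 size_poly0.
by rewrite mulrC size_mulX.
Qed.

Lemma polyfun_bin r : polyfun r (fun t => 'C(t, r)%:R).
Proof.
elim: r => [|r IHr].
  by exists 1 => [|t _]; rewrite ?size_poly1 ?hornerC ?bin0.
apply: (@polyfun_ext _ _
   (fun t => (r.+1%:R)^-1 * (t%:R * 'C(t, r)%:R + - r%:R * 'C(t, r)%:R))).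
  move=> t _; apply: (@mulfI _ r.+1%:R); first by rewrite pnatr_eq0.
  rewrite mulrA divff ?pnatr_eq0 // mul1r -mulrDl -natrM mul_bin_left.
  have [rt|tr] := leqP r t; first by rewrite natrM natrB.
  by rewrite bin_small // muln0 mulr0.
apply/polyfunZ/polyfunD; first exact: polyfun_mulX.
by apply/polyfunZ; apply: polyfun_widen IHr.
Qed.

Lemma polyfun_zero d phi (s : seq nat) :
    polyfun d phi -> uniq s -> (d < size s)%N ->
    (forall t, t \in s -> (t <= m)%N /\ phi t = 0) ->
  forall t, (t <= m)%N -> phi t = 0.
Proof.
move=> [p sp pE] us ds sz t tm; rewrite pE //.
suff -> : p = 0 by rewrite horner0.
apply: (@roots_geq_poly_eq0 _ p [seq k%:R | k <- s]).
- apply/allP=> x /mapP[k ks ->]; have [km kz] := sz k ks.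
  by rewrite rootE -pE // kz.
- by rewrite map_inj_uniq // => x y /eqP; rewrite eqr_nat => /eqP.
- by rewrite size_map (leq_trans sp).
Qed.

End PolyFun.

(** * The operator X d/dX on powers of a polynomial *)

Section EulerDerivation.
Variable S : comNzRingType.
Implicit Types p E : {poly S}.

Definition eder p : {poly S} := 'X * p^`().

Lemma coef_eder p j : (eder p)`_j = p`_j *+ j.
Proof. by rewrite coefXM; case: j => [|j] /=; rewrite ?mulr0n ?coef_deriv. Qed.

Lemma coef_iter_eder b p j : (iter b eder p)`_j = p`_j *+ j ^ b.
Proof.
by elim: b => [|b IHb] /=; rewrite ?expn0 ?mulr1n // coef_eder IHb -mulrnA -expnSr.
Qed.

(** By Leibniz, E^(t-r) becomes (t-r) E^(t-r-1) [eder E], and (t-r) C(t,r) = (r+1) C(t,r+1). The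
    factors [W] are the same for all [t]; a truncated t - r is harmless since then C(t,r) = 0. *)
Lemma eder_power b E : exists W : nat -> {poly S}, forall t,
  iter b eder (E ^+ t) = \sum_(r < b.+1) E ^+ (t - r) * W r *+ 'C(t, r).
Proof.
elim: b => [|b [W IHW]].
  by exists (fun _ => 1) => t; rewrite big_ord1 subn0 mulr1 bin0.
exists (fun r => (if (r <= b)%N then eder (W r) else 0) +
                 (if r is r'.+1 then eder E * W r' *+ r'.+1 else 0)) => t.
rewrite iterS IHW.
have ederD p q : eder (p + q) = eder p + eder q.
  by rewrite /eder derivD mulrDr.
have eder0 : eder 0 = 0 by rewrite /eder deriv0 mulr0.
have ederMn p k : eder (p *+ k) = eder p *+ k by rewrite /eder derivMn mulrnAr.
have -> : eder (\sum_(r < b.+1) E ^+ (t - r) * W r *+ 'C(t, r)) =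
  \sum_(r < b.+1) (E ^+ (t - r) * eder (W r) *+ 'C(t, r) +
                   E ^+ (t - r.+1) * (eder E * W r *+ r.+1) *+ 'C(t, r.+1)).
  rewrite (big_morph eder ederD eder0); apply: eq_bigr => r _.
  rewrite ederMn /eder derivM deriv_exp.
  rewrite mulrDr mulrnDl addrC; congr (_ + _).
    by congr (_ *+ _); rewrite mulrCA.
  rewrite subnS; set y := E ^+ _.-1; set w := W r; set c := (t - r)%N.
  rewrite -[RHS]mulrnAr -mulrnA mul_bin_left -/c; move: 'C(t, r) (E^`()) => k d.
  rewrite mulrnAl mulrnAr -mulrnA mulrnAr; congr (_ *+ _).
  ring.
rewrite big_split /= [RHS](eq_bigr (fun r : 'I_b.+2 =>
   (E ^+ (t - r) * (if (r <= b)%N then eder (W r) else 0) *+ 'C(t, r)) +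
   (E ^+ (t - r) * (if r : nat is r'.+1 then eder E * W r' *+ r'.+1 else 0)
      *+ 'C(t, r)))); last by move=> r _; rewrite mulrDr mulrnDl.
rewrite big_split /=; congr (_ + _).
  rewrite [RHS]big_ord_recr /= ltnn mulr0 mul0rn addr0; apply: eq_bigr => r _.
  by rewrite -ltnS ltn_ord.
by rewrite [RHS]big_ord_recl /= mulr0 mul0rn add0r.
Qed.

End EulerDerivation.

(** * Vanishing of the numbers lam((E^(m-t))_(D-j) (E^t)_j) *)

Section Interpolation.
Variables (F : numFieldType) (S : comNzRingType) (lam : {additive S -> F}).
Variable E : {poly S}.

(** Row t, column j of an array in which the total exponent m and the total degree D are fixed. *)
Definition bcoef (m D t j : nat) : F :=
  lam ((E ^+ (m - t))`_(D - j) * (E ^+ t)`_j).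

Lemma bcoef_rev m D t j : (t <= m)%N -> (j <= D)%N ->
  bcoef m D (m - t) (D - j) = bcoef m D t j.
Proof. by move=> tm jD; rewrite /bcoef !subKn // mulrC. Qed.

(** The factor j^b is produced by X d/dX acting on E^t; by [eder_power] the product with E^(m-t) is
    a sum of C(t,r) E^(m-r) W_r, where t survives only in the binomials. *)
Lemma bcoef_moment m D b :
  polyfun m b (fun t => \sum_(j < D.+1) bcoef m D t j * j%:R ^+ b).
Proof.
have [W EW] := eder_power b E.
apply: (@polyfun_ext _ _ _ _ (fun t =>
   \sum_(r < b.+1) lam (E ^+ (m - r) * W r)`_D * 'C(t, r)%:R)); last first.
  apply: (@polyfun_sum _ m b) => r.
  apply: (@polyfun_ext _ _ _ _
    (fun t => lam (E ^+ (m - r) * W r)`_D * 'C(t, r)%:R)) => //.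
  by apply/polyfunZ/polyfun_widen/polyfun_bin; rewrite -ltnS.
move=> t tm.
have -> : \sum_(j < D.+1) bcoef m D t j * j%:R ^+ b =
          lam (E ^+ (m - t) * iter b (@eder S) (E ^+ t))`_D.
  rewrite coefMr raddf_sum; apply: eq_bigr => j _.
  by rewrite coef_iter_eder mulrnAr raddfMn /= -natrX mulr_natr.
rewrite EW mulr_sumr coef_sum raddf_sum; apply: eq_bigr => r _.
rewrite mulrnAr coefMn raddfMn /= mulr_natr.
have [rt|tr] := leqP r t; last by rewrite bin_small.
by rewrite mulrA -exprD addnBA // subnK.
Qed.

(** Each factor costs one degree, whichever of its three terms is picked. The slope [mu] serves to
    cancel supports that move linearly with the row. *)
Lemma bcoef_linear_factors m D mu (cs : seq F) b c :
  polyfun m (b + c + size cs) (fun t => \sum_(j < D.+1) bcoef m D t j *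
    (j%:R ^+ b * t%:R ^+ c * \prod_(x <- cs) (j%:R - mu * t%:R - x))).
Proof.
elim: cs b c => [|x cs IHcs] b c /=.
  rewrite addn0; elim: c => [|c IHc].
    rewrite addn0; apply: polyfun_ext (bcoef_moment m D b) => t _.
    by apply: eq_bigr => j _; rewrite big_nil expr0 !mulr1.
  rewrite addnS; apply: polyfun_ext (polyfun_mulX IHc) => t _.
  rewrite mulr_sumr; apply: eq_bigr => j _.
  by rewrite big_nil !mulr1 exprS; move: (bcoef _ _ _ _) => q; ring.
have H1 := IHcs b.+1 c; have H2 := polyfunZ (- mu) (IHcs b c.+1).
have H3 := polyfun_widen (leqnSn _) (polyfunZ (- x) (IHcs b c)).
rewrite !(addSn, addnS) in H1 H2 H3; rewrite addnS.
apply: polyfun_ext (polyfunD (polyfunD H1 H2) H3) => t _ /=.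
rewrite !mulr_sumr -!big_split /=; apply: eq_bigr => j _.
rewrite big_cons !exprS; move: (\prod_(_ <- _) _) (bcoef _ _ _ _) => p q.
move: (t%:R) (j%:R) => {}t {}j; ring.
Qed.

Variable N : nat -> nat.
Hypothesis lamN : forall k s x, (s < N k)%N -> lam ((E ^+ k)`_s * x) = 0.

Lemma bcoef_supp m D t j : (t <= m)%N -> (j <= D)%N ->
  bcoef m D t j != 0 -> (N t <= j)%N /\ (N (m - t) + j <= D)%N.
Proof.
move=> tm jD nz; split.
  by rewrite leqNgt; apply: contraNN nz => jN; rewrite /bcoef mulrC lamN.
rewrite leqNgt; apply: contraNN nz => DN; rewrite /bcoef lamN //; lia.
Qed.

(** Induction on s: the rows t < s vanish, and by symmetry the rows t > m - s, which makes 2s zeros.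
    Row s has at most 2s places, so fewer than 2s linear factors isolate one of them, and the
    resulting polynomial in t has more zeros than its degree allows. *)
Lemma bcoef_zero m D s : (s.*2 <= m)%N ->
    (forall t, (t <= s)%N -> (D < N (m - t) + N t + t.*2)%N) ->
  forall j, (j <= D)%N -> bcoef m D s j = 0.
Proof.
elim/ltn_ind: s => s IHs sm HD j0 j0D.
have low t j : (t < s)%N -> (j <= D)%N -> bcoef m D t j = 0.
  by move=> ts; apply: IHs => //; [lia | move=> t' ?; apply: HD; lia].
have high t j : (m - s < t <= m)%N -> (j <= D)%N -> bcoef m D t j = 0.
  move=> /andP[mt tm] jD; rewrite -bcoef_rev //; apply: low; lia.
apply/eqP/negPn/negP => nz.
have s_le_m : (s <= m)%N by lia.
have [Nj0 Dj0] := bcoef_supp s_le_m j0D nz.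
(* The places of row [s] that may be nonzero, except [j0]. *)
pose js := rem j0 (iota (N s) (D - N (m - s) - N s).+1).
have mem_js j : (j \in js) = (j != j0) && (N s <= j < N s + (D - N (m - s) - N s).+1)%N.
  by rewrite mem_rem_uniq ?iota_uniq // inE mem_iota.
have size_js : (size js < s.*2)%N.
  rewrite size_rem ?size_iota ?mem_iota; last lia.
  by have := HD s (leqnn s); lia.
pose B t := \sum_(j < D.+1) bcoef m D t j *
   (j%:R ^+ 0 * t%:R ^+ 0 * \prod_(x <- [seq k%:R | k <- js]) (j%:R - 0 * t%:R - x)).
have Bs0 : B s = 0.
  apply: (@polyfun_zero F m _ B (iota 0 s ++ iota (m - s).+1 s)
            (bcoef_linear_factors m D 0 [seq k%:R | k <- js] 0 0)).
  - rewrite cat_uniq !iota_uniq /= andbT; apply/hasPn => t.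
    by rewrite !mem_iota; lia.
  - by rewrite !add0n size_map size_cat !size_iota addnn.
  - move=> t; rewrite mem_cat !mem_iota => ts; split; first lia.
    apply: big1 => j _; have jD : (j <= D)%N by rewrite -ltnS.
    by case/orP: ts => ts; [rewrite low | rewrite high]; rewrite ?mul0r //; lia.
  - lia.
move: Bs0; rewrite /B (bigD1 (inord j0)) //= inordK // [X in _ + X]big1 ?addr0 => [|j nj].
  move=> /eqP; rewrite mulf_eq0 (negbTE nz) /= !expr0 !mul1r big_map.
  rewrite prodf_seq_eq0 => /hasP[k]; rewrite mem_js => /andP[kj _] /=.
  by rewrite mul0r subr0 subr_eq0 eqr_nat eq_sym (negbTE kj).
apply/eqP; rewrite mulf_eq0; have [//|nzj] := eqVneq (bcoef _ _ _ _) 0.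
have jD : (j <= D)%N by rewrite -ltnS.
have [|Nj Dj] := bcoef_supp _ jD nzj; first lia.
rewrite !expr0 !mul1r big_map prodf_seq_eq0; apply/orP; right; apply/hasP.
exists (val j) => /=; last by rewrite mul0r subr0 subrr.
rewrite mem_js; apply/andP; split; last lia.
by apply: contraNneq nj => <-; rewrite inord_val.
Qed.

(** Rows p, ..., p + s live in windows of 2p + s places sliding with slope mu; row t1 has one place
    more, [top]. Cancelling the windows takes 2p + s factors, so the sum has degree at most 2p + s
    in t, while it has p low, p high and s + 1 middle zeros. Hence it vanishes at t1, where [top]
    alone contributes. *)
Lemma bcoef_top_zero m D mu a p s t1 top :
    (p + s <= t1)%N -> (t1 <= m)%N -> (m - t1 = p)%N ->
    (forall t j, (t < p)%N -> (j <= D)%N -> bcoef m D t j = 0) ->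
    (forall r j, (r <= s)%N -> (j <= D)%N -> bcoef m D (p + r) j != 0 ->
       (a + mu * r <= j < a + mu * r + p.*2 + s)%N) ->
    (forall j, (j <= D)%N -> bcoef m D t1 j != 0 ->
       (a + mu * (t1 - p) <= j <= a + mu * (t1 - p) + p.*2 + s)%N) ->
    (top = a + mu * (t1 - p) + p.*2 + s)%N -> (top <= D)%N ->
  bcoef m D t1 top = 0.
Proof.
move=> pst tm mtp low mid top_range topE topD.
have high t j : (t1 < t <= m)%N -> (j <= D)%N -> bcoef m D t j = 0.
  by move=> /andP[mt tm'] jD; rewrite -bcoef_rev //; apply: low; lia.
(* Chosen so that at row t the roots fill the window starting at a + mu (t - p). *)
pose cs : seq F := [seq a%:R - mu%:R * p%:R + l%:R | l <- iota 0 (p.*2 + s)].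
pose B t := \sum_(j < D.+1) bcoef m D t j *
   (j%:R ^+ 0 * t%:R ^+ 0 * \prod_(x <- cs) (j%:R - mu%:R * t%:R - x)).
have factors (t j : nat) : (p <= t)%N ->
    (a + mu * (t - p) <= j < a + mu * (t - p) + p.*2 + s)%N ->
    \prod_(x <- cs) (j%:R - mu%:R * t%:R - x) = 0 :> F.
  move=> pt jr; apply/eqP; rewrite big_map prodf_seq_eq0; apply/hasP.
  exists (j - (a + mu * (t - p)))%N; first by rewrite mem_iota; lia.
  rewrite /= natrB ?natrD ?natrM ?natrB //; last by case/andP: jr.
  by apply/eqP; ring.
have B0 : B t1 = 0.
  apply: (@polyfun_zero F m _ B (iota 0 (p + s).+1 ++ iota t1.+1 p)
            (bcoef_linear_factors m D mu%:R cs 0 0)).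
  - rewrite cat_uniq !iota_uniq andbT andTb; apply/hasPn => t.
    by rewrite !mem_iota; lia.
  - by rewrite !add0n size_map size_cat !size_iota; lia.
  - move=> t; rewrite mem_cat !mem_iota => ts; split; first lia.
    apply: big1 => j _; have jD : (j <= D)%N by rewrite -ltnS.
    have [tp|pt] := ltnP t p; first by rewrite low ?mul0r.
    have [t1t|tt1] := ltnP t1 t; first by rewrite high ?mul0r //; lia.
    have tr : t = (p + (t - p))%N by lia.
    have [->|nz] := eqVneq (bcoef m D t j) 0; first by rewrite mul0r.
    rewrite factors ?mulr0 //; apply: mid => //; first lia.
    by rewrite -tr.
  - by [].
have [//|nz] := eqVneq (bcoef m D t1 top) 0.
move: B0; rewrite /B (bigD1 (inord top)) //= inordK ?ltnS // [X in _ + X]big1 ?addr0 => [|j nj].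
  move=> /eqP; rewrite mulf_eq0 (negbTE nz) /= !expr0 !mul1r big_map.
  rewrite prodf_seq_eq0 => /hasP[l]; rewrite mem_iota => lr /=.
  rewrite (_ : _ - _ = (p.*2 + s - l)%:R).
    by rewrite pnatr_eq0; lia.
  rewrite topE natrB; last lia.
  rewrite -!addnA !natrD natrM natrB; last lia.
  by move: (a%:R) (mu%:R) (p%:R) (t1%:R) => {}a' {}mu' p' t'; ring.
have jD : (j <= D)%N by rewrite -ltnS.
have [->|nzj] := eqVneq (bcoef m D t1 j) 0; first by rewrite mul0r.
rewrite factors ?mulr0 //; first lia.
have := top_range j jD nzj; rewrite -topE.
have : val j != top by apply: contraNneq nj => <-; rewrite inord_val.
by rewrite /=; lia.
Qed.

End Interpolation.

(** * Product identities behind the dimension recursions *)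

Lemma pair_split_prod (g b d P : nat) : (0 < g)%N -> (g <= b)%N -> (b <= d)%N ->
  ((b - g) * (d.+1 * P) + g.-1 * (b.+1 * (d * P)) + (g + d - b) * P =
   g * (b * (d * P)))%N.
Proof.
case: g => // g _ gb bd.
have [x bE] : exists x, b = (g.+1 + x)%N by exists (b - g.+1)%N; lia.
have [y dE] : exists y, d = (b + y)%N by exists (d - b)%N; lia.
have -> : (g.+1 + d - b = g.+1 + y)%N by lia.
rewrite dE bE addKn /=; ring.
Qed.

Lemma double_split_prod (g b d P Q : nat) : (0 < g)%N -> (g < b)%N -> (b <= d)%N ->
  (g.-1 * Q * (g.+1 * (b * (d * P))) + b.-1 * (d.+1 * (Q * P)) +
     g * Q * ((g + d - b) * P) =
   g * Q * (g * (b * (d * P))) + g.-1 * Q * ((g.+1 + d - b) * P))%N.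
Proof.
case: g => // g _ gb bd.
have [x bE] : exists x, b = (g.+2 + x)%N by exists (b - g.+2)%N; lia.
have [y dE] : exists y, d = (b + y)%N by exists (d - b)%N; lia.
have -> : (g.+1 + d - b = g.+1 + y)%N by lia.
have -> : (g.+2 + d - b = g.+2 + y)%N by lia.
rewrite dE bE /=; ring.
Qed.

Lemma smallest_split_prod (a e R : nat) : (0 < a <= e)%N ->
  (a.-1 * (e.+1 * R) + (e - a).+1 * R = a * (e * R))%N.
Proof.
case: a => // a /andP[_ ae].
have [x ->] : exists x, e = (a.+1 + x)%N by exists (e - a.+1)%N; lia.
rewrite addKn /=; ring.
Qed.

Lemma double_split_lt (g Q R : nat) : (0 < g)%N -> (0 < Q)%N -> (0 < R)%N ->
  (g.-1 * Q * (g.+1 * R) < g * Q * (g * R))%N.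
Proof.
case: g => // g _ Q0 R0 /=.
have -> : (g.+1 * Q * (g.+1 * R) = g * Q * (g.+2 * R) + Q * R)%N by ring.
by rewrite -[ltnLHS]addn0 ltn_add2l muln_gt0 Q0.
Qed.

(** This is [smallest_split_prod] at e = g + d - b, read as an inequality. *)
Lemma smallest_shift_bound (a g b d P : nat) :
  (0 < a)%N -> (a < g)%N -> (g < b)%N -> (b <= d)%N ->
  (a * ((g + d - b) * P) <=
   a.-1 * ((g.+1 + d - b) * P) + ((g - a).+1 + d - b) * P)%N.
Proof.
case: a => // a _ ag gb bd; rewrite !mulnA -mulnDl leq_mul2r; apply/orP; right.
have [x gE] : exists x, g = (a.+2 + x)%N by exists (g - a.+2)%N; lia.
have [y dE] : exists y, d = (b + y)%N by exists (d - b)%N; lia.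
have -> : (g + d - b = a.+2 + x + y)%N by lia.
have -> : (g.+1 + d - b = a.+3 + x + y)%N by lia.
have -> : ((g - a.+1).+1 + d - b = x.+2 + y)%N by lia.
by rewrite /=; nia.
Qed.

(** * Dimension estimates for cyclic modules *)

Lemma NA_cat A B k : NA (A ++ B) k = (NA A k + NA B k)%N.
Proof. by rewrite /NA big_cat. Qed.

Lemma NA_cons a A k : NA (a :: A) k = (k.+1 - a + NA A k)%N.
Proof. by rewrite /NA big_cons. Qed.

Lemma NA_nil k : NA [::] k = 0%N.
Proof. by rewrite /NA big_nil. Qed.

Lemma NA_perm A B k : perm_eq A B -> NA A k = NA B k.
Proof. by move=> AB; rewrite /NA (perm_big _ AB). Qed.

Lemma NA_addr A x y : all (fun a => a <= x.+1)%N A ->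
  NA A (x + y) = (NA A x + size A * y)%N.
Proof.
elim: A => [|a A IHA] /=; first by rewrite !NA_nil.
by move=> /andP[ax /IHA IH]; rewrite !NA_cons IH; lia.
Qed.

Lemma NA_le_addr A x y : (NA A (x + y) <= NA A x + size A * y)%N.
Proof.
elim: A => [|a A IHA] /=; first by rewrite !NA_nil.
by rewrite !NA_cons; lia.
Qed.

Lemma NA_mono A x y : (x <= y)%N -> (NA A x <= NA A y)%N.
Proof.
move=> xy; elim: A => [|a A IHA]; first by rewrite !NA_nil.
by rewrite !NA_cons; lia.
Qed.

Lemma NA_eq0 A x : all (fun a => x < a)%N A -> NA A x = 0%N.
Proof.
elim: A => [|a A IHA] /=; first by rewrite NA_nil.
by move=> /andP[ax /IHA IH]; rewrite NA_cons IH; lia.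
Qed.

(* Convexity of NA: the pair (t, k + q - t) majorizes (k, q). *)
Lemma NA_convex A k q t : (t <= k)%N -> (t <= q)%N ->
  (NA A k + NA A q <= NA A (k + q - t) + NA A t)%N.
Proof.
move=> tk tq; elim: A => [|a A IHA]; first by rewrite !NA_nil.
by rewrite !NA_cons; lia.
Qed.

(** * Membership in a subspace tested by linear functionals *)

Section Separation.
Variables (F : fieldType) (W : vectType F).

(** The coordinates of the projection to a complement of [Z] are functionals vanishing on [Z], so
    all of them are zero at [u]. *)
Lemma mem_of_functionals (Z : {vspace W}) (u : W) :
  (forall l : 'Hom(W, F^o), (forall z, z \in Z -> l z = 0) -> l u = 0) -> u \in Z.
Proof.
move=> H; pose C := (Z^C)%VS.
have ZC : (Z :&: C)%VS = 0%VS := capv_compl Z.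
have CZ : (C :&: Z)%VS = 0%VS by rewrite capvC.
have uE : daddv_pi Z C u + daddv_pi C Z u = u.
  by apply: daddv_pi_add => //; rewrite addv_complf memvf.
suff pu : daddv_pi C Z u = 0 by rewrite -uE pu addr0 memv_pi.
rewrite (coord_vbasis (memv_pi C Z u : _ \in C)) big1 // => i _.
pose c : W -> F^o := coord (vbasis C) i.
have cl : linear c by move=> a x y; rewrite /c linearP.
pose cL : {linear W -> F^o} := HB.pack c (GRing.isLinear.Build F W F^o _ c cl).
have := H (linfun cL \o daddv_pi C Z)%VF.
rewrite comp_lfunE lfunE /= /c => ->; first by rewrite scale0r.
move=> z zZ; rewrite comp_lfunE lfunE /= /c.
suff -> : daddv_pi C Z z = 0 by rewrite linear0.
have := daddv_pi_add ZC (_ : z \in (Z + C)%VS).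
rewrite addv_complf memvf => /(_ isT); rewrite (daddv_pi_id ZC zZ).
by move/(congr1 (fun x => x - z)); rewrite addrAC subrr add0r.
Qed.
End Separation.

(** * Cyclic modules over a commutative ring, modulo a stable subspace *)

Section CyclicModules.
Variables (F : numFieldType) (S : comNzRingType) (W : vectType F).
Variable ac : S -> 'End(W).
Hypothesis acD : forall a b u, ac (a + b) u = ac a u + ac b u.
Hypothesis acM : forall a b u, ac (a * b) u = ac a (ac b u).
Hypothesis ac1 : forall u, ac 1 u = u.

Lemma acC a b u : ac a (ac b u) = ac b (ac a u).
Proof. by rewrite -!acM mulrC. Qed.

Lemma ac0 u : ac 0 u = 0.
Proof. by apply: (@addrI _ (ac 0 u)); rewrite -acD !addr0. Qed.

Lemma acN a u : ac (- a) u = - ac a u.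
Proof. by apply/eqP; rewrite -addr_eq0 -acD addNr ac0. Qed.

Lemma acMn a k u : ac (a *+ k) u = ac a u *+ k.
Proof. by elim: k => [|k IHk]; rewrite ?mulr0n ?ac0 // !mulrS acD IHk. Qed.

Lemma ac_sum (I : Type) (r : seq I) (P : pred I) (f : I -> S) u :
  ac (\sum_(i <- r | P i) f i) u = \sum_(i <- r | P i) ac (f i) u.
Proof. by apply: (big_morph (fun a => ac a u)) => [a b|]; rewrite ?acD ?ac0. Qed.

Definition stab (Z : {vspace W}) := forall g u, u \in Z -> ac g u \in Z.

(** Relations are stated modulo [Z], so that the inductions pass to quotients by enlarging [Z],
    without forming quotient modules. *)
Definition satisfies (E : {poly S}) (N : nat -> nat) (Z : {vspace W}) (v : W) :=
  forall k s, (s < N k)%N -> ac (E ^+ k)`_s v \in Z.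

Lemma satisfies_le E (N N' : nat -> nat) Z v :
  (forall k, N' k <= N k)%N -> satisfies E N Z v -> satisfies E N' Z v.
Proof. by move=> le H k s /leq_trans-/(_ _ (le k)) /H. Qed.

Lemma bcoef_functional (l : 'Hom(W, F^o)) v : exists lam : {additive S -> F},
  forall a, lam a = l (ac a v).
Proof.
pose f a : F := l (ac a v).
have fB : zmod_morphism f.
  by move=> a b; rewrite /f acD acN linearB.
pose lam : {additive S -> F} := HB.pack f (GRing.isZmodMorphism.Build S F f fB).
by exists lam.
Qed.

(** A functional on [W] is pulled back to the ring along a -> a v. If it vanishes on the stable [Z],
    the pullback kills all multiples of the relations, which is the hypothesis of the interpolation
    lemmas. *)
Lemma mem_of_bcoef E (Z : {vspace W}) v (N : nat -> nat) a :
    stab Z -> satisfies E N Z v ->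
    (forall lam : {additive S -> F},
       (forall k s x, (s < N k)%N -> lam ((E ^+ k)`_s * x) = 0) -> lam a = 0) ->
  ac a v \in Z.
Proof.
move=> sZ sat H; apply: mem_of_functionals => l lZ.
have [lam lamE] := bcoef_functional l v; rewrite -lamE; apply: H => k s x sN.
by rewrite lamE mulrC acM lZ //; apply/sZ/sat.
Qed.

(* The vector [E^k]_(N k) v satisfies at index q the bound given by the two-row
   minimum over t of N (k + q - t) + N t + 2t. *)
Lemma satisfies_coef E N T Z v k : stab Z -> satisfies E N Z v ->
    (forall q t, (t <= k)%N -> (t <= q)%N -> (0 < T q)%N ->
       (N k + T q <= N (k + q - t) + N t + t.*2)%N) ->
  satisfies E T Z (ac (E ^+ k)`_(N k) v).
Proof.
move=> sZ sat HT q j jT; rewrite acC -acM.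
apply: (mem_of_bcoef sZ sat) => lam lamN.
have Tpos : (0 < T q)%N by lia.
(* [bcoef_zero] asks for a row in the lower half, so the smaller of [q] and [k] becomes the row
   index. *)
have [qk|kq] := leqP q k.
  have -> : lam ((E ^+ k)`_(N k) * (E ^+ q)`_j) = bcoef lam E (k + q) (N k + j) q j.
    by rewrite /bcoef !addnK.
  apply: (bcoef_zero lamN); rewrite ?leq_addl //; first lia.
  by move=> t tq; have := HT q t; lia.
have -> : lam ((E ^+ k)`_(N k) * (E ^+ q)`_j) =
          bcoef lam E (k + q) (N k + j) k (N k).
  by rewrite /bcoef !addKn mulrC.
apply: (bcoef_zero lamN); rewrite ?leq_addr //; first lia.
by move=> t tk; have := HT q t; lia.
Qed.

Definition cyc (Z : {vspace W}) (v : W) : {vspace W} :=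
  vspan (fun u => u \in Z \/ exists g, u = ac g v).

Lemma cyc_sub Z v : (Z <= cyc Z v)%VS.
Proof. by apply/subvP => u uZ; have [+ _] := vspanP (fun u => u \in Z \/ exists g, u = ac g v); apply; left. Qed.

Lemma cyc_ac Z v g : ac g v \in cyc Z v.
Proof. by have [+ _] := vspanP (fun u => u \in Z \/ exists g, u = ac g v); apply; right; exists g. Qed.

Lemma cyc_id Z v : v \in cyc Z v.
Proof. by rewrite -{1}[v]ac1 cyc_ac. Qed.

Lemma cyc_min Z v (U : {vspace W}) :
  stab U -> (Z <= U)%VS -> v \in U -> (cyc Z v <= U)%VS.
Proof.
move=> sU /subvP ZU vU.
have [_ +] := vspanP (fun u => u \in Z \/ exists g, u = ac g v); apply=> u.
by case=> [/ZU //|[g ->]]; apply: sU.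
Qed.

Lemma cyc_stab Z v : stab Z -> stab (cyc Z v).
Proof.
move=> sZ g u uC; rewrite memv_preim; apply: subvP uC.
have [_ +] := vspanP (fun u => u \in Z \/ exists g, u = ac g v); apply=> {}u.
rewrite -memv_preim; case=> [uZ|[h ->]]; last by rewrite -acM cyc_ac.
by apply: (subvP (cyc_sub Z v)); apply: sZ.
Qed.

Lemma cyc_trans Z v w : stab Z -> (cyc Z v <= cyc (cyc Z w) v)%VS.
Proof.
move=> sZ; apply: cyc_min; last exact: cyc_id.
  by do 2!apply: cyc_stab.
exact: subv_trans (cyc_sub Z w) (cyc_sub _ _).
Qed.

Variables (n : nat) (Y : nat -> S).
Hypothesis stab_gen : forall U : {vspace W},
  (forall p u, (p < n)%N -> u \in U -> ac (Y p) u \in U) -> stab U.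

(** When Y p acts as e_(n-1-p), this is e_(n-j)(z), the series in the variables from [j] on. *)
Definition current (j : nat) : {poly S} := \poly_(p < n - j) Y (j + p).

Lemma current_rec j : (j < n)%N -> current j = (Y j)%:P + 'X * current j.+1.
Proof.
move=> jn; apply/polyP => p; rewrite coefD coefC coefXM !coef_poly.
case: p => [|p] /=; first by rewrite subn_gt0 jn addn0 addr0.
by rewrite add0r subnS -ltn_predRL addSnnS.
Qed.

Lemma current_coef0 j k : (j < n)%N -> (current j ^+ k)`_0 = Y j ^+ k.
Proof.
move=> jn; elim: k => [|k IHk]; first by rewrite !expr0 coef1.
by rewrite !exprS coef0M IHk coef_poly subn_gt0 jn addn0.
Qed.

Lemma current_coef j k s : (j < n)%N -> (current j ^+ k)`_s =
  \sum_(i < k.+1) (if (i <= s)%N then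
     Y j ^+ (k - i) * (current j.+1 ^+ i)`_(s - i) else 0) *+ 'C(k, i).
Proof.
move=> jn; rewrite (current_rec jn) exprDn coef_sum; apply: eq_bigr => i _.
rewrite coefMn; congr (_ *+ _); rewrite -polyC_exp coefCM exprMn coefXnM.
by rewrite ltnNge; case: leqP; rewrite ?mulr0.
Qed.

(** In the binomial expansion of (Y j + X E')^k, with E' the next current, a term with fewer than k
    - s factors [Y j] starts above degree s. *)
Lemma current_coef_low j k s : (j < n)%N -> (s <= k)%N ->
  exists c, (current j ^+ k)`_s = Y j ^+ (k - s) * c.
Proof.
move=> jn sk; rewrite current_coef //.
exists (\sum_(i < k.+1) (if (i <= s)%N then
     Y j ^+ (s - i) * (current j.+1 ^+ i)`_(s - i) else 0) *+ 'C(k, i)).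
rewrite mulr_sumr; apply: eq_bigr => i _; rewrite mulrnAr; congr (_ *+ _).
case: leqP => is_; rewrite ?mulr0 // mulrA -exprD; congr (_ ^+ _ * _); lia.
Qed.

(* When Y j kills v modulo Z the current loses its constant term, i.e. it acts
   as 'X * current j.+1. *)
Lemma satisfies_shift j N (Z : {vspace W}) v : (j < n)%N -> stab Z ->
    ac (Y j) v \in Z ->
    satisfies (current j) (fun k => k + N k)%N Z v ->
  satisfies (current j.+1) N Z v.
Proof.
move=> jn sZ yZ sat k s sN.
have := sat k (k + s)%N; rewrite ltn_add2l => /(_ sN).
rewrite current_coef // big_ord_recr /= leq_addr subnn mul1r addKn binn mulr1n.
rewrite acD rpredDl // ac_sum rpred_sum // => i _; rewrite acMn rpredMn //.
case: leqP => _; last by rewrite ac0 mem0v.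
rewrite -(subnSK (ltn_ord i)) exprSr mulrC mulrA acM.
exact: sZ yZ.
Qed.

Lemma cyc_nil Z v : stab Z -> (forall p, (p < n)%N -> ac (Y p) v \in Z) ->
  (\dim (cyc Z v) <= (\dim Z).+1)%N.
Proof.
move=> sZ YZ; have : (cyc Z v <= Z + <[v]>)%VS.
  apply: cyc_min; last by rewrite memvE addvSr.
    apply: stab_gen => p u pn /memv_addP[z zZ [_ /vlineP[c ->] ->]].
    rewrite linearD linearZ /= rpredD //.
      by apply: (subvP (addvSl _ _)); apply: sZ.
    by apply: (subvP (addvSl _ _)); rewrite rpredZ // YZ.
  exact: addvSl.
move=> /dimvS /leq_trans; apply; apply: leq_trans (dimv_add_leqif _ _) _.
by rewrite -addn1 leq_add2l dim_vline; case: eqP.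
Qed.

Definition annihilated (j : nat) (Z : {vspace W}) (v : W) :=
  forall p, (p < j)%N -> ac (Y p) v \in Z.

Lemma annihilated_sub j (Z Z' : {vspace W}) v :
  (Z <= Z')%VS -> annihilated j Z v -> annihilated j Z' v.
Proof. by move=> /subvP le H p /H /le. Qed.

Lemma annihilated_ac j Z v g :
  stab Z -> annihilated j Z v -> annihilated j Z (ac g v).
Proof. by move=> sZ H p /H; rewrite acC; apply: sZ. Qed.

Lemma annihilatedS j Z v :
  annihilated j Z v -> ac (Y j) v \in Z -> annihilated j.+1 Z v.
Proof. by move=> H yZ p; rewrite ltnS leq_eqVlt => /predU1P[->//|/H]. Qed.

Lemma cyc_dim_trans Z v w d1 d2 : stab Z ->
    (\dim (cyc Z w) <= \dim Z + d1)%N ->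
    (\dim (cyc (cyc Z w) v) <= \dim (cyc Z w) + d2)%N ->
  (\dim (cyc Z v) <= \dim Z + (d1 + d2))%N.
Proof.
move=> sZ H1 H2; apply: leq_trans (dimvS (cyc_trans v w sZ)) _.
by apply: leq_trans H2 _; rewrite addnA leq_add2r.
Qed.

Lemma cyc_mem Z v : stab Z -> v \in Z -> (\dim (cyc Z v) <= \dim Z)%N.
Proof. by move=> sZ vZ; apply/dimvS/cyc_min => //; apply: subvv. Qed.

Lemma ex_minimal_split (A : seq nat) : A != [::] ->
  exists a L, perm_eq A (a :: L) /\ all (fun b => a <= b)%N L.
Proof.
elim: A => // a [|b A] IHA _; first by exists a, [::].
have [c [L [pL cL]]] := IHA isT.
have [ac'|ca] := leqP a c.
  exists a, (b :: A); split=> //; rewrite (perm_all _ pL) /= ac' /=.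
  by apply: sub_all cL => x; apply: leq_trans.
exists c, (a :: L); split; last by rewrite /= (ltnW ca).
by rewrite -(perm_cons a) in pL; rewrite (perm_trans pL) // (perm_catCA [:: a] [:: c] L).
Qed.

Lemma prod_perm (A B : seq nat) : perm_eq A B -> (\prod_(a <- A) a = \prod_(a <- B) a)%N.
Proof. by move=> AB; rewrite (perm_big _ AB). Qed.

(* Passing from A = a, e, L to a-1, e+1, L adds to the ideal the lowest nonzero
   coefficients of the k-th powers with a-1 <= k < e, all multiples of Y j ^ (a-1). *)
Lemma satisfies_quotient j N Z v a e L (w := ac (Y j ^+ a.-1) v) :
    (j < n)%N -> (0 < a <= e)%N -> all (fun b => e <= b)%N L -> stab Z ->
    (forall k, NA [:: a, e & L] k <= N k)%N ->
    satisfies (current j) N Z v ->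
  forall k s, (s < NA [:: a.-1, e.+1 & L] k)%N ->
    ac (current j ^+ k)`_s v \in cyc Z w.
Proof.
move=> jn /andP[a0 ae] eL sZ NN sat k s.
have [sN _|Ns] := ltnP s (N k); first exact: (subvP (cyc_sub _ _)) _ (sat _ _ sN).
have := leq_trans (NN k) Ns; rewrite !NA_cons => H1 H2.
have ke : (k < e)%N by lia.
have L0 : NA L k = 0%N by apply: NA_eq0; apply: sub_all eL => b; apply: leq_trans.
have sE : s = (k.+1 - a)%N by lia.
have [||c ->] := @current_coef_low j k s; [by []|lia|].
rewrite mulrC acM -/w; apply: cyc_stab => //.
have -> : (k - s = a.-1)%N by lia.
exact: cyc_id.
Qed.

(** As N(a-1) = 0, w is [E^(a-1)]_(N(a-1)) v for the current E, so [satisfies_coef] applies; N(a) >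
    0 puts Y j ^ a v in [Z], and one variable is dropped at the price of q degrees. The summand [M]
    makes room for the additional relation of the second estimate. *)
Lemma satisfies_kernel j N Z v a e L (w := ac (Y j ^+ a.-1) v) (M : nat -> nat) :
    (j < n)%N -> (0 < a)%N -> stab Z ->
    satisfies (current j) N Z v -> (0 < N a)%N -> N a.-1 = 0%N ->
    (forall q t, (t < a)%N -> (t <= q)%N ->
       (q + NA ((e - a).+1 :: L) q + M q <= N (a.-1 + q - t) + N t + t.*2)%N) ->
  ac (Y j) w \in Z /\
  satisfies (current j.+1) (fun q => NA ((e - a).+1 :: L) q + M q)%N Z w.
Proof.
move=> jn a0 sZ sat Na Na1 HN.
have yZ : ac (Y j) w \in Z.
  by rewrite /w -acM -exprS prednK // -(current_coef0 _ jn) sat.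
split=> //; apply: satisfies_shift => //.
have -> : w = ac (current j ^+ a.-1)`_(N a.-1) v by rewrite Na1 current_coef0.
apply: satisfies_coef => // q t ta tq _; rewrite Na1.
by have := HN q t; lia.
Qed.

(** For the two smallest entries a <= e take w = Y j ^ (a-1) v. Modulo w the relations become those
    of a-1, e+1, L, while w satisfies those of e-a+1, L in one variable fewer; the two bounds add up
    to the product. *)
Theorem dim_cyc_le (A : seq nat) j Z v : (size A + j = n)%N -> stab Z ->
    annihilated j Z v -> satisfies (current j) (NA A) Z v ->
  (\dim (cyc Z v) <= \dim Z + \prod_(a <- A) a)%N.
Proof.
have [m] := ubnP (\prod_(a <- A) a + size A)%N.
elim: m A j Z v => // m IHm A j Z v Am szA sZ aZ sat.
have [A0|] := eqVneq A [::].
  rewrite A0 big_nil addn1; apply: cyc_nil => // p pn; apply: aZ.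
  by rewrite -szA A0 in pn.
move=> /ex_minimal_split[a [L [pA aL]]].
rewrite (prod_perm pA) (perm_size pA) /= in Am szA *.
have jn : (j < n)%N by lia.
have {}sat : satisfies (current j) (NA (a :: L)) Z v.
  by move=> k s; rewrite -(NA_perm _ pA); apply: sat.
(* An entry 0 activates the relation k = s = 0, which says that v lies in [Z]. *)
have [a0|a0] := posnP a.
  rewrite big_cons a0 mul0n addn0; apply: cyc_mem => //.
  by have := sat 0%N 0%N; rewrite expr0 coef1 ac1; apply; rewrite NA_cons a0.
case: (L =P [::]) => [L0|/eqP/ex_minimal_split[e [L' [pL eL]]]].
  (* One variable is left: the current is the constant [Y j], and each application of it lowers [a]
     by one for one dimension. *)
  subst L; pose w := ac (Y j) v.
  have H1 : (\dim (cyc Z w) <= \dim Z + \prod_(b <- [:: a.-1]) b)%N.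
    apply: (IHm _ j) => //; first by move: Am; rewrite !big_seq1 /=; lia.
      exact: annihilated_ac.
    move=> k s sN; rewrite /w acC -acM.
    have curE : current j = (Y j)%:P.
      apply/polyP => p; rewrite coef_poly coefC -szA addnK.
      by case: p => [|p] //=; rewrite addn0.
    have -> : Y j * (current j ^+ k)`_s = (current j ^+ k.+1)`_s.
      by rewrite exprS {2}curE coefCM.
    by apply: sat; move: sN; rewrite !NA_cons !NA_nil; lia.
  rewrite !big_seq1 in H1 *.
  have -> : a = (a.-1 + 1)%N by lia.
  apply: cyc_dim_trans (H1) _ => //; rewrite addn1.
  apply: cyc_nil; first exact: cyc_stab.
  move=> p; rewrite -szA /= add1n ltnS leq_eqVlt => /predU1P[->|pj].
    exact: cyc_id.
  by apply: (subvP (cyc_sub _ _)); apply: aZ.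
have pAe : perm_eq (a :: L) [:: a, e & L'] by rewrite perm_cons.
have ae : (a <= e)%N by have := aL; rewrite (perm_all _ pL) /= => /andP[].
rewrite (prod_perm pAe) !big_cons (perm_size pL) /= in Am szA *.
have {}sat : satisfies (current j) (NA [:: a, e & L']) Z v.
  by move=> k s; rewrite -(NA_perm _ pAe); apply: sat.
have NA0 x : (x < a)%N -> NA [:: a, e & L'] x = 0%N.
  move=> xa; apply: NA_eq0; rewrite /= xa (leq_trans xa) //=.
  by apply: sub_all eL => b; apply: leq_trans; apply: leq_trans xa ae.
pose w := ac (Y j ^+ a.-1) v.
have NLt q t : (t < a)%N -> (t <= q)%N -> (NA L' q <= NA L' (a.-1 + q - t))%N.
  by move=> ta tq; apply: NA_mono; lia.
have [yw satw] : ac (Y j) w \in Z /\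
    satisfies (current j.+1) (fun q => NA ((e - a).+1 :: L') q + 0)%N Z w.
  apply: satisfies_kernel sat _ _ _ => //; first by rewrite NA_cons; lia.
    by apply: NA0; lia.
  by move=> q t ta tq; have := NLt q t ta tq; rewrite !NA_cons; lia.
have prodE : (a * (e * \prod_(b <- L') b) =
   (e - a).+1 * \prod_(b <- L') b + a.-1 * (e.+1 * \prod_(b <- L') b))%N.
  rewrite !mulnA -mulnDl; congr (_ * _)%N.
  by case: (a) a0 ae => // a' _ ae /=; rewrite -(subnKC ae); lia.
have P0 : (0 < (e - a).+1 * \prod_(b <- L') b)%N.
  rewrite muln_gt0 /= big_seq prodn_cond_gt0 // => b /(allP eL); lia.
rewrite prodE in Am *; apply: (@cyc_dim_trans _ _ w) => //.
  rewrite -(big_cons _ _ _ _ (fun=> true) (fun b => b)).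
  apply: (IHm _ j.+1) => //.
  - by rewrite big_cons /=; move: Am; rewrite -addnA; move: (_ * _)%N (_ * _)%N; lia.
  - by rewrite /= -szA; lia.
  - by apply: annihilatedS => //; apply: annihilated_ac.
  - by apply: satisfies_le satw => k; rewrite addn0.
rewrite -!(big_cons _ _ _ _ (fun=> true) (fun b => b)).
apply: (IHm _ j) => //.
- by rewrite !big_cons /=; move: Am P0; move: (_ * _)%N (_ * _)%N; lia.
- exact: cyc_stab.
- exact: annihilated_sub (cyc_sub _ _) aZ.
- by move=> k s; apply: satisfies_quotient sat _ _ => //; rewrite a0.
Qed.

(** For b - 1 <= q < d this degree is just beyond the reach of [satisfies_coef]. [bcoef_top_zero] is
    applied with p = g - 1, s = q - (b - 1) and slope l + 2, the slope of [NA A] between g - 1 and b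
    - 1. *)
Lemma coef_vanish E Z v g b d L H q (A := [:: g, g, b, d & L ++ H]) :
    stab Z -> (0 < g < b)%N -> (b <= q.+1)%N -> (q < d)%N ->
    all (fun a => a <= g)%N L -> all (fun a => d <= a)%N H ->
    satisfies E (fun k => NA A k + (k == b.-1))%N Z v ->
  ac ((E ^+ g.-1)`_(NA A g.-1) * (E ^+ q)`_(NA A q + g.-1.*2)) v \in Z.
Proof.
move=> sZ /andP[g0 gb] bq qd Lg dH sat.
apply: (mem_of_bcoef sZ sat) => lam lamN.
pose p := g.-1; have gE : g = p.+1 by lia.
rewrite -/p; pose s := (q - b.-1)%N; pose l := size L.
have NAE k : NA A k = ((k.+1 - g) + (k.+1 - g) + (k.+1 - b) + (k.+1 - d) +
                       NA L k + NA H k)%N.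
  by rewrite /A !NA_cons NA_cat !addnA.
have NAL x : NA L (p + x) = (NA L p + l * x)%N.
  by apply: NA_addr; apply: sub_all Lg => a; rewrite gE.
have NAH k : (k < d)%N -> NA H k = 0%N.
  by move=> kd; apply: NA_eq0; apply: sub_all dH => a; apply: leq_trans.
have NAq : NA A q = (NA A p + (l + 2) * (q - p) + s)%N.
  rewrite !NAE !NAH; try lia.
  have -> : NA L q = (NA L p + l * (q - p))%N by rewrite -NAL; congr NA; lia.
  rewrite mulnDl /s; lia.
pose D := (NA A p + (NA A q + p.*2))%N.
have -> : lam ((E ^+ p)`_(NA A p) * (E ^+ q)`_(NA A q + p.*2)) =
          bcoef lam E (p + q) D q (NA A q + p.*2).
  by rewrite /bcoef /D !addnK.
apply: (@bcoef_top_zero F S lam E _ _ (l + 2) (NA A p) p s).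
- by rewrite /s; lia.
- exact: leq_addl.
- by rewrite addnK.
- move=> t j tp jD; apply: (bcoef_zero lamN) => //; first lia.
  move=> t' tt'; rewrite /D.
  have LH : (NA A q + (l + 3) * (p - t') <= NA A (p + q - t'))%N.
    have -> : (p + q - t' = q + (p - t'))%N by lia.
    rewrite !NAE (NAH q) //.
    have -> : NA L (q + (p - t')) = (NA L q + l * (p - t'))%N.
      by apply: NA_addr; apply: sub_all Lg => a; lia.
    rewrite mulnDl; move: (l * _)%N (NA L _) (NA H _) => x y z.
    by clear -gE gb bq qd tt' tp; lia.
  have LT : (NA A p <= NA A t' + l * (p - t'))%N.
    rewrite !NAE !NAH; try lia.
    have := NA_le_addr L t' (p - t'); rewrite subnKC; last lia.
    rewrite -/l; move: (l * _)%N (NA L _) (NA L _) => x y z.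
    by clear -gE gb bq qd tt' tp; lia.
  move: LH LT; rewrite mulnDl; move: (l * _)%N (NA A q) (NA A p) (NA A _) (NA A _) => x y z u w.
  by clear -tt' tp; lia.
- move=> r j rs jD nz; have [|N1 N2] := bcoef_supp lamN _ jD nz; first by rewrite /s in rs; lia.
  have L1 : (NA A p + (l + 2) * r <= NA A (p + r))%N.
    rewrite !NAE NAL (NAH p); last lia.
    rewrite mulnDl; move: (l * _)%N (NA L p) (NA H _) => x y z.
    by clear -gE; lia.
  have L2 : (NA A q = NA A (q - r) + (l + 3) * r)%N.
    rewrite !NAE !NAH; try lia.
    have -> : NA L q = (NA L (q - r) + l * r)%N.
      have {1}-> : q = (q - r + r)%N by rewrite /s in rs; lia.
      by apply: NA_addr; apply: sub_all Lg => a; rewrite /s in rs; lia.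
    rewrite mulnDl; move: (l * _)%N (NA L _) => x y; rewrite /s in rs.
    by clear -gE gb bq qd rs; lia.
  move: N1 N2 L1 L2; rewrite /D.
  have -> : (p + q - (p + r) = q - r)%N by lia.
  (* Row p + r has complementary exponent q - r. Its support fits the window for r < s; for r = s it
     would exceed it by one, but then q - r = b - 1 and the additional relation cuts off that
     place. *)
  have : (r < s)%N || ((r == s)%N && (q - r == b.-1)%N) by rewrite /s in rs *; lia.
  case/orP => [rs'|/andP[/eqP rs' ->]]; rewrite !mulnDl; move: (l * r)%N; lia.
- move=> j jD nz; have [|N1 N2] := bcoef_supp lamN _ jD nz; first exact: leq_addl.
  by move: N1 N2; rewrite addnK /D NAq; move: (_ * _)%N; lia.
- by rewrite NAq; move: (_ * _)%N; lia.
- by rewrite /D leq_addl.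
Qed.

Lemma ex_maximal_split (A : seq nat) : A != [::] ->
  exists a L, perm_eq A (a :: L) /\ all (fun b => b <= a)%N L.
Proof.
elim: A => // a [|b A] IHA _; first by exists a, [::].
have [c [L [pL cL]]] := IHA isT.
have [ca|ac'] := leqP c a.
  exists a, (b :: A); split=> //; rewrite (perm_all _ pL) /= ca /=.
  by apply: sub_all cL => x /leq_trans; apply.
exists c, (a :: L); split; last by rewrite /= (ltnW ac').
by rewrite -(perm_cons a) in pL; rewrite (perm_trans pL) // (perm_catCA [:: a] [:: c] L).
Qed.

Lemma bin_act_mem (Z : {vspace W}) (a : S) v k i :
  (i <= k)%N -> ac (a *+ 'C(k, i)) v \in Z -> ac a v \in Z.
Proof.
move=> ik; rewrite acMn -scaler_nat => H.
have c0 : ('C(k, i)%:R : F) != 0 by rewrite pnatr_eq0 -lt0n bin_gt0.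
by rewrite -[ac a v](scalerK c0) rpredZ.
Qed.

(** The relations of I_A and one more, which kills [E^(b-1)]_(N_A(b-1)), the generator of the
    embedded module when b = a_i. *)
Definition NAplus A b k := (NA A k + (k == b.-1))%N.

Lemma satisfies_perm E A A' b Z v : perm_eq A A' ->
  satisfies E (NAplus A b) Z v -> satisfies E (NAplus A' b) Z v.
Proof. by move=> p sat k s; rewrite /NAplus -(NA_perm k p); apply: sat. Qed.

(** From k = e on, the pairs a, e and a-1, e+1 contribute equally to N, so the relation at k = b - 1
    >= e keeps its degree. *)
Lemma satisfies_quotient_plus j Z v a e b L (w := ac (Y j ^+ a.-1) v) :
    (j < n)%N -> (0 < a <= e)%N -> (e < b)%N -> all (fun c => e <= c)%N L -> stab Z ->
    satisfies (current j) (NAplus [:: a, e & L] b) Z v ->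
  satisfies (current j) (NAplus [:: a.-1, e.+1 & L] b) (cyc Z w) v.
Proof.
move=> jn ae eb eL sZ sat k s sN.
have [sN'|sN'] := ltnP s (NA [:: a.-1, e.+1 & L] k).
  apply: satisfies_quotient sat _ _ sN' => // x; exact: leq_addr.
apply: (subvP (cyc_sub _ _)); apply: sat; move: sN sN'.
by rewrite /NAplus !NA_cons; case: eqP; lia.
Qed.

(** For t < a - 1 the index a - 1 + q - t exceeds q. At q = b - 1 the entry b then contributes at
    least 1 on the right, which pays for the additional unit on the left. *)
Lemma satisfies_kernel_plus j Z v a e b L (w := ac (Y j ^+ a.-1) v) :
    (j < n)%N -> (0 < a <= e)%N -> (e < b)%N -> b \in L ->
    all (fun c => e <= c)%N L -> stab Z ->
    satisfies (current j) (NAplus [:: a, e & L] b) Z v ->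
  ac (Y j) w \in Z /\ satisfies (current j.+1) (NAplus ((e - a).+1 :: L) b) Z w.
Proof.
move=> jn /andP[a0 ae] eb bL eL sZ sat.
have := perm_to_rem bL; move: (rem b L) => L' pL.
have NL x : NA L x = (x.+1 - b + NA L' x)%N by rewrite (NA_perm _ pL) NA_cons.
apply: satisfies_kernel sat _ _ _ => //.
- by rewrite /NAplus NA_cons; lia.
- rewrite /NAplus NA_eq0 /=; first lia.
  apply/and3P; split; [lia|lia|].
  by apply: sub_all eL => x; lia.
move=> q t ta tq; rewrite /NAplus !NA_cons !NL.
have := NA_mono L' (_ : q <= a.-1 + q - t)%N.
have [->|tlt] : t = a.-1 \/ (t < a.-1)%N by lia.
  rewrite addKn => _; move: (NA L' q) (nat_of_bool (q == b.-1)) => x y.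
  by clear -a0 ae; lia.
have x0 : (a.-1 + q - t = (a.-1 - t) + q)%N by lia.
rewrite x0 => /(_ (leq_addl _ _)); have u0 : (0 < a.-1 - t)%N by lia.
have [qb|_] := eqVneq q b.-1.
  move: (NA L' _) (NA L' _) (nat_of_bool (_ == b.-1)) (nat_of_bool (_ == b.-1)) => x y z z' /=.
  by clear -a0 ae eb u0 tlt qb; lia.
rewrite addn0.
move: (NA L' _) (NA L' _) (nat_of_bool (_ == b.-1)) (nat_of_bool _) => x y z z'.
by clear -a0 ae eb u0 tlt; lia.
Qed.

(** The additional relation is the coefficient of degree b - g in the power b - 1. Its terms
    containing Y j ^ g lie in [Z], and the rest says that Y (j+1) ^ (b-g) kills w = Y j ^ (g-1) v
    modulo [Z]. So the submodule of w obeys b-g, d+1 in place of b-g+1, d. *)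
Lemma dim_cyc_plus_base g b d H j Z v (A := [:: g, b, d & H]) :
    (size A + j = n)%N -> (0 < g <= b)%N -> (b <= d)%N ->
    all (fun a => d <= a)%N H -> stab Z -> annihilated j Z v ->
    satisfies (current j) (NAplus A b) Z v ->
  (\dim (cyc Z v) <= \dim Z + (\prod_(a <- [:: (b - g)%N, d.+1 & H]) a +
                               \prod_(a <- [:: g.-1, b.+1, d & H]) a))%N.
Proof.
move=> szA /andP[g0 gb] bd dH sZ aZ sat.
have [jn jn1] : (j < n)%N /\ (j.+1 < n)%N.
  by move: szA; rewrite /A /= => <-; clear; split; lia.
have satA : satisfies (current j) (NA A) Z v.
  by apply: satisfies_le sat => k; apply: leq_addr.
pose w := ac (Y j ^+ g.-1) v.
have gbH : all (fun c => b <= c)%N (d :: H).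
  by rewrite /= bd; apply: sub_all dH => x; apply: leq_trans.
have [|||yw satw] := @satisfies_kernel j (NA A) Z v g b (d :: H) (fun=> 0%N)
  jn g0 sZ satA.
- by rewrite /A /= NA_cons; lia.
- apply: NA_eq0; rewrite /A /=; apply/and4P; split; try lia.
  by apply: sub_all dH => x; lia.
- move=> q t tg tq; rewrite /A /= !NA_cons.
  have : (NA H q <= NA H (g.-1 + q - t))%N by apply: NA_mono; lia.
  by lia.
have {}satw : satisfies (current j.+1) (NA [:: (b - g).+1, d & H]) Z w.
  by apply: satisfies_le satw => k; rewrite addn0.
have w2Z : ac (Y j.+1 ^+ (b - g)) w \in Z.
  have bgb : (b - g < b.-1.+1)%N by lia.
  have := sat b.-1 (b - g)%N; rewrite /NAplus eqxx addn1 ltnS.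
  rewrite /A /= !NA_cons => /(_ (leq_trans _ (leq_addr _ _))).
  have -> : (b - g <= b.-1.+1 - g)%N by lia.
  move=> /(_ isT); rewrite current_coef // (bigD1 (Ordinal bgb)) //= leqnn subnn.
  rewrite acD ac_sum rpredDr; last first.
    apply: rpred_sum => i ni; rewrite acMn rpredMn //.
    case: leqP => ibg; last by rewrite ac0 mem0v.
    have igl : (i < b - g)%N.
      by rewrite ltn_neqAle ibg andbT; apply: contraNneq ni => ibgE; apply/eqP/val_inj.
    have -> : (b.-1 - i = (b.-1 - i - g) + g)%N by lia.
    rewrite exprD mulrAC acM; apply: sZ.
    rewrite -[Y j ^+ g](current_coef0 _ jn); apply: satA.
    by rewrite /A /= NA_cons; lia.
  rewrite (current_coef0 _ jn1).
  have -> : (b.-1 - (b - g) = g.-1)%N by lia.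
  by rewrite mulrC => /(bin_act_mem (_ : b - g <= b.-1)%N) H'; rewrite /w -acM; apply: H'; lia.
have K : (\dim (cyc Z w) <= \dim Z + \prod_(a <- [:: (b - g)%N, d.+1 & H]) a)%N.
  apply: (@dim_cyc_le _ j.+1) => //; first by rewrite /= -szA /=; lia.
    by apply: annihilatedS => //; apply: annihilated_ac.
  (* Adjoining a vector of [Z] changes nothing, so [satisfies_quotient] can be read modulo [Z]. *)
  have ZZ : (cyc Z (ac (Y j.+1 ^+ (b - g)) w) <= Z)%VS by apply: cyc_min => //; apply: subvv.
  move=> k s sN; apply: (subvP ZZ).
  apply: (@satisfies_quotient j.+1 _ Z w (b - g).+1 d H _ _ _ _ (fun=> leqnn _) satw) => //; lia.
have Q : (\dim (cyc (cyc Z w) v) <= \dim (cyc Z w) + \prod_(a <- [:: g.-1, b.+1, d & H]) a)%N.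
  apply: (@dim_cyc_le _ j) => //; [exact: cyc_stab|exact: annihilated_sub (cyc_sub _ _) aZ|].
  by apply: satisfies_quotient satA => //; rewrite g0.
exact: cyc_dim_trans sZ K Q.
Qed.

(** For equal entries g, g the vector [E^(g-1)]_(N(g-1)) v replaces a power of [Y j]: killing it
    turns g, g into g-1, g+1. Both [Y j] and [Y j.+1] annihilate it modulo [Z], so its submodule
    lives in two variables fewer. *)
Lemma dim_cyc_plus_double L g b d H j Z v (A := [:: g, g, b, d & L ++ H])
      (A' := g.-1 :: L ++ [:: g.+1, b, d & H]) :
    (size A + j = n)%N -> all (fun a => a <= g)%N L -> (0 < g < b)%N -> (b <= d)%N ->
    all (fun a => d <= a)%N H -> stab Z -> annihilated j Z v ->
    satisfies (current j) (NAplus A b) Z v ->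
  exists w, stab (cyc Z w) /\ [/\ annihilated j (cyc Z w) v,
    satisfies (current j) (NAplus A' b) (cyc Z w) v,
    (\dim (cyc Z v) <= \dim (cyc (cyc Z w) v))%N &
    (\dim (cyc Z w) <= \dim Z + \prod_(a <- [:: b.-1, d.+1 & L ++ H]) a)%N].
Proof.
move=> szA L1g /andP[g0 gb] bd dH sZ aZ sat.
have [jn jn1] : (j < n)%N /\ (j.+1 < n)%N.
  by move: szA; rewrite /A /= => <-; clear; split; lia.
have satA : satisfies (current j) (NA A) Z v.
  by apply: satisfies_le sat => k; apply: leq_addr.
pose w := ac (current j ^+ g.-1)`_(NA A g.-1) v.
have satw q s : (s < q.*2 + NA [:: b.-1, d.+1 & L ++ H] q)%N ->
    ac (current j ^+ q)`_s w \in Z.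
  have [sN _|sN] := ltnP s (q.*2 + NA [:: b, d & L ++ H] q).
    apply: (@satisfies_coef (current j) (NA A)
      (fun q => q.*2 + NA [:: b, d & L ++ H] q)%N) => // {sN}q t tg tq _.
    have := NA_convex [:: b, d & L ++ H] tg tq.
    by rewrite /A !(NA_cons g); lia.
  move=> sN'.
  (* Passing from b, d to b-1, d+1 adds a single degree, and only for b - 1 <= q < d. *)
  have [qb qd sE] : [/\ (b <= q.+1)%N, (q < d)%N & s = (NA A q + g.-1.*2)%N].
    by split; move: sN sN'; rewrite /A !NA_cons; clear -g0 gb bd; lia.
  rewrite /w acC -acM sE; apply: (coef_vanish sZ _ qb qd L1g dH sat).
  by rewrite g0.
have yw : ac (Y j) w \in Z.
  by have := @satw 1%N 0%N; rewrite expr1 coef_poly subn_gt0 jn addn0; apply.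
have satw1 : satisfies (current j.+1) (fun q => q + NA [:: b.-1, d.+1 & L ++ H] q)%N Z w.
  by apply: satisfies_shift => // q s sq; apply: satw; rewrite -addnn -addnA.
have yw1 : ac (Y j.+1) w \in Z.
  by have := @satw1 1%N 0%N; rewrite expr1 coef_poly subn_gt0 jn1 addn0; apply.
have K : (\dim (cyc Z w) <= \dim Z + \prod_(a <- [:: b.-1, d.+1 & L ++ H]) a)%N.
  apply: (@dim_cyc_le _ j.+2) => //; first by rewrite -szA /=; lia.
    by do 2!apply: annihilatedS => //; apply: annihilated_ac.
  exact: satisfies_shift.
exists w; split; first exact: cyc_stab.
split=> //; [exact: annihilated_sub (cyc_sub _ _) aZ| |exact/dimvS/cyc_trans].
move=> k s; have -> : NAplus A' b k = (NAplus A b k + (k == g.-1))%N.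
  rewrite /NAplus (@NA_perm _ [:: g.-1, g.+1, b, d & L ++ H]).
    by rewrite /A !NA_cons; clear -g0; case: eqP; lia.
  by rewrite /A' perm_cons (perm_catCA L [:: g.+1; b; d] H).
move=> sN; have [sN'|sN'] := ltnP s (NAplus A b k).
  by apply: (subvP (cyc_sub _ _)); apply: sat.
have [-> ->] : k = g.-1 /\ s = NA A g.-1.
  have kg : k = g.-1 by move: sN sN'; case: eqP => //; clear; lia.
  split=> //; move: sN sN'; rewrite kg /NAplus eqxx.
  have -> : (g.-1 == b.-1) = false by apply/eqP; clear -g0 gb; lia.
  by clear; lia.
exact: cyc_id.
Qed.

Lemma dim_cyc_plus_smallest a e b L j Z v (A := [:: a, e & L]) :
    (j < n)%N -> (0 < a <= e)%N -> (e < b)%N -> b \in L ->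
    all (fun c => e <= c)%N L -> stab Z -> annihilated j Z v ->
    satisfies (current j) (NAplus A b) Z v ->
  exists w, stab (cyc Z w) /\ [/\ annihilated j (cyc Z w) v,
    satisfies (current j) (NAplus [:: a.-1, e.+1 & L] b) (cyc Z w) v,
    (\dim (cyc Z v) <= \dim (cyc (cyc Z w) v))%N,
    annihilated j.+1 Z w &
    satisfies (current j.+1) (NAplus ((e - a).+1 :: L) b) Z w].
Proof.
move=> jn ae eb bL eL sZ aZ sat; exists (ac (Y j ^+ a.-1) v).
split; first exact: cyc_stab.
have [yw satw] := satisfies_kernel_plus jn ae eb bL eL sZ sat.
split=> //; [exact: annihilated_sub (cyc_sub _ _) aZ| |exact/dimvS/cyc_trans|].
  exact: satisfies_quotient_plus.
by apply: annihilatedS => //; apply: annihilated_ac.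
Qed.

(** Each spreading must keep the entries before the triple g, b, d at most equal to its first entry;
    this dictates the cases. The summand [size L] of the measure pays for the case g = b, where the
    entries are only regrouped. *)
Theorem dim_cyc_plus_le L g b d H j Z v :
    (size (L ++ [:: g, b, d & H]) + j = n)%N ->
    all (fun a => a <= g)%N L -> (0 < g <= b)%N -> (b <= d)%N ->
    all (fun a => d <= a)%N H -> stab Z -> annihilated j Z v ->
    satisfies (current j) (NAplus (L ++ [:: g, b, d & H]) b) Z v ->
  (\dim (cyc Z v) + \prod_(a <- L ++ (g + d - b)%N :: H) a
     <= \dim Z + \prod_(a <- L ++ [:: g, b, d & H]) a)%N.
Proof.
have [m] := ubnP (\prod_(a <- L ++ [:: g, b, d & H]) a +
                  size (L ++ [:: g, b, d & H]) + size L)%N.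
elim: m L g b d H j Z v => // m IHm L g b d H j Z v.
set A := L ++ [:: g, b, d & H].
rewrite ltnS => Am szA Lg /andP[g0 gb] bd dH sZ aZ sat.
have [L0|L0] := boolP (0%N \in L).
  have z0 (B : seq nat) : 0%N \in B -> (\prod_(a <- B) a = 0)%N.
    by move=> B0; rewrite (prod_perm (perm_to_rem B0)) big_cons mul0n.
  rewrite !z0 ?mem_cat ?L0 // !addn0.
  have satA : satisfies (current j) (NA A) Z v.
    by apply: satisfies_le sat => k; apply: leq_addr.
  by have := dim_cyc_le szA sZ aZ satA; rewrite z0 ?addn0 // mem_cat L0.
have Lpos : (0 < \prod_(a <- L) a)%N.
  rewrite big_seq prodn_cond_gt0 // => a aL; rewrite lt0n.
  by apply: contraNneq L0 => <-.
have Hpos : (0 < \prod_(a <- H) a)%N.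
  rewrite big_seq prodn_cond_gt0 // => a /(allP dH).
  exact: leq_trans (leq_trans g0 (leq_trans gb bd)).
have prodA : (\prod_(a <- A) a = \prod_(a <- L) a * (g * (b * (d * \prod_(a <- H) a))))%N.
  by rewrite /A big_cat /= !big_cons.
have sizeA : (size A = size L + (3 + size H))%N by rewrite /A size_cat.
rewrite [X in (_ + X <= _)%N]big_cat /= big_cons.
have [L1|Ln] := eqVneq L [::].
  subst L; rewrite /A /= in szA sat.
  have := dim_cyc_plus_base szA (introT andP (conj g0 gb)) bd dH sZ aZ sat.
  rewrite prodA !big_cons big_nil !mul1n -(pair_split_prod _ g0 gb bd).
  by rewrite [(\dim Z + (_ + _ + _))%N]addnA leq_add2r.
(* Here g + d - b = d. With e the largest entry of [L], the triple e, b, b contracts to e + b - b =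
   e, which gives the same product. *)
have [gb'|gb'] := eqVneq g b.
  have [e [L' [pL eL]]] := ex_maximal_split Ln.
  have e0 : (0 < e)%N by rewrite lt0n; apply: contraNneq L0 => <-; rewrite (perm_mem pL) mem_head.
  have eb : (e <= b)%N by have := Lg; rewrite (perm_all _ pL) /= => /andP[]; rewrite gb'.
  have pA : perm_eq A (L' ++ [:: e, b, b, d & H]).
    rewrite /A gb' (perm_trans (_ : perm_eq _ ((e :: L') ++ [:: b, b, d & H]))) ?perm_cat2r //.
    by rewrite -cat1s -catA (perm_catCA [:: e] L').
  have := IHm L' e b b (d :: H) j Z v.
  rewrite -(prod_perm pA) -(perm_size pA) addnK => IH.
  have : (\dim (cyc Z v) + \prod_(a <- L' ++ e :: d :: H) a <= \dim Z + \prod_(a <- A) a)%N.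
    apply: IH => //.
    - move: Am; rewrite (perm_size pL) /= addnS; exact: leq_trans.
    - by rewrite e0.
    - by rewrite /= bd; apply: sub_all dH => x; apply: leq_trans.
    - exact: satisfies_perm pA sat.
  rewrite (prod_perm pL) big_cat /= !big_cons gb' addKn.
  by rewrite mulnA [(\prod_(_ <- _) _ * e)%N]mulnC mulnA.
have {gb gb'} gb : (g < b)%N by rewrite ltn_neqAle gb'.
have d0 : (0 < d)%N by apply: leq_trans bd; apply: leq_trans gb.
have Rpos : (0 < b * (d * \prod_(a <- H) a))%N by rewrite !muln_gt0 Hpos d0 (leq_trans _ gb).
(* An entry g of [L] cannot be raised without passing the g of the triple, so these two are spread
   together. *)
have [gL|gL] := boolP (g \in L).
  have := perm_to_rem gL; move: (rem g L) => L1 pL.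
  have L1g : all (fun a => a <= g)%N L1.
    by have := Lg; rewrite (perm_all _ pL) /= => /andP[].
  have prodL := prod_perm pL; rewrite big_cons in prodL.
  have sizeL := perm_size pL; rewrite /= in sizeL.
  have pA : perm_eq A [:: g, g, b, d & L1 ++ H].
    rewrite /A (perm_trans (_ : perm_eq _ ((g :: L1) ++ [:: g, b, d & H]))) ?perm_cat2r //.
    by rewrite /= perm_cons (perm_catCA L1 [:: g; b; d] H).
  have {}sat := satisfies_perm pA sat.
  have szA3 : (size [:: g, g, b, d & L1 ++ H] + j = n)%N by rewrite -(perm_size pA).
  have g0b : (0 < g < b)%N by rewrite g0.
  have [w [sw [aw satw vw dw]]] := dim_cyc_plus_double szA3 L1g g0b bd dH sZ aZ sat.
  have L1pos : (0 < \prod_(a <- L1) a)%N by move: Lpos; rewrite prodL muln_gt0 => /andP[].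
  have IH := IHm (g.-1 :: L1) g.+1 b d H j (cyc Z w) v _ _ _ _ bd dH sw aw satw.
  have {}IH : (\dim (cyc (cyc Z w) v) + \prod_(a <- g.-1 :: L1 ++ (g.+1 + d - b)%N :: H) a <=
     \dim (cyc Z w) + \prod_(a <- g.-1 :: L1 ++ [:: g.+1, b, d & H]) a)%N.
    apply: IH.
    - apply: leq_trans Am; rewrite prodA sizeA prodL sizeL /= size_cat big_cons big_cat /= big_cons.
      rewrite (big_cons _ _ b) big_cons -!addSn !addnS mulnA.
      have := double_split_lt g0 L1pos Rpos; rewrite addSn ltnS.
      by move: (_ * _)%N (_ * _)%N (size L1) (size H); clear; lia.
    - by rewrite -szA3 /= !size_cat /=; clear; lia.
    - by rewrite /= leqW ?leq_pred //; apply: sub_all L1g => x; apply: leqW.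
    - by rewrite gb.
  move: vw dw IH; rewrite prodA prodL !big_cons !big_cat /= !big_cons.
  have := double_split_prod (\prod_(a <- H) a) (\prod_(a <- L1) a) g0 gb bd.
  rewrite -!mulnA; move: (g.-1 * _)%N (g.-1 * _)%N (b.-1 * _)%N (g * _)%N (g * _)%N.
  by clear; lia.
have {gL} Lg' : all (fun a => a < g)%N L.
  apply/allP => a aL; rewrite ltn_neqAle (allP Lg _ aL) andbT.
  by apply: contraNneq gL => <-.
have [a [L' [pL aL]]] := ex_minimal_split Ln.
have a0 : (0 < a)%N by rewrite lt0n; apply: contraNneq L0 => <-; rewrite (perm_mem pL) mem_head.
have ag : (a < g)%N by have := Lg'; rewrite (perm_all _ pL) /= => /andP[].
have L'g : all (fun c => c < g)%N L' by have := Lg'; rewrite (perm_all _ pL) /= => /andP[].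
have prodL := prod_perm pL; rewrite big_cons in prodL.
have sizeL := perm_size pL; rewrite /= in sizeL.
have jn : (j < n)%N by rewrite -szA sizeA sizeL; clear; lia.
have gH : all (fun c => g <= c)%N (b :: d :: H).
  rewrite /= (ltnW gb) (leq_trans (ltnW gb)) //=; apply: sub_all dH => x.
  by apply: leq_trans; apply: leq_trans bd; apply: ltnW.
have gb0 : (0 < g <= b)%N by rewrite g0 ltnW.
(* If a is the only entry before g, the pair is a, g: the triple of the quotient starts with g + 1
   <= b, that of the submodule with g - a + 1. *)
case: (L' =P [::]) => [L'0|/eqP/ex_minimal_split[e [L2 [pL' eL]]]].
  subst L'; rewrite big_nil muln1 in prodL.
  have pA : perm_eq A [:: a, g, b, d & H].
    by rewrite /A -[[:: a, g, b, d & H]]/([:: a] ++ [:: g, b, d & H]) perm_cat2r.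
  have [|||w [sw [aw satw vw awK satK]]] :=
      @dim_cyc_plus_smallest a g b [:: b, d & H] j Z v jn _ gb _ gH sZ aZ _.
  - by rewrite a0 ltnW.
  - exact: mem_head.
  - exact: satisfies_perm pA sat.
  have E1 := smallest_split_prod (b * (d * \prod_(c <- H) c)) (introT andP (conj a0 (ltnW ag))).
  have E2 : (0 < (g - a).+1 * (b * (d * \prod_(c <- H) c)))%N by rewrite muln_gt0.
  have Q : (\dim (cyc (cyc Z w) v) + \prod_(c <- [:: a.-1] ++ (g.+1 + d - b)%N :: H) c <=
     \dim (cyc Z w) + \prod_(c <- [:: a.-1] ++ [:: g.+1, b, d & H]) c)%N.
    apply: (IHm [:: a.-1] g.+1 b d H j) => //.
    - apply: leq_trans Am; rewrite prodA prodL -E1 sizeA sizeL /= !big_cons.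
      by move: E2; move: (_ * _)%N (_ * _)%N; clear; lia.
    - by rewrite -szA sizeA sizeL /=; clear; lia.
    - by rewrite /= andbT; apply: leqW; apply: leq_trans (leq_pred _) (ltnW ag).
  have K : (\dim (cyc Z w) + \prod_(c <- [::] ++ ((g - a).+1 + d - b)%N :: H) c <=
     \dim Z + \prod_(c <- [::] ++ [:: (g - a).+1, b, d & H]) c)%N.
    apply: (IHm [::] (g - a).+1 b d H j.+1) => //.
    - apply: leq_trans Am; rewrite prodA prodL -E1 sizeA sizeL /= !big_cons.
      by move: (_ * _)%N (_ * _)%N; clear; lia.
    - by rewrite -szA sizeA sizeL /=; clear; lia.
    - by clear -gb a0; lia.
  move: vw Q K; rewrite prodA prodL !big_cons -E1.
  have := smallest_shift_bound (\prod_(c <- H) c) a0 ag gb bd.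
  by move: (_ * _)%N (_ * _)%N (_ * _)%N (_ * _)%N (_ * _)%N; clear; lia.
have eg : (e < g)%N by have := L'g; rewrite (perm_all _ pL') /= => /andP[].
have L2g : all (fun c => c < g)%N L2 by have := L'g; rewrite (perm_all _ pL') /= => /andP[].
have ae : (a <= e)%N by have := aL; rewrite (perm_all _ pL') /= => /andP[].
have a0e : (0 < a <= e)%N by rewrite a0.
rewrite (prod_perm pL') big_cons in prodL; rewrite (perm_size pL') /= in sizeL.
have pA : perm_eq A [:: a, e & L2 ++ [:: g, b, d & H]].
  rewrite /A -[[:: a, e & _]]/([:: a, e & L2] ++ [:: g, b, d & H]) perm_cat2r.
  by rewrite (perm_trans pL) // perm_cons.
have eA : all (fun c => e <= c)%N (L2 ++ [:: g, b, d & H]).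
  rewrite all_cat eL /= (ltnW eg) /=; apply: sub_all gH => x.
  by apply: leq_trans; apply: ltnW.
have L2pos : (0 < \prod_(c <- L2) c)%N.
  by move: Lpos; rewrite prodL !muln_gt0 => /and3P[].
have [|||w [sw [aw satw vw awK satK]]] :=
    @dim_cyc_plus_smallest a e b (L2 ++ [:: g, b, d & H]) j Z v jn a0e _ _ eA sZ aZ _.
- exact: ltn_trans gb.
- by rewrite mem_cat !inE eqxx !orbT.
- exact: satisfies_perm pA sat.
set R := (\prod_(c <- L2) c * (g * (b * (d * \prod_(c <- H) c))))%N.
have R0 : (0 < R)%N by rewrite !muln_gt0 L2pos g0 /=; move: Rpos; rewrite !muln_gt0.
have E1 := smallest_split_prod R a0e.
have E2 : (0 < (e - a).+1 * R)%N by rewrite muln_gt0.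
have prodA' : (\prod_(c <- A) c = a * (e * R))%N by rewrite prodA prodL /R -!mulnA.
have Q : (\dim (cyc (cyc Z w) v) + \prod_(c <- [:: a.-1, e.+1 & L2] ++ (g + d - b)%N :: H) c <=
   \dim (cyc Z w) + \prod_(c <- [:: a.-1, e.+1 & L2] ++ [:: g, b, d & H]) c)%N.
  apply: (IHm [:: a.-1, e.+1 & L2] g b d H j) => //.
  - apply: leq_trans Am; rewrite prodA' -E1 sizeA sizeL /= !big_cons big_cat /= !big_cons -/R size_cat /=.
    by move: E2; move: (_ * _)%N (_ * _)%N; clear; lia.
  - by rewrite -szA sizeA sizeL /= size_cat /=; clear; lia.
  - rewrite /= eg (leq_trans (leq_pred _) (ltnW ag)) /=.
    by apply: sub_all L2g => x; apply: ltnW.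
have K : (\dim (cyc Z w) + \prod_(c <- ((e - a).+1 :: L2) ++ (g + d - b)%N :: H) c <=
   \dim Z + \prod_(c <- ((e - a).+1 :: L2) ++ [:: g, b, d & H]) c)%N.
  apply: (IHm ((e - a).+1 :: L2) g b d H j.+1) => //.
  - apply: leq_trans Am; rewrite prodA' -E1 sizeA sizeL /= !big_cons big_cat /= !big_cons -/R size_cat /=.
    by move: (_ * _)%N (_ * _)%N; clear; lia.
  - by rewrite -szA sizeA sizeL /= size_cat /=; clear; lia.
  - rewrite /=; apply/andP; split; first by clear -eg a0; lia.
    by apply: sub_all L2g => x; apply: ltnW.
move: vw Q K; rewrite prodA' -E1 prodL !big_cat /= !big_cons -/R -!mulnA.
rewrite -(smallest_split_prod _ a0e).
by move: (_ * _)%N (_ * _)%N (_ * _)%N (_ * _)%N; clear; lia.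
Qed.

End CyclicModules.

(** * Modules generated by a lowest weight vector *)

(** Take a subspace of largest dimension contained in [P]. Adjoining any vector of [P] stays in [P],
    so it already contains them all, and the span by minimality. *)
Lemma vspan_closed (F : fieldType) (V : vectType F) (P : V -> Prop) :
    P 0 -> (forall a u v, P u -> P v -> P (a *: u + v)) ->
  forall u, u \in vspan P -> P u.
Proof.
move=> P0 PD; pose Q d := `[< exists U : {vspace V}, (forall v, v \in U -> P v) /\ \dim U = d >].
have exQ : exists d, Q d.
  exists 0%N; apply/asboolP; exists 0%VS; split; last exact: dimv0.
  by move=> v; rewrite memv0 => /eqP ->.
have ubQ d : Q d -> (d <= \dim (fullv : {vspace V}))%N.
  by move=> /asboolP[U [_ <-]]; rewrite dimvS ?subvf.
case: (ex_maxnP exQ ubQ) => d /asboolP[U [PU dU]] dmax u uP; apply: (PU).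
have [_ +] := vspanP P => /(_ U) H; apply: (subvP (H _)) uP => {u H} v Pv.
have : Q (\dim (U + <[v]>)%VS).
  apply/asboolP; exists (U + <[v]>)%VS; split=> //.
  move=> _ /memv_addP[x xU [_ /vlineP[c ->] ->]].
  by rewrite addrC; apply: PD => //; apply: (PU).
move=> /dmax; rewrite -dU => le.
have /eqP -> : (U == U + <[v]>)%VS by rewrite eqEdim addvSl.
by rewrite memvE addvSr.
Qed.

(** * Polynomials acting through commuting endomorphisms *)

Section PolyAction.
Variables (F : numFieldType) (W : vectType F) (n : nat) (y : 'I_n -> 'End(W)).
Hypothesis yC : forall i k u, y i (y k u) = y k (y i u).

Definition monact (m : 'X_{1..n}) (s : seq 'I_n) (u : W) : W :=
  foldr (fun i w => iter (m i) (y i) w) u s.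

Lemma monact_linear m s : linear (monact m s).
Proof.
move=> a u v; elim: s => //= i s ->; elim: (m i) => //= k ->.
by rewrite linearP.
Qed.

HB.instance Definition _ m s :=
  GRing.isLinear.Build F W W _ (monact m s) (monact_linear m s).

Lemma monactC i m s u : y i (monact m s u) = monact m s (y i u).
Proof.
elim: s => //= k s <-; move: (monact m s u) => {}u.
by elim: (m k) => //= d <-; rewrite yC.
Qed.

Lemma monactD m1 m2 s u :
  monact (m1 + m2)%MM s u = monact m1 s (monact m2 s u).
Proof.
elim: s u => //= i s IHs u; rewrite IHs mnmDE iterD; congr iter.
elim: (m2 i) => //= k ->; exact: monactC.
Qed.

Definition polyact (g : {mpoly F[n]}) : 'End(W) :=
  \sum_(m <- msupp g) g@_m *: linfun (monact m (enum 'I_n)).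

Lemma polyactE k g : (msize g <= k)%N ->
  polyact g = \sum_(m : 'X_{1..n < k}) g@_m *: linfun (monact m (enum 'I_n)).
Proof.
move=> le_gk; set I : subFinType _ := 'X_{1..n < k}.
rewrite /polyact (big_mksub I) ?msupp_uniq //=; first last.
  by move=> x /msize_mdeg_lt /leq_trans; apply.
rewrite big_rmcond //= => m /memN_msupp_eq0 ->.
by rewrite scale0r.
Qed.

Lemma polyactP a g h : polyact (a *: g + h) = a *: polyact g + polyact h.
Proof.
pose k := maxn (msize (a *: g + h)) (maxn (msize g) (msize h)).
rewrite !(@polyactE k) ?leq_max ?leqnn ?orbT //.
rewrite scaler_sumr -big_split /=; apply: eq_bigr => m _.
by rewrite mcoeffD mcoeffZ scalerDl scalerA.
Qed.

Lemma polyactD g h u : polyact (g + h) u = polyact g u + polyact h u.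
Proof. by have := polyactP 1 g h; rewrite !scale1r => ->; rewrite add_lfunE. Qed.

Lemma polyactZ a g u : polyact (a *: g) u = a *: polyact g u.
Proof.
have p0 : polyact 0 = 0 by rewrite /polyact msupp0 big_nil.
by have := polyactP a g 0; rewrite addr0 p0 addr0 => ->; rewrite scale_lfunE.
Qed.

Lemma polyactX m u : polyact 'X_[m] u = monact m (enum 'I_n) u.
Proof. by rewrite /polyact msuppX big_seq1 mcoeffX eqxx scale1r lfunE. Qed.

Lemma polyactM g h u : polyact (g * h) u = polyact g (polyact h u).
Proof.
have p0 v : polyact 0 v = 0.
  by rewrite /polyact msupp0 big_nil zero_lfunE.
elim/mpolyind: g h => [h|a m g _ _ IHg h]; first by rewrite mul0r !p0.
rewrite mulrDl -scalerAl !polyactD IHg !polyactZ; congr (_ *: _ + _).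
elim/mpolyind: h {IHg} => [|b k h _ _ IHh]; first by rewrite mulr0 !p0 linear0.
rewrite mulrDr -scalerAr !polyactD !polyactZ IHh linearD linearZ /=.
by rewrite -mpolyXD !polyactX monactD.
Qed.

Lemma polyact1 u : polyact 1 u = u.
Proof.
rewrite -mpolyX0 polyactX; elim: (enum 'I_n) => //= i s ->.
by rewrite mnm0E.
Qed.

Lemma polyactXi i u : polyact 'X_i u = y i u.
Proof.
rewrite polyactX; have := enum_uniq 'I_n; have := mem_enum 'I_n i; rewrite inE.
elim: (enum 'I_n) => //= k s IHs; rewrite inE mnm1E => ik /andP[ks us].
have [ki|ki] := eqVneq i k.
  subst k; rewrite /=; congr (y i _); elim: s ks {IHs ik us} => //= k s IHs.
  rewrite inE negb_or mnm1E => /andP[ik /IHs ->].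
  by rewrite (negbTE ik).
by rewrite (negbTE ki) /= in ik *; apply: IHs.
Qed.

Lemma polyact_gen (U : {vspace W}) :
  (forall i u, u \in U -> y i u \in U) -> forall g u, u \in U -> polyact g u \in U.
Proof.
move=> HU g u uU; rewrite /polyact sum_lfunE; apply: rpred_sum => m _.
rewrite scale_lfunE rpredZ // lfunE /=; elim: (enum 'I_n) => //= i s IHs.
by elim: (m i) => //= k; apply: HU.
Qed.

End PolyAction.

(** * The polynomial ring in the e_j *)

Section EAction.
Variables (F : numFieldType) (n : nat).
Implicit Types (M N : sl2t_mod F).

Lemma act_eC M i j (u : M) : act M sl2e i (act M sl2e j u) = act M sl2e j (act M sl2e i u).
Proof. by apply/eqP; rewrite -subr_eq0 act_br /= scale0r. Qed.

(** The reversed index makes variable i the coefficient of z^i in e_(n)(z). *)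
Definition eact M : {mpoly F[n]} -> 'End(M) :=
  polyact (fun i : 'I_n => act M sl2e (n.-1 - i)).

Definition evar (p : nat) : {mpoly F[n]} := oapp (fun i : 'I_n => 'X_i) 0 (insub p).

Lemma eactD M g h (u : M) : eact M (g + h) u = eact M g u + eact M h u.
Proof. exact: polyactD. Qed.

Lemma eactM M g h (u : M) : eact M (g * h) u = eact M g (eact M h u).
Proof. by apply: polyactM => i k w; apply: act_eC. Qed.

Lemma eact1 M (u : M) : eact M 1 u = u.
Proof. exact: polyact1. Qed.

Lemma eact_evar M p (u : M) : (p < n)%N -> eact M (evar p) u = act M sl2e (n.-1 - p) u.
Proof. by move=> pn; rewrite /evar insubT /= /eact polyactXi. Qed.

Lemma eact_gen M (U : {vspace M}) :
  (forall p u, (p < n)%N -> u \in U -> eact M (evar p) u \in U) -> stab (eact M) U.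
Proof.
move=> HU; apply: polyact_gen => i u uU.
by rewrite -(eact_evar u (ltn_ord i)); apply: HU.
Qed.

Lemma hom_eact M N (f : 'Hom(M, N)) :
    (forall j u, f (act M sl2e j u) = act N sl2e j (f u)) ->
  forall g u, f (eact M g u) = eact N g (f u).
Proof.
move=> fe g u; rewrite /eact /polyact !sum_lfunE linear_sum; apply: eq_bigr => m _.
rewrite !scale_lfunE linearZ !lfunE /=; congr (_ *: _).
elim: (enum 'I_n) => //= i s <-; elim: (m i) => //= k <-.
by rewrite fe.
Qed.

End EAction.

(** * Cyclic submodules on lowest weight vectors and their homomorphisms *)

Section LowestVectors.
Variables (F : numFieldType) (n : nat).
Implicit Types (M N : sl2t_mod F).

Local Notation ea M := (@eact F n M).
Local Notation ecyc M Z v := (@cyc F {mpoly F[n]} M (ea M) Z v).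

Lemma ecyc_stab M Z (v : M) : stab (ea M) Z -> stab (ea M) (ecyc M Z v).
Proof. by apply: cyc_stab => *; apply: eactM. Qed.

Lemma ecyc_id M Z (v : M) : v \in ecyc M Z v.
Proof. by apply: cyc_id => *; apply: eact1. Qed.

Lemma stab0 M : stab (ea M) 0%VS.
Proof. by move=> g u; rewrite memv0 => /eqP ->; rewrite linear0 mem0v. Qed.

Lemma ecyc0P M (v : M) u : u \in ecyc M 0%VS v -> exists g, u = ea M g v.
Proof.
have H w : w \in 0%VS \/ (exists g, w = ea M g v) -> exists g, w = ea M g v.
  case=> //; rewrite memv0 => /eqP ->.
  by exists 0; rewrite (ac0 (@eactD F n M)).
move=> uC; apply/H/(vspan_closed _ _ uC); first by left; apply: mem0v.
move=> a w1 w2 /H[g1 ->] /H[g2 ->]; right; exists (a *: g1 + g2).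
by rewrite eactD /eact polyactZ.
Qed.

Definition lowest (lam : F) M (v : M) :=
  [/\ forall j, act M sl2f j v = 0,
      forall j, act M sl2h j v = if j == 0%N then lam *: v else 0
    & forall j, (n <= j)%N -> act M sl2e j v = 0].

Lemma ecyc_act_ge M lam (v : M) j u : lowest lam v -> (n <= j)%N ->
  u \in ecyc M 0%VS v -> act M sl2e j u = 0.
Proof.
move=> [_ _ ev] nj uC; apply/eqP; rewrite -memv_ker; apply: subvP uC.
apply: cyc_min; rewrite ?sub0v //; last by rewrite memv_ker ev.
apply: eact_gen => p w pn; rewrite !memv_ker eact_evar // => /eqP w0.
by rewrite act_eC w0 linear0.
Qed.

Lemma ecyc_act_e M lam (v : M) j u : lowest lam v ->
  u \in ecyc M 0%VS v -> act M sl2e j u \in ecyc M 0%VS v.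
Proof.
move=> lv uC; have [nj|jn] := leqP n j; first by rewrite (ecyc_act_ge lv) ?mem0v.
have pn : (n.-1 - j < n)%N by lia.
have -> : act M sl2e j u = ea M (evar F n (n.-1 - j)) u.
  by rewrite eact_evar //; congr (act M sl2e _ u); lia.
exact: ecyc_stab (@stab0 M) _ _ uC.
Qed.

(** The operators h_j and f_j are moved through the e's to v by [h, e] = 2e and [f, e] = -h, so the
    case of f rests on that of h. Formally, the vectors of C sent into C form a subspace stable
    under the e's that contains v. *)
Lemma ecyc_act M lam (v : M) x j u : lowest lam v ->
  u \in ecyc M 0%VS v -> act M x j u \in ecyc M 0%VS v.
Proof.
move=> lv; have [fv hv _] := lv; set C := ecyc M 0%VS v.
have Ce i w : w \in C -> act M sl2e i w \in C by apply: ecyc_act_e lv.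
have Ch i w : w \in C -> act M sl2h i w \in C.
  move=> wC; suff : (C <= C :&: act M sl2h i @^-1: C)%VS.
    by move=> /subvP/(_ _ wC); rewrite memv_cap -memv_preim => /andP[].
  apply: cyc_min; rewrite ?sub0v //; last first.
    rewrite memv_cap ecyc_id -memv_preim hv; case: eqP => _; rewrite ?mem0v //.
    by rewrite rpredZ // ecyc_id.
  apply: eact_gen => p w' pn; rewrite !memv_cap -!memv_preim => /andP[w1 w2].
  rewrite eact_evar // Ce //= -[act M sl2h i _](subrK (act M sl2e (n.-1 - p) (act M sl2h i w'))).
  by rewrite act_br rpredD ?rpredZ ?Ce.
case: x; [exact: Ce|exact: Ch|].
move=> uC; suff : (C <= C :&: act M sl2f j @^-1: C)%VS.
  by move=> /subvP/(_ _ uC); rewrite memv_cap -memv_preim => /andP[].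
apply: cyc_min; rewrite ?sub0v //; last first.
  by rewrite memv_cap ecyc_id -memv_preim fv mem0v.
apply: eact_gen => p w' pn; rewrite !memv_cap -!memv_preim => /andP[w1 w2].
rewrite eact_evar // Ce //= -[act M sl2f j _](subrK (act M sl2e (n.-1 - p) (act M sl2f j w'))).
by rewrite act_br rpredD ?rpredZ ?Ce ?Ch.
Qed.

Definition pair_fun M N x j (u : (M * N)%type) : (M * N)%type :=
  (act M x j u.1, act N x j u.2).

Lemma pair_fun_linear M N x j : linear (@pair_fun M N x j).
Proof. by move=> a u w; rewrite /pair_fun !linearP. Qed.

HB.instance Definition _ M N x j := GRing.isLinear.Build F (M * N)%type (M * N)%type
  _ (@pair_fun M N x j) (@pair_fun_linear M N x j).

Definition pair_act M N x j : 'End((M * N)%type) := linfun (@pair_fun M N x j).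

Lemma pair_act_br M N x y i j (u : (M * N)%type) :
  pair_act M N x i (pair_act M N y j u) - pair_act M N y j (pair_act M N x i u)
  = (sl2_br F x y).1 *: pair_act M N (sl2_br F x y).2 (i + j) u.
Proof. by rewrite !lfunE /= /pair_fun /=; congr (_, _); rewrite /= act_br. Qed.

Definition pair_mod M N : sl2t_mod F := Sl2tMod (@pair_act_br M N).

Definition fstL M N : 'Hom(pair_mod M N, M) := linfun (fst : (M * N)%type -> M).
Definition sndL M N : 'Hom(pair_mod M N, N) := linfun (snd : (M * N)%type -> N).

Lemma fstL_act M N x j u : fstL M N (act (pair_mod M N) x j u) = act M x j (fstL M N u).
Proof. by rewrite /fstL !lfunE. Qed.

Lemma sndL_act M N x j u : sndL M N (act (pair_mod M N) x j u) = act N x j (sndL M N u).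
Proof. by rewrite /sndL !lfunE. Qed.

Lemma lowest_pair lam M N (v : M) (u : N) :
  lowest lam v -> lowest lam u -> lowest lam ((v, u) : pair_mod M N).
Proof.
move=> [v1 v2 v3] [u1 u2 u3]; split=> j; rewrite /= ?lfunE /= /pair_fun /=.
- by rewrite v1 u1.
- by rewrite v2 u2; case: eqP.
- by move=> nj; rewrite v3 ?u3.
Qed.

Local Notation cur := (@current {mpoly F[n]} n (evar F n) 0).

Lemma satisfies_pair (B : nat -> nat) M N (v : M) (u : N) :
  satisfies (ea M) cur B 0%VS v -> satisfies (ea N) cur B 0%VS u ->
  satisfies (ea (pair_mod M N)) cur B 0%VS ((v, u) : pair_mod M N).
Proof.
move=> sv su k s sN; rewrite memv0; apply/eqP; set g := _`_s.
pose x := ea (pair_mod M N) g ((v, u) : pair_mod M N).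
have H1 : fstL M N x = ea M g v.
  by rewrite /x (hom_eact (fun j => @fstL_act M N sl2e j)) /fstL lfunE.
have H2 : sndL M N x = ea N g u.
  by rewrite /x (hom_eact (fun j => @sndL_act M N sl2e j)) /sndL lfunE.
have := sv k s sN; have := su k s sN; rewrite !memv0 -/g -H1 -H2 -/x.
by rewrite /fstL /sndL !lfunE /=; case: x {H1 H2} => a b /= /eqP -> /eqP ->.
Qed.

Lemma lowest_dim_le (A : seq nat) M (v : M) : size A = n ->
  satisfies (ea M) cur (NA A) 0%VS v ->
  (\dim (ecyc M 0%VS v) <= \prod_(a <- A) a)%N.
Proof.
move=> szA sat.
have := @dim_cyc_le F _ M (ea M) (@eactD F n M) (@eactM F n M) (@eact1 F n M) n
  (evar F n) (@eact_gen F n M) A 0%N 0%VS v.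
by rewrite dimv0 addn0; apply=> //; apply: stab0.
Qed.

(* M has the largest dimension allowed by its relations, so the submodule of
   M x N generated by (v, u) is the graph of a homomorphism. *)
Theorem lowest_hom lam (A : seq nat) M N (v : M) (u : N) :
    size A = n -> lowest lam v -> lowest lam u ->
    (\prod_(a <- A) a <= \dim (fullv : {vspace M}))%N -> ecyc M 0%VS v = fullv ->
    satisfies (ea M) cur (NA A) 0%VS v -> satisfies (ea N) cur (NA A) 0%VS u ->
  exists f : mod_hom M N, f v = u /\ (limg f <= ecyc N 0%VS u)%VS.
Proof.
move=> szA lv lu dM cM sv su.
pose P := pair_mod M N; pose vu : P := (v, u).
have lvu : lowest lam vu := lowest_pair lv lu.
pose U := ecyc P 0%VS vu.
have dU : (\dim U <= \dim (fullv : {vspace M}))%N.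
  exact: leq_trans (lowest_dim_le szA (satisfies_pair sv su)) dM.
have fU : (fstL M N @: U = fullv)%VS.
  apply/eqP; rewrite eqEsubv subvf /= -cM; apply: cyc_min; rewrite ?sub0v //.
    apply: eact_gen => p w pn /memv_imgP[w' w'U ->].
    rewrite -(hom_eact (fun j => @fstL_act M N sl2e j)) memv_img //.
    exact: ecyc_stab (@stab0 P) _ _ w'U.
  have -> : v = fstL M N vu by rewrite /fstL lfunE.
  by rewrite memv_img // ecyc_id.
have kU : (U :&: lker (fstL M N) = 0)%VS.
  apply/eqP; rewrite -dimv_eq0; have E := limg_ker_dim (fstL M N) U.
  by move: dU; rewrite -E fU -[X in (_ <= X)%N]add0n leq_add2r leqn0.
pose h : 'Hom(subvs_of U, M) := (fstL M N \o linfun vsval)%VF.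
have hE w : h w = fstL M N (vsval w) by rewrite /h comp_lfunE [linfun vsval w]lfunE.
have kh : lker h == 0%VS.
  apply/lker0P => w1 w2; rewrite !hE => e; apply/subvs_inj/eqP.
  rewrite -subr_eq0 -memv0 -kU memv_cap rpredB ?subvsP //=.
  by rewrite memv_ker linearB /= e subrr.
have ih : limg h = fullv.
  apply/eqP; rewrite eqEsubv subvf /= -fU; apply/subvP => x /memv_imgP[w wU ->].
  have -> : fstL M N w = h (vsproj U w) by rewrite hE vsprojK.
  by rewrite memv_img ?memvf.
have hK x : h (h^-1%VF x) = x by rewrite limg_lfunVK // ih memvf.
pose f : 'Hom(M, N) := (sndL M N \o linfun vsval \o h^-1)%VF.
have fE x : f x = sndL M N (vsval (h^-1%VF x)).
  by rewrite /f !comp_lfunE [linfun vsval _]lfunE.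
have fP w : w \in U -> f (fstL M N w) = sndL M N w.
  move=> wU; rewrite fE; congr (sndL M N _).
  have -> : fstL M N w = h (vsproj U w) by rewrite hE vsprojK.
  by rewrite (lker0_lfunK kh) vsprojK.
have fact x j w : f (act M x j w) = act N x j (f w).
  have -> : w = fstL M N (vsval (h^-1%VF w)) by rewrite -hE hK.
  have wU : vsval (h^-1%VF w) \in U := subvsP _.
  rewrite -fstL_act !fP //; first by rewrite sndL_act.
  exact: ecyc_act lvu wU.
have fv : f v = u.
  have -> : v = fstL M N vu by rewrite /fstL lfunE.
  by rewrite fP ?ecyc_id // /sndL lfunE.
exists (ModHom fact); split=> //=.
apply/subvP => x /memv_imgP[w _ ->].
have : w \in ecyc M 0%VS v by rewrite cM memvf.
move=> /ecyc0P[g ->]; rewrite (hom_eact (fun j => @fact sl2e j)) fv.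
exact: cyc_ac.
Qed.

End LowestVectors.

(** * The fusion product *)

Section GradedModule.
Variables (F : fieldType) (M : sl2t_mod F) (v : M).

Local Notation gr := (gr_mod v).
Local Notation famT := {ffun 'I_(filt_bound v).+1 -> M}.

Lemma fam_in_sum (U : nat -> {vspace M}) :
  fam_in v U = (\sum_(s < (filt_bound v).+1) linfun (@fam_single F M v s) @: U s)%VS.
Proof.
apply/eqP; rewrite eqEsubv; apply/andP; split; apply/subvP => u.
  move=> /fam_inP uU.
  have -> : u = \sum_(s < (filt_bound v).+1) fam_single v s ((u : famT) s).
    apply/ffunP=> t; rewrite sum_ffunE (bigD1 t) //= ffunE eqxx big1 ?addr0 // => s st.
    by rewrite ffunE val_eqE eq_sym (negbTE st).
  apply: memv_sumr => s _; have -> : fam_single v s ((u : famT) s) =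
    linfun (@fam_single F M v s) ((u : famT) s) by rewrite lfunE.
  exact: memv_img.
move=> /memv_sumP[w wU ->]; apply: rpred_sum => s _.
by have /memv_imgP[x xU ->] := wU s isT; rewrite lfunE; apply: fam_single_in.
Qed.

Lemma dim_fam_in (U : nat -> {vspace M}) :
  \dim (fam_in v U) = (\sum_(s < (filt_bound v).+1) \dim (U s))%N.
Proof.
rewrite fam_in_sum.
have : directv (\sum_(s < (filt_bound v).+1) linfun (@fam_single F M v s) @: U s)%VS.
  apply/directv_sum_independent => us usU us0 s _.
  have usE (t : 'I_(filt_bound v).+1) : exists2 x, x \in U t & us t = fam_single v t x.
    by have /memv_imgP[x xU ->] := usU t isT; exists x; rewrite ?lfunE.
  have [x _ usx] := usE s; have := congr1 (fun f : famT => f s) us0.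
  rewrite sum_ffunE (bigD1 s) //= big1 ?addr0 => [|t ts].
    rewrite usx ffunE eqxx [RHS]ffunE => ->.
    by apply/ffunP => t; rewrite !ffunE; case: eqP.
  have [y _ ->] := usE t; rewrite ffunE val_eqE.
  by rewrite eq_sym (negbTE ts).
move=> /directvP/= ->; apply: eq_bigr => s _.
apply: limg_dim_eq; apply/eqP; rewrite -subv0; apply/subvP => x.
rewrite memv_cap => /andP[_]; rewrite memv_ker lfunE memv0 => /eqP.
by move/(congr1 (fun f : famT => f s)); rewrite !ffunE eqxx => ->.
Qed.

(** The differences dim F_s - dim F_(s-1) telescope. *)
Lemma dim_gr : \dim (fullv : {vspace gr}) = \dim (filt v (filt_bound v)).
Proof.
have -> : \dim (fullv : {vspace gr}) = \dim (gr_num v :\: gr_den v)%VS.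
  by rewrite dimvf.
have := dimv_cap_compl (gr_num v) (gr_den v).
have -> : (gr_num v :&: gr_den v)%VS = gr_den v.
  apply/capv_idPr/subvP => u /fam_inP uU; apply/fam_inP => s.
  exact: (subvP (filt_pred_sub v s)).
rewrite /= !dim_fam_in big_ord_recl /= dimv0 add0n big_ord_recr /=.
by move/addnI.
Qed.

Definition gr_cls (s : nat) : 'Hom(M, gr) :=
  (quo_proj (gr_num v) (gr_den v) \o linfun (@fam_single F M v s))%VF.

Lemma gr_clsE s y : gr_cls s y = quo_proj (gr_num v) (gr_den v) (fam_single v s y).
Proof. by rewrite /gr_cls comp_lfunE [linfun _ y]lfunE. Qed.

Lemma gr_cls_act x j s y : y \in filt v s ->
  act gr x j (gr_cls s y) = gr_cls (s + j) (act M x j y).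
Proof.
move=> ys; rewrite !gr_clsE -fam_single_act; apply/esym/quo_proj_act.
exact: fam_single_in.
Qed.

Lemma gr_cls_pred s y : y \in filt_pred v s -> gr_cls s y = 0.
Proof.
move=> ys; apply/eqP; rewrite gr_clsE quo_projP; first exact/fam_single_in.
exact/fam_single_in/(subvP (filt_pred_sub v s)).
Qed.

Lemma gr_vecE : gr_vec v = gr_cls 0 v. Proof. by rewrite gr_clsE. Qed.

Lemma gr_word w : act_word w (gr_vec v) = gr_cls (deg_word w) (act_word w v).
Proof.
elim: w => [|[x j] w IHw] /=; first by rewrite /deg_word big_nil gr_vecE.
rewrite IHw gr_cls_act; last exact: filt_word.
by rewrite /deg_word big_cons /= addnC.
Qed.

Lemma filt_wordS w s : (deg_word w <= s)%N -> act_word w v \in filt v s.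
Proof.
move=> ws.
by have [+ _] := vspanP (fun u => exists w, (deg_word w <= s)%N /\ u = act_word w v); apply; exists w.
Qed.

Lemma gr_span (U : {vspace gr}) :
  (forall w, act_word w (gr_vec v) \in U) -> U = fullv.
Proof.
move=> wU; apply/eqP; rewrite eqEsubv subvf /=; apply/subvP => x _.
have [u /fam_inP uD <-] := @quo_proj_surj F _ (gr_num v) (gr_den v) x.
have -> : u = \sum_(s < (filt_bound v).+1) fam_single v s ((u : famT) s).
  apply/ffunP=> t; rewrite sum_ffunE (bigD1 t) //= ffunE eqxx big1 ?addr0 // => s st.
  by rewrite ffunE val_eqE eq_sym (negbTE st).
rewrite linear_sum; apply: rpred_sum => s _ /=; rewrite -gr_clsE.
move: ((u : famT) s) (uD s) => y; move: (s : nat) => {}s {u uD} ys.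
rewrite memv_preim; apply: subvP ys.
have [_ +] := vspanP (fun u => exists w, (deg_word w <= s)%N /\ u = act_word w v).
apply=> u [w [ws ->]]; rewrite -memv_preim.
move: ws; rewrite leq_eqVlt => /predU1P[<-|lt_ws]; first by rewrite -gr_word.
rewrite gr_cls_pred ?mem0v //.
by case: (s) lt_ws => // s' /=; rewrite ltnS; apply: filt_wordS.
Qed.

Lemma deg_word_cat w1 w2 : deg_word (w1 ++ w2) = (deg_word w1 + deg_word w2)%N.
Proof. by rewrite /deg_word big_cat. Qed.

(** For j > 0 the operator x_j raises the degree, and nothing lives above [filt_bound]. *)
Lemma gr_nilpotent x j : (0 < j)%N -> exists k, forall u : gr, iter k (act gr x j) u = 0.
Proof.
move=> j0; exists (filt_bound v).+1 => u; set k := _.+1.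
pose pw m := iter m (fun h => (act gr x j \o h)%VF) \1%VF.
have pwE m w : pw m w = iter m (act gr x j) w.
  rewrite /pw; elim: m => [|m IHm] /=; first by rewrite id_lfunE.
  by rewrite comp_lfunE IHm.
rewrite -pwE; apply/eqP; rewrite -memv_ker.
suff -> : lker (pw k) = fullv by rewrite memvf.
apply: gr_span => w; rewrite memv_ker pwE; apply/eqP.
have -> : iter k (act gr x j) (act_word w (gr_vec v)) =
          act_word (nseq k (x, j) ++ w) (gr_vec v).
  by elim: k => //= m ->.
rewrite gr_word; apply: gr_cls_pred.
have lt : (filt_bound v < deg_word (nseq k (x, j) ++ w))%N.
  rewrite deg_word_cat /deg_word big_nseq iter_addn addn0 /=.
  by apply: leq_trans (leq_addr _ _); rewrite leq_pmull.
by rewrite -filt_boundP //; apply: filt_wordS.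
Qed.

Lemma filt_bound_stab x j u :
  u \in filt v (filt_bound v) -> act M x j u \in filt v (filt_bound v).
Proof.
have H := svalP (cid (chain_stable (filt_mono v))).
by move=> /(filt_act x j); rewrite (H (_ + _)%N) ?leq_addr.
Qed.

End GradedModule.

(** * The tensor product of evaluation modules *)

Section EvaluationTensor.
Variables (F : numFieldType) (n : nat) (d : 'I_n -> nat) (z : 'I_n -> F).
Hypothesis z_inj : injective z.

Local Notation V := (tens_mod d z).
Local Notation low := (tens_low d z).

Lemma tens_actE x j (w : V) :
  act V x j w = \sum_(p < n) z p ^+ j *: tloc (irr F (d p) x) (w : tens F d).
Proof.
by rewrite /= /tens_act sum_lfunE; apply: eq_bigr => p _; rewrite scale_lfunE.
Qed.

Lemma tloc_f_low p : tloc (irr F (d p) sl2f) (low : tens F d) = 0.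
Proof.
apply/ffunP=> m; rewrite tlocE ffunE big1 // => k _; rewrite !mxE ffunE.
case: eqP => [km|_]; last by rewrite mulr0n mul0r.
rewrite [X in _ * X%:R](_ : _ = 0%N) ?mulr0 //; apply/eqP; rewrite eqb0.
by apply/negP => /forallP/(_ p); rewrite tupd_in km.
Qed.

Lemma tloc_h_low p :
  tloc (irr F (d p) sl2h) (low : tens F d) = - (d p).-1%:R *: (low : tens F d).
Proof.
apply/ffunP=> m; rewrite tlocE (bigD1 (m p)) //= big1 ?addr0 => [|k km]; last first.
  by rewrite !mxE eq_sym (negbTE km) mulr0n mul0r.
have -> : tupd m (m p) = m.
  apply/ffunP=> l; have [<-|pl] := eqVneq p l; first by rewrite tupd_in.
  by rewrite tupd_out.
rewrite !mxE eqxx mulr1n !ffunE; case: forallP => [/(_ p)/eqP ->|_].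
  by rewrite sub0r.
by rewrite !mulr0 scaler0.
Qed.

Lemma act_f_low j : act V sl2f j low = 0.
Proof. by rewrite tens_actE big1 // => p _; rewrite tloc_f_low scaler0. Qed.

Lemma act_h_low j :
  act V sl2h j low = (- \sum_(p < n) z p ^+ j * (d p).-1%:R) *: low.
Proof.
rewrite tens_actE -sumrN scaler_suml; apply: eq_bigr => p _.
by rewrite tloc_h_low scalerA mulrN.
Qed.

Definition raise (p : 'I_n) : 'End(V) := tloc (irr F (d p) sl2e).

Lemma raiseC p q (w : V) : raise p (raise q w) = raise q (raise p w).
Proof.
by have [->//|pq] := eqVneq p q; apply: tloc_comm.
Qed.

Lemma raiseE p (w : V) m : (raise p w : tens F d) m =
  \sum_(k < d p) (m p == k.+1 :> nat)%:R * (w : tens F d) (tupd m k).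
Proof. by rewrite [LHS]tlocE; apply: eq_bigr => k _; rewrite mxE. Qed.

Lemma raise_nilpotent p r (w : V) : (d p <= r)%N -> iter r (raise p) w = 0.
Proof.
move=> dr; suff H k (m : tidx d) : (m p < k)%N -> (iter k (raise p) w : tens F d) m = 0.
  by apply/ffunP=> m; rewrite H ?ffunE // (leq_trans (ltn_ord _)).
elim: k m => // k IHk m mk; rewrite iterS raiseE big1 // => l _.
case: eqP => [ml|_]; last by rewrite mul0r.
by rewrite IHk ?mulr0 // tupd_in; rewrite ml in mk.
Qed.

(** Lagrange basis polynomial: it recovers the action on a single tensor factor from the e_j, see
    [raise_act_e]. *)
Definition lag (p : 'I_n) : {poly F} :=
  \prod_(q < n | q != p) ((z p - z q)^-1 *: ('X - (z q)%:P)).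

Lemma lagE p q : (lag p).[z q] = (q == p)%:R.
Proof.
rewrite /lag horner_prod; have [->|qp] := eqVneq q p.
  rewrite big1 // => r rp; rewrite !hornerE /= mulVf // subr_eq0.
  by rewrite (inj_eq z_inj) eq_sym.
by rewrite (bigD1 q) //= !hornerE /= subrr mulr0 mul0r.
Qed.

Lemma act_e_poly (g : {poly F}) (w : V) :
  \sum_(j < size g) g`_j *: act V sl2e j w = \sum_(p < n) g.[z p] *: raise p w.
Proof.
transitivity (\sum_(j < size g) \sum_(p < n) (g`_j * z p ^+ j) *: raise p w).
  by apply: eq_bigr => j _; rewrite tens_actE scaler_sumr; apply: eq_bigr => p _; rewrite scalerA.
rewrite exchange_big; apply: eq_bigr => p _ /=.
by rewrite horner_coef scaler_suml.
Qed.

Lemma raise_act_e p (w : V) :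
  raise p w = \sum_(j < size (lag p)) (lag p)`_j *: act V sl2e j w.
Proof.
rewrite act_e_poly (bigD1 p) //= lagE eqxx scale1r big1 ?addr0 // => q qp.
by rewrite lagE (negbTE qp) scale0r.
Qed.

(** Each basis tensor arises from the lowest one by raising one factor at a time; induction on the
    sum of the indices. *)
Lemma tens_cyclic (U : {vspace V}) :
  low \in U -> (forall p w, w \in U -> raise p w \in U) -> U = fullv.
Proof.
move=> lowU raiseU; apply/eqP; rewrite eqEsubv subvf /=.
have deltaU (m : tidx d) : ([ffun m' => (m' == m)%:R] : tens F d) \in U.
  have [k] := ubnP (\sum_p (m p : nat))%N; elim: k m => // k IHk m mk.
  have [m0|] := boolP [forall p, m p == 0%N :> nat].
    rewrite (_ : [ffun m' => _] = low) //; apply/ffunP => m'; rewrite !ffunE.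
    congr ((_ : bool)%:R); apply/eqP/forallP => [->|m'0]; first exact/forallP.
    by apply/ffunP => p; apply/val_inj; rewrite /= (eqP (m'0 p)) (eqP (forallP m0 p)).
  rewrite negb_forall => /existsP[p mp0].
  have lt : ((m p).-1 < d p)%N by apply: leq_ltn_trans (leq_pred _) (ltn_ord _).
  pose m1 := tupd m (Ordinal lt).
  have m1U : ([ffun m' => (m' == m1)%:R] : tens F d) \in U.
    apply: IHk; apply: leq_trans (_ : \sum_p m p <= k)%N; last by rewrite -ltnS.
    rewrite (bigD1 p) //= [X in (_ < X)%N](bigD1 p) //= tupd_in /=.
    rewrite -addSn prednK ?lt0n // leq_add2l.
    by apply: eq_leq; apply: eq_bigr => q qp; rewrite tupd_out // eq_sym.
  suff <- : raise p ([ffun m' => (m' == m1)%:R] : tens F d) =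
    ([ffun m' => (m' == m)%:R] : tens F d) by exact: raiseU.
  apply/ffunP => m'; rewrite raiseE !ffunE.
  have [->|mm'] := eqVneq m' m.
    rewrite (bigD1 (Ordinal lt)) //= prednK ?lt0n // eqxx mul1r ffunE eqxx.
    rewrite big1 ?addr0 // => k0 /eqP k0P; case: eqP => [E|]; last by rewrite mul0r.
    by case: k0P; apply: val_inj; rewrite /= E.
  rewrite big1 // => k0 _; case: eqP => [E|]; last by rewrite mul0r.
  rewrite ffunE; case: eqP => [E'|]; last by rewrite mulr0.
  case/eqP: mm'; apply/ffunP => q; have [<-|qp] := eqVneq p q.
    have := congr1 (fun g : tidx d => g p : nat) E'; rewrite !tupd_in /= => E2.
    by apply/val_inj; rewrite /= E E2 prednK // lt0n.
  by have := congr1 (fun g : tidx d => g q : nat) E'; rewrite !tupd_out // => E2; apply/val_inj.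
apply/subvP => w _.
have -> : w = \sum_m (w : tens F d) m *: ([ffun m' => (m' == m)%:R] : tens F d).
  apply/ffunP => m; rewrite sum_ffunE (bigD1 m) //= !ffunE eqxx [_ *: _]mulr1.
  by rewrite big1 ?addr0 // => m' mm'; rewrite !ffunE eq_sym (negbTE mm') scaler0.
by apply: rpred_sum => m _; apply: rpredZ.
Qed.

Lemma filt_low_full : filt low (filt_bound low) = fullv.
Proof.
apply: tens_cyclic => [|p w wU]; first by apply: (@filt_wordS _ _ _ [::]); rewrite /deg_word big_nil.
by rewrite raise_act_e; apply: rpred_sum => j _; rewrite rpredZ // filt_bound_stab.
Qed.

Lemma dim_tens : \dim (fullv : {vspace V}) = (\prod_(p < n) d p)%N.
Proof.
rewrite dimvf; transitivity #|tidx d|; first by rewrite -[RHS]muln1.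
rewrite card_dep_ffun foldrE big_map big_enum /=.
by apply: eq_bigr => p _; rewrite card_ord.
Qed.

Lemma dim_gr_low : \dim (fullv : {vspace gr_mod low}) = (\prod_(p < n) d p)%N.
Proof. by rewrite dim_gr filt_low_full dim_tens. Qed.

End EvaluationTensor.

Lemma coef_poly_pow (R : comNzRingType) (c : nat -> R) n k s :
  ((\poly_(p < n) c p) ^+ k)`_s =
  \sum_(t : k.-tuple 'I_n | (\sum_(p <- t) (p : nat))%N == s) \prod_(p <- t) c p.
Proof.
have -> : (\poly_(p < n) c p) ^+ k =
    \sum_(f : {ffun 'I_k -> 'I_n}) (\prod_i c (f i)) *: 'X^(\sum_i f i)%N.
  rewrite -[in LHS](card_ord k) -prodr_const poly_def bigA_distr_bigA /=.
  by apply: eq_bigr => f _; rewrite scaler_prod prodrXr.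
rewrite coef_sum [RHS]big_mkcond /=.
rewrite (reindex (fun t : k.-tuple 'I_n => [ffun i => tnth t i])) /=; last first.
  exists (fun f : {ffun 'I_k -> 'I_n} => [tuple f i | i < k]) => [t _|f _].
    by apply: eq_from_tnth => i; rewrite tnth_mktuple ffunE.
  by apply/ffunP => i; rewrite ffunE tnth_mktuple.
apply: eq_bigr => t _; rewrite coefZ coefXn !big_tuple.
under eq_bigr do rewrite ffunE; under [in X in _ * X]eq_bigr do rewrite ffunE.
by rewrite eq_sym; case: eqP => _; rewrite ?mulr1 ?mulr0.
Qed.

(** * The relations of I_A modulo lower filtration *)

Section TensorRelations.
Variables (F : numFieldType) (n : nat) (d : 'I_n -> nat) (z : 'I_n -> F).
Hypothesis z_inj : injective z.
Hypothesis d_gt0 : forall p, (0 < d p)%N.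

Local Notation V := (tens_mod d z).
Local Notation low := (tens_low d z).
Local Notation pa := (polyact (@raise F n d z)).
Local Notation S := {mpoly F[n]}.

Let paD (g h : S) w : pa (g + h) w = pa g w + pa h w.
Proof. exact: polyactD. Qed.
Let paM (g h : S) w : pa (g * h) w = pa g (pa h w).
Proof. exact/polyactM/raiseC. Qed.
Let paZ a (g : S) w : pa (a *: g) w = a *: pa g w.
Proof. exact: polyactZ. Qed.

Let pa_sum I r (P : pred I) (f : I -> S) w :
  pa (\sum_(i <- r | P i) f i) w = \sum_(i <- r | P i) pa (f i) w.
Proof. exact: (ac_sum paD). Qed.

Definition eps (j : nat) : S := \sum_p z p ^+ j *: 'X_p.

Lemma pa_eps j w : pa (eps j) w = act V sl2e j w.
Proof.
by rewrite pa_sum tens_actE; apply: eq_bigr => p _; rewrite paZ polyactXi.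
Qed.

Lemma filt_leq s t : (s <= t)%N -> (filt low s <= filt low t)%VS.
Proof.
by move=> /subnK <-; elim: (t - s)%N => // k /subv_trans; apply; apply: filt_mono.
Qed.

Lemma filt_ltn s t : (s < t)%N -> (filt low s <= filt_pred low t)%VS.
Proof. by case: t => //= t; rewrite ltnS; apply: filt_leq. Qed.

(** With [U] the filtration, g raises the degree by at most c; with [U] the preceding steps, g
    vanishes as an operator of degree c on the graded module. *)
Definition shifts (U : nat -> {vspace V}) (c : nat) (g : S) : Prop :=
  forall s w, w \in filt low s -> pa g w \in U (s + c)%N.

Lemma shifts_sum U c I r (P : pred I) (f : I -> S) :
  (forall i, P i -> shifts U c (f i)) -> shifts U c (\sum_(i <- r | P i) f i).
Proof. by move=> Uf s w ws; rewrite pa_sum; apply: rpred_sum => i Pi; apply: Uf. Qed.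

Lemma shiftsM U a b g h :
  shifts (filt low) a g -> shifts U b h -> shifts U (a + b) (g * h).
Proof. by move=> fg fh s w ws; rewrite mulrC paM addnA; apply/fh/fg. Qed.

Lemma shifts0 U c : shifts U c 0.
Proof. by move=> s w _; rewrite (ac0 paD) mem0v. Qed.

Lemma shifts_eps j : shifts (filt low) j (eps j).
Proof. by move=> s w ws; rewrite pa_eps; apply: filt_act. Qed.

Lemma size_lag p : (size (lag z p) <= n)%N.
Proof.
rewrite /lag size_prod => [|q qp]; last first.
  by rewrite scaler_eq0 invr_eq0 subr_eq0 (inj_eq z_inj) polyXsubC_eq0 eq_sym orbF.
rewrite (eq_bigr (fun=> 2)) => [|q qp]; last first.
  by rewrite size_scale ?size_XsubC // invr_eq0 subr_eq0 (inj_eq z_inj) eq_sym.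
rewrite sum_nat_const cardC1 card_ord; have := ltn_ord p; lia.
Qed.

(* z_p^j is a combination of the z_p^l with l < n. *)
Lemma shifts_eps_ge j : (n <= j)%N -> shifts (filt_pred low) j (eps j).
Proof.
move=> nj s w ws; rewrite pa_eps tens_actE; apply: rpred_sum => p _; rewrite rpredZ //.
rewrite -/(raise d z p w) (raise_act_e z_inj) rpred_sum // => l _; rewrite rpredZ //.
apply: (subvP (@filt_ltn (s + l) _ _)); last exact: filt_act.
by rewrite ltn_add2l (leq_trans (ltn_ord l)) // (leq_trans (size_lag p)).
Qed.

Definition eps_poly K : {poly S} := \poly_(j < K) eps j.

Lemma shifts_eps_poly K j : shifts (filt low) j (eps_poly K)`_j.
Proof. by rewrite coef_poly; case: ifP => _; [apply: shifts_eps|apply: shifts0]. Qed.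

Lemma shifts_coefM U (g h : {poly S}) :
  (forall j, shifts (filt low) j g`_j) -> (forall j, shifts U j h`_j) ->
  forall j, shifts U j (g * h)`_j.
Proof.
move=> fg fh j; rewrite coefM; apply: shifts_sum => i _.
have ij : (i <= j)%N by rewrite -ltnS.
by have := shiftsM (fg i) (fh (j - i)%N); rewrite subnKC.
Qed.

Lemma shifts_pow K k j : shifts (filt low) j (eps_poly K ^+ k)`_j.
Proof.
elim: k j => [|k IHk] j; last first.
  rewrite exprS; exact: (shifts_coefM (shifts_eps_poly K) IHk).
rewrite coef1; case: j => [|j]; last exact: shifts0.
by move=> s w; rewrite polyact1 addn0.
Qed.

(** Modulo lower filtration e_j is zero for j >= n, and the difference of two powers splits into
    terms that contain such a factor. *)
Lemma shifts_pow_truncate K k j : (n <= K)%N ->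
  shifts (filt_pred low) j (eps_poly K ^+ k - eps_poly n ^+ k)`_j.
Proof.
move=> nK; elim: k j => [|k IHk] j; first by rewrite subrr coef0; apply: shifts0.
rewrite !exprS.
have -> : eps_poly K * eps_poly K ^+ k - eps_poly n * eps_poly n ^+ k =
  eps_poly K * (eps_poly K ^+ k - eps_poly n ^+ k) +
  eps_poly n ^+ k * (eps_poly K - eps_poly n) by ring.
rewrite coefD => s w ws; rewrite paD rpredD //.
  by apply: (shifts_coefM (shifts_eps_poly K)) ws.
apply: (shifts_coefM (shifts_pow n k)) ws => i.
rewrite coefB !coef_poly; case: (ltnP i n) => [in_|ni].
  by rewrite (leq_trans in_ nK) subrr; apply: shifts0.
by rewrite subr0; case: ifP => _; [apply: shifts_eps_ge|apply: shifts0].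
Qed.

Definition geom K p : {poly F} := \poly_(j < K) z p ^+ j.

Lemma geomE K p : (1 - z p *: 'X) * geom K p = 1 - (z p) ^+ K *: 'X^K.
Proof.
rewrite /geom; elim: K => [|K IHK].
  by rewrite poly_def big_ord0 mulr0 expr0 scale1r subrr.
rewrite poly_def big_ord_recr /= -poly_def mulrDr IHK.
by rewrite !exprS -!mul_polyC !rmorphM /=; ring.
Qed.

(** A common denominator: the series of the e_j is the sum of X_p / (1 - z_p X), and in its k-th
    power X_p has exponent at most min(k, d_p - 1) unless the term acts by zero. *)
Definition capped k : {poly F} := \prod_p (1 - z p *: 'X) ^+ minn k (d p).-1.

Lemma size_linear_prod (e : 'I_n -> nat) :
  (size (\prod_p (1 - z p *: 'X) ^+ e p)%R <= (\sum_p e p).+1)%N.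
Proof.
have sz p : (size (1 - z p *: 'X : {poly F})%R <= 2)%N.
  rewrite (leq_trans (size_polyD _ _)) // geq_max size_poly1 size_polyN /=.
  by rewrite (leq_trans (size_scale_leq _ _)) ?size_polyX.
apply: (big_ind2 (fun (q : {poly F}) e => size q <= e.+1)%N).
- by rewrite size_poly1.
- move=> q1 e1 q2 e2 h1 h2; apply: leq_trans (size_polyMleq _ _) _.
  by move: h1 h2; clear; lia.
- move=> p _; apply: leq_trans (size_poly_exp_leq _ _) _.
  by rewrite ltnS -[X in (_ <= X)%N]mul1n leq_mul2r; have := sz p; lia.
Qed.

(* (1 - z_p X) times the truncated geometric series is 1 modulo X^(K+1), so up
   to that order the product is a polynomial of degree (sum of the caps) - k. *)
Lemma capped_coef k K (f : 'I_k -> 'I_n) s :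
  (forall p, #|[pred i | f i == p]| < d p)%N ->
  (\sum_p minn k (d p).-1 < s + k)%N -> (s <= K)%N ->
  (capped k * \prod_i geom K.+1 (f i))`_s = 0.
Proof.
move=> fd ks sK; pose m p := #|[pred i | f i == p]|.
have mk p : (m p <= minn k (d p).-1)%N.
  rewrite leq_min -{1}(card_ord k) max_card /=.
  by rewrite -ltnS prednK ?d_gt0 // fd.
have sm : (\sum_p m p = k)%N.
  rewrite -[RHS](card_ord k) -sum1_card (partition_big f xpredT) //=.
  by apply: eq_bigr => p _; rewrite sum1_card.
have -> : \prod_i geom K.+1 (f i) = \prod_p geom K.+1 p ^+ m p.
  rewrite (partition_big f xpredT) //=; apply: eq_bigr => p _.
  rewrite (eq_bigr (fun=> geom K.+1 p)) => [|i /eqP -> //].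
  by rewrite prodr_const.
rewrite /capped -big_split /=.
have -> : \prod_p ((1 - z p *: 'X) ^+ minn k (d p).-1 * geom K.+1 p ^+ m p) =
    \prod_p (1 - z p *: 'X) ^+ (minn k (d p).-1 - m p) *
    \prod_p (1 - (z p) ^+ K.+1 *: 'X^(K.+1)) ^+ m p.
  rewrite -big_split /=; apply: eq_bigr => p _.
  by rewrite -geomE exprMn mulrA -exprD subnK.
have [H ->] : exists H : {poly F},
    \prod_p (1 - (z p) ^+ K.+1 *: 'X^(K.+1)) ^+ m p = 1 + H * 'X^(K.+1).
  have H1 (q1 q2 : {poly F}) : (exists H, q1 = 1 + H * 'X^(K.+1)) ->
      (exists H, q2 = 1 + H * 'X^(K.+1)) -> exists H, q1 * q2 = 1 + H * 'X^(K.+1).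
    move=> [G1 ->] [G2 ->]; exists (G1 + G2 + G1 * G2 * 'X^(K.+1)); ring.
  apply: (big_ind (fun q : {poly F} => exists H, q = 1 + H * 'X^(K.+1))) => [|//|p _].
    by exists 0; rewrite mul0r addr0.
  elim: (m p) => [|e IHe]; first by exists 0; rewrite mul0r addr0.
  rewrite exprS; apply: H1 => //; exists (- (z p ^+ K.+1)%:P).
  by rewrite mulNr mul_polyC.
rewrite mulrDr mulr1 coefD mulrA coefMXn ltnS sK addr0.
apply: nth_default; apply: leq_trans (size_linear_prod _) _.
rewrite sumnB; last by move=> p _; apply: mk.
have : (\sum_p m p <= \sum_p minn k (d p).-1)%N by apply: leq_sum => p _; apply: mk.
by rewrite sm; move: ks; clear; lia.
Qed.

Lemma pa_monomial k (f : 'I_k -> 'I_n) p w :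
  (d p <= #|[pred i | f i == p]|)%N -> pa (\prod_i 'X_(f i)) w = 0.
Proof.
move=> dp; rewrite (bigID (fun i => f i == p)) /=.
rewrite (eq_bigr (fun=> 'X_p)) => [|i /eqP -> //]; rewrite prodr_const paM.
have H m w' : pa ('X_p ^+ m) w' = iter m (raise d z p) w'.
  by elim: m => [|m IHm]; rewrite ?expr0 ?polyact1 // exprS paM IHm polyactXi.
by rewrite H raise_nilpotent.
Qed.

(** The k-th power is expanded into monomials. Either some X_p occurs at least d_p times and the
    monomial acts by zero, or its scalar coefficient vanishes by [capped_coef]. *)
Lemma capped_relation k K s w :
  (\sum_p minn k (d p).-1 < s + k)%N -> (s <= K)%N ->
  pa (map_poly (@mpolyC n F) (capped k) * eps_poly K.+1 ^+ k)`_s w = 0.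
Proof.
move=> ks sK.
have -> : eps_poly K.+1 = \sum_p ('X_p)%:P * map_poly (@mpolyC n F) (geom K.+1 p).
  apply/polyP => j; rewrite coef_poly coef_sum.
  under eq_bigr do rewrite coefCM coef_map coef_poly /=.
  case: ifP => _; last by rewrite big1 // => p _; rewrite rmorph0 mulr0.
  by apply: eq_bigr => p _; rewrite mulrC mul_mpolyC.
rewrite -[in X in _ ^+ X](card_ord k) -prodr_const bigA_distr_bigA /=.
rewrite mulr_sumr coef_sum pa_sum big1 // => f _.
rewrite big_split /= -rmorph_prod -rmorph_prod mulrCA -rmorphM coefCM coef_map /=.
have [/forallP fd|] := boolP [forall p, #|[pred i | f i == p]| < d p]%N.
  rewrite capped_coef // rmorph0 mulr0; exact: (ac0 paD).
rewrite negb_forall => /existsP[p]; rewrite -leqNgt => dp.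
by rewrite mulrC paM [pa (\prod_i _) w](pa_monomial _ dp) linear0.
Qed.

(** [capped k] has constant term 1, so [capped_relation] expresses the coefficient of degree s
    through those of smaller degree, which act in lower filtration. *)
Lemma eps_pow_low k s : (\sum_p minn k (d p).-1 < s + k)%N ->
  pa (eps_poly n ^+ k)`_s low \in filt_pred low s.
Proof.
(* The truncation must reach s for [capped_relation] and n for [shifts_pow_truncate]. *)
move=> ks; pose K := maxn s n; pose T := eps_poly K.+1.
have low0 : low \in filt low 0 by apply: (@filt_wordS _ _ _ [::]); rewrite /deg_word big_nil.
have -> : (eps_poly n ^+ k)`_s = (T ^+ k)`_s - (T ^+ k - eps_poly n ^+ k)`_s.
  by rewrite coefB subKr.
have nK : (n <= K.+1)%N by rewrite leqW // leq_maxr.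
have := shifts_pow_truncate k s nK low0; rewrite add0n -/T => inD.
rewrite -scaleN1r paD paZ; apply: rpredD; last exact: rpredZ inD.
have := capped_relation low ks (leq_maxl s n); rewrite -/K -/T coefM big_ord_recl /=.
rewrite coef_map /= subn0 -horner_coef0 horner_prod big1 => [|p _]; last first.
  by rewrite !hornerE /= ?mulr0 ?subr0 ?expr1n.
rewrite rmorph1 mul1r paD => /eqP; rewrite addr_eq0 => /eqP ->; rewrite rpredN.
rewrite pa_sum; apply: rpred_sum => i _.
rewrite coef_map /= mul_mpolyC paZ; apply: rpredZ.
have := shifts_pow K.+1 k (s - bump 0 i) low0; rewrite add0n.
apply/subvP/filt_ltn; rewrite /bump /= add1n; have := ltn_ord i; lia.
Qed.

End TensorRelations.

(** * Coefficients of powers of e_(n)(z) *)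

Section PowerCoefficients.
Variables (F : numFieldType) (n : nat).

Local Notation cur := (@current {mpoly F[n]} n (evar F n) 0).

Lemma epow_coef_current (M : sl2t_mod F) j k s (v : M) :
  epow_coef (n - j) k s v = eact M (@current {mpoly F[n]} n (evar F n) j ^+ k)`_s v.
Proof.
rewrite /current (coef_poly_pow (fun p => evar F n (j + p))) (ac_sum (@eactD F n M)).
apply: eq_bigr => t _; elim: (t : seq 'I_(n - j)) => [|p r IHr]; first by rewrite big_nil eact1.
have jp : (j + p < n)%N by have := ltn_ord p; lia.
rewrite big_cons eactM eact_evar //= IHr; congr (act M _ _ _).
by move: jp; clear; lia.
Qed.

Lemma epow_coefE (M : sl2t_mod F) k s (v : M) :
  epow_coef n k s v = eact M (cur ^+ k)`_s v.
Proof. by have := epow_coef_current 0 k s v; rewrite subn0. Qed.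

Lemma deg_word_epow k (t : k.-tuple 'I_n) :
  (deg_word [seq (sl2e, (n.-1 - (p : nat))%N) | p : 'I_n <- t] +
   \sum_(p <- t) (p : nat) = k * n.-1)%N.
Proof.
rewrite /deg_word big_map -big_split /= -[in RHS](size_tuple t).
rewrite (eq_bigr (fun=> n.-1)) => [|p _]; first by rewrite big_const_seq count_predT iter_addn_0 mulnC.
by have := ltn_ord p; lia.
Qed.

Lemma epow_coef_large (M : sl2t_mod F) k s (v : M) :
  (k * n.-1 < s)%N -> epow_coef n k s v = 0.
Proof.
move=> ks; rewrite /epow_coef big_pred0 // => t; apply/eqP => ts.
by have := deg_word_epow t; rewrite ts; lia.
Qed.

Lemma epow_coef_gr (M : sl2t_mod F) k s (v : M) :
  epow_coef n k s (gr_vec v) = gr_cls v (k * n.-1 - s) (epow_coef n k s v).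
Proof.
rewrite /epow_coef linear_sum; apply: eq_bigr => t /eqP ts.
by rewrite gr_word -(deg_word_epow t) ts addnK.
Qed.

(** Reversing the indices, p -> n-1-p, turns the degree s in z into the degree k(n-1) - s in t. *)
Lemma epow_coef_eps (d : 'I_n -> nat) (z : 'I_n -> F) k s (w : tens_mod d z) :
  (s <= k * n.-1)%N -> epow_coef n k s w =
  polyact (@raise F n d z) (eps_poly z n ^+ k)`_(k * n.-1 - s) w.
Proof.
move=> sk; rewrite /eps_poly coef_poly_pow (ac_sum (@polyactD F _ n (@raise F n d z))).
rewrite (reindex (fun t : k.-tuple 'I_n => map_tuple (@rev_ord n) t)) /=; last first.
  by exists (fun t => map_tuple (@rev_ord n) t) => t _; apply/val_inj;
    rewrite /= -map_comp map_id_in // => p _; rewrite /= rev_ordK.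
apply: eq_big => t.
  have E : (\sum_(p <- [seq rev_ord i | i <- t]) (p : nat) + \sum_(p <- t) (p : nat) = k * n.-1)%N.
    rewrite -(deg_word_epow t) /deg_word !big_map; congr addn; apply: eq_bigr => p _ /=.
    by have := ltn_ord p; lia.
  move: E sk; move: (\sum_(p <- map _ _) _)%N (\sum_(p <- t) _)%N (_ * _)%N; clear => a b c.
  lia.
move=> _; elim: (t : seq 'I_n) => [|p r IHr]; first by rewrite big_nil polyact1.
rewrite big_cons (polyactM (@raiseC F n d z)) pa_eps -IHr /=.
by have -> : (n - p.+1 = n.-1 - p)%N by lia.
Qed.

End PowerCoefficients.

(** * Lowest weight, relations and dimension of M^A *)

Section FusionProduct.
Variables (F : numFieldType) (A : seq nat) (z : seq F).
Hypotheses (A_gt0 : all (fun a => 0 < a)%N A) (zA : eval_points A z).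

Local Notation n := (size A).
Local Notation v := (fusion_vec A z).
Local Notation d := (fun p : 'I_n => nth 0%N A p).
Local Notation zz := (fun p : 'I_n => z`_p).
Local Notation low := (tens_low d zz).

Let z_inj : injective zz.
Proof.
move: zA => /andP[/eqP sz uz] p q /eqP; rewrite nth_uniq ?sz //.
by move=> /eqP/val_inj.
Qed.

Let d_gt0 p : (0 < d p)%N.
Proof. by move/allP: A_gt0; apply; apply: mem_nth. Qed.

Let low0 : low \in filt low 0.
Proof. by apply: (@filt_wordS _ _ _ [::]); rewrite /deg_word big_nil. Qed.

Definition weight (B : seq nat) : F := - (\sum_(a <- B) a.-1)%N%:R.

Lemma fusion_vecE : v = gr_cls low 0 low. Proof. exact: gr_vecE. Qed.

Lemma fusion_lowest : lowest n (weight A) v.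
Proof.
split=> j; rewrite fusion_vecE gr_cls_act // add0n.
- by rewrite act_f_low linear0.
- rewrite act_h_low; case: eqP => [->|/eqP j0].
    rewrite linearZ /= /weight (big_nth 0%N) big_mkord natr_sum.
    by congr (- _ *: _); apply: eq_bigr => p _; rewrite expr0 mul1r.
  rewrite gr_cls_pred // rpredZ //; apply: (subvP (@filt_ltn _ _ _ _ 0 _ _)) => //.
  by rewrite lt0n.
- move=> nj; rewrite gr_cls_pred // -pa_eps.
  by have := shifts_eps_ge z_inj nj low0; rewrite add0n.
Qed.

Lemma fusion_satisfies :
  satisfies (eact (fusion A z)) (@current {mpoly F[n]} n (evar F n) 0) (NA A) 0%VS v.
Proof.
move=> k s sN; rewrite memv0 -epow_coefE; have [sk|ks] := leqP s (k * n.-1); last first.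
  by rewrite epow_coef_large.
rewrite epow_coef_gr gr_cls_pred // epow_coef_eps //.
apply: eps_pow_low => //.
(* For a > 0, max(k+1-a, 0) + min(k, a-1) = k; this converts N_A into the bound of [eps_pow_low]. *)
have E : (NA A k + \sum_p minn k (d p).-1 = k * n)%N.
  rewrite /NA (big_nth 0%N) big_mkord -big_split /= mulnC.
  rewrite (eq_bigr (fun=> k)) => [|p _]; first by rewrite sum_nat_const card_ord.
  by have := d_gt0 p; lia.
have n0 : (0 < n)%N by case: (A) sN => //; rewrite NA_nil.
move: E sN sk; rewrite -[in (k * n)%N](prednK n0) mulnS.
by move: (_ * _)%N (\sum_p _)%N (NA A k); clear; lia.
Qed.

Lemma fusion_cyclic :
  cyc (eact (n:=n) (fusion A z)) 0%VS v = fullv.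
Proof.
apply: gr_span => w; elim: w => [|[x j] w IHw].
  exact: (@ecyc_id F n (fusion A z) 0%VS v).
exact: (@ecyc_act F n (fusion A z) _ _ x j _ fusion_lowest IHw).
Qed.

Lemma fusion_dim : \dim (fullv : {vspace fusion A z}) = (\prod_(a <- A) a)%N.
Proof. by rewrite dim_gr_low // (big_nth 0%N) big_mkord. Qed.

End FusionProduct.

(** * The submodule generated by the embedding vector *)

Section Weights.
Variables (F : numFieldType) (n : nat) (M : sl2t_mod F).

(* Apply h - c t to remove the term x t from the sum. *)
Lemma eigenvector_sum_eq0 (h : 'End(M)) (T : eqType) (s : seq T) (x : T -> M) (c : T -> F) mu :
    (forall t, h (x t) = c t *: x t) -> {in s, forall t, c t != mu} ->
    h (\sum_(t <- s) x t) = mu *: \sum_(t <- s) x t ->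
  \sum_(t <- s) x t = 0.
Proof.
elim: s x => [|t s IHs] x hx cmu; first by rewrite !big_nil.
set y := \sum_(_ <- _) _ => hy.
have E : (mu - c t) *: y = \sum_(t' <- s) (c t' - c t) *: x t'.
  rewrite scalerBl -hy /y !big_cons linearD linear_sum /= hx scalerDr scaler_sumr.
  rewrite opprD addrACA subrr add0r -sumrB; apply: eq_bigr => t' _.
  by rewrite hx scalerBl.
have /eqP : (mu - c t) *: y = 0.
  rewrite E; apply: IHs => [t'|t' t's|].
  - by rewrite linearZ /= hx !scalerA mulrC.
  - by apply: cmu; rewrite inE t's orbT.
  - by rewrite -E linearZ /= hy !scalerA mulrC.
by rewrite scaler_eq0 subr_eq0 eq_sym (negbTE (cmu t _)) ?inE ?eqxx // => /eqP.
Qed.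

Lemma act_he j c (u : M) : act M sl2h 0 u = c *: u ->
  act M sl2h 0 (act M sl2e j u) = (c + 2%:R) *: act M sl2e j u.
Proof.
move=> hu; apply/eqP; rewrite scalerDl -subr_eq; apply/eqP.
have := act_br sl2h sl2e 0 j u; rewrite add0n hu linearZ /= => <-.
by rewrite opprB addrCA subrr addr0.
Qed.

Lemma act_h_word (s : seq nat) lam (u : M) : act M sl2h 0 u = lam *: u ->
  act M sl2h 0 (act_word [seq (sl2e, j) | j <- s] u) =
  (lam + (size s).*2%:R) *: act_word [seq (sl2e, j) | j <- s] u.
Proof.
move=> hu; elim: s => [|j s IHs] /=; first by rewrite addr0.
by rewrite (act_he _ IHs) -addrA -natrD addn2.
Qed.

Lemma act_h_epow k s lam (u : M) : act M sl2h 0 u = lam *: u ->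
  act M sl2h 0 (epow_coef n k s u) = (lam + k.*2%:R) *: epow_coef n k s u.
Proof.
move=> hu; rewrite /epow_coef linear_sum scaler_sumr; apply: eq_bigr => t _ /=.
have := act_h_word [seq (n.-1 - (p : nat))%N | p : 'I_n <- t] hu.
by rewrite -map_comp size_map size_tuple.
Qed.

Lemma act_h_monomial (m : 'X_{1..n}) lam (u : M) : act M sl2h 0 u = lam *: u ->
  act M sl2h 0 (eact M 'X_[m] u) = (lam + (mdeg m).*2%:R) *: eact M 'X_[m] u.
Proof.
move=> hu; rewrite /eact polyactX mdegE -big_enum /=.
elim: (enum 'I_n) => [|i s IHs] /=; first by rewrite big_nil addr0.
rewrite big_cons; elim: (m i) => [|k IHk] //=.
by rewrite (act_he _ IHk) addSn doubleS -addrA -natrD addn2.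
Qed.

Lemma eact_monomials (g : {mpoly F[n]}) (u : M) :
  eact M g u = \sum_(m <- msupp g) g@_m *: eact M 'X_[m] u.
Proof.
rewrite {1}[g]mpolyE (ac_sum (@eactD F n M)); apply: eq_bigr => m _.
by rewrite /eact polyactZ.
Qed.

Lemma eact_weight (g : {mpoly F[n]}) lam mu (u : M) : act M sl2h 0 u = lam *: u ->
    act M sl2h 0 (eact M g u) = mu *: eact M g u ->
  eact M g u =
  \sum_(m <- msupp g | lam + (mdeg m).*2%:R == mu) g@_m *: eact M 'X_[m] u.
Proof.
move=> hu; rewrite eact_monomials.
have hX m : act M sl2h 0 (g@_m *: eact M 'X_[m] u) =
    (lam + (mdeg m).*2%:R) *: (g@_m *: eact M 'X_[m] u).
  by rewrite linearZ /= (act_h_monomial _ hu) !scalerA mulrC.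
rewrite (bigID (fun m => lam + (mdeg m).*2%:R == mu)) /=.
set x := \sum_(m <- _ | _ == _) _; rewrite -big_filter; set s := filter _ _.
have hx : act M sl2h 0 x = mu *: x.
  by rewrite linear_sum scaler_sumr; apply: eq_bigr => m /eqP <-; apply: hX.
rewrite linearD scalerDr /= hx => /addrI/(eigenvector_sum_eq0 hX) ->; rewrite ?addr0 //.
by move=> m; rewrite mem_filter => /andP[].
Qed.

(** The e's generate from u only weights lam + 2m, m >= 0. So f_j u, of weight lam - 2, is zero, and
    h_j u is a multiple of u, which is zero as h_j is nilpotent. *)
Lemma lowest_of_stable lam (u : M) :
    (forall x j w, w \in cyc (eact (n := n) M) 0%VS u ->
       act M x j w \in cyc (eact (n := n) M) 0%VS u) ->
    (forall j, (0 < j)%N -> exists k, forall w : M, iter k (act M sl2h j) w = 0) ->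
    act M sl2h 0 u = lam *: u ->
  (forall j, act M sl2f j u = 0) /\ (forall j, (0 < j)%N -> act M sl2h j u = 0).
Proof.
move=> stabu nilh hu; have uu := @ecyc_id F n M 0%VS u; split=> j.
  have [g fg] := ecyc0P (stabu sl2f j _ uu); rewrite fg.
  have hf : act M sl2h 0 (act M sl2f j u) = (lam - 2%:R) *: act M sl2f j u.
    apply/eqP; rewrite scalerBl -scaleNr -subr_eq; apply/eqP.
    have := act_br sl2h sl2f 0 j u; rewrite add0n hu linearZ /= => <-.
    by rewrite opprB addrCA subrr addr0.
  rewrite fg in hf; rewrite (eact_weight hu hf) big_pred0 // => m.
  apply/negbTE; rewrite (inj_eq (addrI lam)) -subr_eq0 opprK -natrD.
  by rewrite pnatr_eq0 addn2.
move=> j0; have [g hg] := ecyc0P (stabu sl2h j _ uu).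
have hh : act M sl2h 0 (act M sl2h j u) = lam *: act M sl2h j u.
  by apply/eqP; rewrite -subr_eq0 -linearZ -hu act_br scale0r.
have [c hc] : exists c, act M sl2h j u = c *: u.
  exists g@_0%MM; rewrite hg in hh *; rewrite (eact_weight hu hh).
  rewrite (eq_bigl (fun m => m == 0%MM)) => [|m]; last first.
    by rewrite -subr_eq0 addrC addKr pnatr_eq0 double_eq0 mdeg_eq0.
  have [m0|m0] := boolP (0%MM \in msupp g).
    by rewrite -big_filter filter_pred1_uniq ?msupp_uniq // big_seq1 mpolyX0 eact1.
  rewrite (memN_msupp_eq0 m0) scale0r big1_seq // => m /andP[/eqP ->].
  by rewrite (negbTE m0).
have [k hk] := nilh j j0; have : iter k (act M sl2h j) u = c ^+ k *: u.
  elim: k {hk} => [|k IHk]; first by rewrite expr0 scale1r.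
  by rewrite iterS IHk linearZ /= hc scalerA exprSr.
rewrite hk => /esym/eqP; rewrite scaler_eq0 expf_eq0 => /orP[/andP[_ /eqP c0]|/eqP u0].
  by rewrite hc c0 scale0r.
by rewrite u0 linear0.
Qed.

End Weights.

(** * Homomorphisms, quotients and abstract fusion products *)

Section Homomorphisms.
Variables (F : numFieldType) (n : nat).

Lemma mod_hom_eact (M N : sl2t_mod F) (f : mod_hom M N) (g : {mpoly F[n]}) u :
  f (eact M g u) = eact N g (f u).
Proof. by apply: hom_eact => j w; apply: mod_homP. Qed.

Lemma mod_hom_epow (M N : sl2t_mod F) (f : mod_hom M N) k s u :
  f (epow_coef n k s u) = epow_coef n k s (f u).
Proof. by rewrite !epow_coefE mod_hom_eact. Qed.

Lemma submod_eact_stab (M : sl2t_mod F) (U : {vspace M}) :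
  (forall x j u, u \in U -> act M x j u \in U) -> stab (eact (n := n) M) U.
Proof. by move=> HU; apply: eact_gen => p u pn uU; rewrite eact_evar ?HU. Qed.

Lemma limg_onto (M N : sl2t_mod F) (f : mod_hom M N) v :
  cyc (eact (n := n) N) 0%VS (f v) = fullv -> limg f = fullv.
Proof.
move=> cN; apply/eqP; rewrite eqEsubv subvf /= -cN.
apply: cyc_min; rewrite ?sub0v ?memv_img ?memvf //.
by apply: submod_eact_stab; apply: img_subproof.
Qed.

End Homomorphisms.

Lemma dim_lker_onto (F : fieldType) (V W : vectType F) (f : 'Hom(V, W)) :
  limg f = fullv ->
  (\dim (lker f) + \dim (fullv : {vspace W}) = \dim (fullv : {vspace V}))%N.
Proof. by move=> <-; rewrite -{1}[lker f]capfv limg_ker_dim. Qed.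

Lemma quo_mod_iso (F : fieldType) (M N : sl2t_mod F) (f : mod_hom M N)
    (D K : submod M) (Q : submod N) :
  (f @: D = Q)%VS -> K = (D :&: lker f)%VS :> {vspace M} -> mod_iso (quo_mod D K) (submod_mod Q).
Proof.
move=> fD KE.
have KP u : (u \in (K : {vspace M})) = (u \in D) && (u \in lker f).
  by rewrite KE memv_cap.
pose phi : 'Hom(quo_mod D K, submod_mod Q) :=
  (linfun (vsproj Q) \o f \o linfun vsval)%VF.
have fQ (w : quo_mod D K) : f (vsval w) \in (Q : {vspace N}).
  by rewrite -fD memv_img // quo_repD.
have phiE (w : quo_mod D K) : vsval (phi w) = f (vsval w).
  by rewrite /phi !comp_lfunE [linfun vsval w]lfunE lfunE /= vsprojK.
have fproj u : u \in D -> f (vsval (quo_proj D K u)) = f u.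
  move=> uD; apply/eqP; rewrite eq_sym -subr_eq0 -linearB -memv_ker.
  by have := quo_proj_rep K uD; rewrite KP => /andP[].
have phi_act x j w : phi (act (quo_mod D K) x j w) = act (submod_mod Q) x j (phi w).
  apply: subvs_inj; rewrite phiE [in RHS]sub_actE phiE -mod_homP /= quo_actE fproj //.
  by rewrite submodP // quo_repD.
exists (ModHom phi_act); split; apply/eqP.
  rewrite -subv0; apply/subvP => w; rewrite memv_ker memv0 /= => /eqP w0.
  have : vsval w \in (K : {vspace M}).
    by rewrite KP quo_repD memv_ker -phiE w0 linear0 /=.
  by rewrite -(quo_projP K (quo_repD w)) quo_proj_repK.
rewrite eqEsubv subvf /=; apply/subvP => y _.
have : vsval y \in (f @: D)%VS by rewrite fD subvsP.
case/memv_imgP => u uD yu; have -> : y = phi (quo_proj D K u).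
  by apply: subvs_inj; rewrite phiE fproj.
by rewrite memv_img ?memvf.
Qed.

Lemma ecyc_full (F : numFieldType) n (M : sl2t_mod F) (Z : {vspace M}) v :
    stab (eact (n := n) M) Z -> cyc (eact (n := n) M) 0%VS v = fullv ->
  cyc (eact (n := n) M) Z v = fullv.
Proof.
move=> stabZ cv; apply/eqP; rewrite eqEsubv subvf /= -cv.
by apply: cyc_min; [apply: ecyc_stab|apply: sub0v|apply: ecyc_id].
Qed.

(* The properties of M^A and v_A from which the theorem follows. *)
Record fusion_like (F : numFieldType) (A : seq nat) (M : sl2t_mod F) (v : M) : Prop :=
  FusionLike {
    fl_lowest : lowest (size A) (weight F A) v;
    fl_satisfies : satisfies (eact M)
      (@current {mpoly F[size A]} (size A) (evar F (size A)) 0) (NA A) 0%VS v;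
    fl_cyclic : cyc (eact (n := size A) M) 0%VS v = fullv;
    fl_dim : \dim (fullv : {vspace M}) = (\prod_(a <- A) a)%N;
    fl_nilpotent : forall j, (0 < j)%N ->
      exists k, forall u : M, iter k (act M sl2h j) u = 0
  }.

Lemma fusion_fusion_like (F : numFieldType) (A : seq nat) (z : seq F) :
  all (fun a => 0 < a)%N A -> eval_points A z -> fusion_like A (fusion_vec A z).
Proof.
move=> A0 eA; split.
- exact: fusion_lowest.
- exact: fusion_satisfies.
- exact: fusion_cyclic.
- exact: fusion_dim.
- by move=> j; apply: gr_nilpotent.
Qed.

Lemma fusion_like_hom (F : numFieldType) (A B : seq nat) (M N : sl2t_mod F) (v : M) (u : N) :
    fusion_like A v -> fusion_like B u ->
    size A = size B -> weight F A = weight F B -> (forall k, NA A k <= NA B k)%N ->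
  exists f : mod_hom M N, f v = u /\ limg f = fullv.
Proof.
move=> fA fB sAB wAB leN.
have lB : lowest (size A) (weight F A) u by rewrite wAB sAB; apply: fl_lowest fB.
have sB : satisfies (eact (n := size A) N)
    (@current {mpoly F[size A]} (size A) (evar F (size A)) 0) (NA A) 0%VS u.
  by apply: (satisfies_le leN); rewrite sAB; apply: fl_satisfies fB.
have [||f [fv _]] := lowest_hom erefl (fl_lowest fA) lB _ _ (fl_satisfies fA) sB.
- by rewrite (fl_dim fA).
- exact: fl_cyclic fA.
by exists f; split=> //; apply: (@limg_onto F (size B) _ _ f v); rewrite fv; apply: fl_cyclic fB.
Qed.

Lemma fusion_like_hom_unique (F : numFieldType) (A : seq nat) (M N : sl2t_mod F) (v : M)
    (f h : 'Hom(M, N)) :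
    fusion_like A v -> (forall j u, f (act M sl2e j u) = act N sl2e j (f u)) ->
    (forall j u, h (act M sl2e j u) = act N sl2e j (h u)) -> f v = h v ->
  f =1 h.
Proof.
move=> fA fe he fh u; have : u \in cyc (eact (n := size A) M) 0%VS v.
  by rewrite (fl_cyclic fA) memvf.
by case/ecyc0P=> g ->; rewrite (hom_eact fe) (hom_eact he) fh.
Qed.

(** * Arithmetic of A, A1 = A_(i,i+1), B = A_(i-1,i), B1 = B_(i,i+1) and C = A_i *)

Section EmbeddingVector.
Variables (L H : seq nat) (g b d : nat).
Hypotheses (g_gt1 : (1 < g)%N) (gb : (g <= b)%N) (bd : (b < d)%N).

Local Notation A := (L ++ [:: g, b, d & H]).
Local Notation A1 := (L ++ [:: g, b - 1, d + 1 & H])%N.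
Local Notation B := (L ++ [:: g - 1, b + 1, d & H])%N.
Local Notation B1 := (L ++ [:: g - 1, b, d + 1 & H])%N.
Local Notation C := (L ++ (g + d - b)%N :: H).

Lemma NA_shift k : NA A1 k = (NA A k + (b.-1 <= k < d))%N.
Proof.
rewrite !NA_cat !NA_cons; move: (NA L k) (NA H k) => x y.
by clear -g_gt1 gb bd; lia.
Qed.

Lemma NA_shift' k : NA B1 k = (NA B k + (b <= k < d))%N.
Proof.
rewrite !NA_cat !NA_cons; move: (NA L k) (NA H k) => x y.
by clear -g_gt1 gb bd; lia.
Qed.

Lemma NA_prev k : NA B k = (NA A k + (g.-1 <= k < b))%N.
Proof.
rewrite !NA_cat !NA_cons; move: (NA L k) (NA H k) => x y.
by clear -g_gt1 gb bd; lia.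
Qed.

Lemma NA_prev' k : NA B1 k = (NA A1 k + (g.-1 <= k < b.-1))%N.
Proof.
rewrite !NA_cat !NA_cons; move: (NA L k) (NA H k) => x y.
by clear -g_gt1 gb bd; lia.
Qed.

(** This is the hypothesis of [satisfies_coef] for the embedding vector. Convexity covers [L] and
    [H]; the entries g, b, d account for 2q and the entry g + d - b. *)
Lemma NA_contract q t : (t <= b.-1)%N -> (t <= q)%N ->
  (NA A b.-1 + (q.*2 + NA C q) <= NA A (b.-1 + q - t) + NA A t + t.*2)%N.
Proof.
move=> tb tq; have := NA_convex L tb tq; have := NA_convex H tb tq.
pose T k := (k.+1 - g + (k.+1 - b + (k.+1 - d)))%N.
have TE : (T b.-1 + (q.*2 + (q.+1 - (g + d - b))) <= T (b.-1 + q - t) + T t + t.*2)%N.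
  have [e dE] : exists e, d = (b + e)%N by exists (d - b)%N; clear -bd; lia.
  have [r qE] : exists r, q = (t + r)%N by exists (q - t)%N; clear -tq; lia.
  have [s bE] : exists s, b = (t + s).+1 by exists (b.-1 - t)%N; clear -tb g_gt1 gb; lia.
  have -> : T b.-1 = (b - g)%N by rewrite /T; clear -g_gt1 gb bd; lia.
  have -> : T (b.-1 + q - t)%N = (b + r - g + r + (r - e))%N.
    by rewrite /T; clear -dE qE bE gb; lia.
  have -> : T t = (t.+1 - g)%N by rewrite /T; clear -bd bE; lia.
  have -> : (g + d - b = g + e)%N by clear -dE; lia.
  by clear -dE qE bE gb; lia.
have AE k : NA A k = (NA L k + T k + NA H k)%N by rewrite NA_cat !NA_cons /T !addnA.
rewrite !AE NA_cat NA_cons; move: TE; move: (T _) (T _) (T _); clear.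
move: (NA L _) (NA L _) (NA L _) (NA L _) (NA H _) (NA H _) (NA H _) (NA H _) => *; lia.
Qed.

(** Read as dimensions: dim ker p = dim ker q + dim M^C. *)
Lemma prod_contract :
  (\prod_(a <- A) a + \prod_(a <- B1) a = \prod_(a <- A1) a + \prod_(a <- B) a + \prod_(a <- C) a)%N.
Proof.
rewrite !big_cat !big_cons /=; move: (\prod_(a <- L) a)%N (\prod_(a <- H) a)%N => x y.
have [e ->] : exists e, d = (b + e)%N by exists (d - b)%N; clear -bd; lia.
have -> : (g + (b + e) - b = g + e)%N by clear; lia.
have [g' ->] : exists g', g = g'.+1 by exists g.-1; clear -g_gt1; lia.
have [b' ->] : exists b', b = b'.+1 by exists b.-1; clear -g_gt1 gb; lia.
by rewrite !subn1 !addn1 /=; clear; ring.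
Qed.

Lemma size_contract : size A = (size C).+2.
Proof. by rewrite !size_cat /= !addnS. Qed.

End EmbeddingVector.

(** * The embedded module and the isomorphism *)

Section Embedding.
Variables (F : numFieldType) (L H : seq nat) (g b d : nat).
Hypotheses (Lg : all (fun a => a <= g)%N L)
  (dH : all (fun a => d <= a)%N H) (g_gt1 : (1 < g)%N) (gb : (g <= b)%N) (bd : (b < d)%N).

Local Notation A := (L ++ [:: g, b, d & H]).
Local Notation A1 := (L ++ [:: g, b - 1, d + 1 & H])%N.
Local Notation B := (L ++ [:: g - 1, b + 1, d & H])%N.
Local Notation B1 := (L ++ [:: g - 1, b, d + 1 & H])%N.
Local Notation C := (L ++ (g + d - b)%N :: H).
Local Notation n := (size A).

Lemma weight_contract : weight F A + (b - 1).*2%:R = weight F C.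
Proof.
apply/eqP; rewrite /weight addrC subr_eq addrC eq_sym subr_eq -!natrD eqr_nat.
rewrite !big_cat !big_cons /=; move: (\sum_(_ <- L) _)%N (\sum_(_ <- H) _)%N => x y.
by clear -g_gt1 gb bd; lia.
Qed.

Section EmbeddedVector.
Variables (M : sl2t_mod F) (v : M).
Hypothesis fA : fusion_like A v.

Local Notation cur := (@current {mpoly F[n]} n (evar F n)).

Let w : M := epow_coef n (b - 1) (NA A (b - 1)) v.

Lemma emb_satisfies : satisfies (eact M) (cur 0)
  (fun q => q.*2 + NA C q)%N 0%VS w.
Proof.
rewrite /w subn1 epow_coefE.
apply: (satisfies_coef (@eactD F n M) (@eactM F n M)); first exact: stab0.
  exact: fl_satisfies fA.
by move=> q t tb tq _; apply: NA_contract.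
Qed.

Let n2 : (1 < n)%N. Proof. by rewrite size_contract. Qed.

Let Y0 : eact M (evar F n 0) w = 0.
Proof.
have := @emb_satisfies 1%N 0%N; rewrite current_coef0 ?expr1; last by clear -n2; lia.
by rewrite memv0 => /(_ isT)/eqP.
Qed.

Let satisfies1 : satisfies (eact M) (cur 1) (fun q => q + NA C q)%N 0%VS w.
Proof.
apply: (satisfies_shift (@eactD F n M) (@eactM F n M)).
- by clear -n2; lia.
- exact: stab0.
- by rewrite Y0 mem0v.
by apply: satisfies_le emb_satisfies => k; rewrite addnA addnn.
Qed.

Let Y1 : eact M (evar F n 1) w = 0.
Proof.
have := @satisfies1 1%N 0%N; rewrite current_coef0 ?expr1 //.
by rewrite memv0 => /(_ isT)/eqP.
Qed.

(** As w is killed by e_(n-1) and e_(n-2), the series loses two terms; each loss takes q off the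
    bound 2q + N_C(q). *)
Lemma emb_satisfies_contract :
  satisfies (eact M) (@current {mpoly F[size C]} (size C) (evar F (size C)) 0)
    (NA C) 0%VS w.
Proof.
have : satisfies (eact M) (cur 2) (NA C) 0%VS w.
  apply: (satisfies_shift (@eactD F n M) (@eactM F n M)) => //; first exact: stab0.
  by rewrite Y1 mem0v.
move=> sat k s sN; have := sat k s sN; rewrite -!epow_coefE -epow_coef_current.
by rewrite size_contract subn2.
Qed.

(** Modulo the span of w the vector v satisfies the additional relation, and v generates all of M.
    The upper bound for dim M in [dim_cyc_plus_le] thus becomes a lower bound for the span of w. *)
Lemma emb_dim : (\prod_(a <- C) a <= \dim (cyc (eact (n := n) M) 0%VS w))%N.
Proof.
set W := cyc _ _ _; have stabW : stab (eact (n := n) M) W by apply/ecyc_stab/stab0.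
have := @dim_cyc_plus_le F _ M (eact M) (@eactD F n M) (@eactM F n M) (@eact1 F n M)
  n (evar F n) (@eact_gen F n M) L g b d H 0 W v.
rewrite (ecyc_full stabW (fl_cyclic fA)) (fl_dim fA).
move=> UB; rewrite -(leq_add2l (\prod_(a <- A) a)%N) [X in (_ <= X)%N]addnC; apply: UB => //.
- by rewrite addn0.
- by rewrite gb andbT (ltnW g_gt1).
- exact: ltnW.
move=> k s; rewrite /NAplus; case: eqP => [->|_]; last first.
  by rewrite addn0 => sN; apply: (subvP (sub0v _)); apply: (fl_satisfies fA) sN.
rewrite addn1 ltnS leq_eqVlt => /predU1P[->|sN]; last first.
  by apply: (subvP (sub0v _)); apply: (fl_satisfies fA) sN.
rewrite -epow_coefE -subn1; exact: ecyc_id.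
Qed.

(** The stability hypothesis feeds [lowest_of_stable]; it is met once the span of w is recognised as
    the intersection of two kernels. The two top e_j kill w by [Y0] and [Y1]. *)
Lemma emb_lowest :
    (forall x j u, u \in cyc (eact (n := n) M) 0%VS w ->
       act M x j u \in cyc (eact (n := n) M) 0%VS w) ->
  lowest (size C) (weight F C) w.
Proof.
move=> stabw; have [_ hv _] := fl_lowest fA.
have hw : act M sl2h 0 w = weight F C *: w.
  by rewrite -weight_contract; apply: act_h_epow; rewrite hv.
have [fw hjw] := lowest_of_stable stabw (fl_nilpotent fA) hw; split=> // j.
  by case: eqP => [->//|/eqP j0]; rewrite hjw // lt0n.
have En : n = (size C).+2 by apply: size_contract.
have [nj _|jn Cj] := leqP n j.
  apply: (ecyc_act_ge (fl_lowest fA) nj).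
  by rewrite (fl_cyclic fA) memvf.
move: Y0 Y1; rewrite !eact_evar; [|by clear -n2; lia..]; rewrite subn0 => e0 e1.
have [->//|->//] : j = n.-1 \/ j = (n.-1 - 1)%N.
by move: En jn Cj; clear; lia.
Qed.

End EmbeddedVector.

Theorem contracted_submodule (MA MA1 MB MB1 MC : sl2t_mod F)
    (vA : MA) (vA1 : MA1) (vB : MB) (vB1 : MB1) (vC : MC) :
    fusion_like A vA -> fusion_like A1 vA1 -> fusion_like B vB ->
    fusion_like B1 vB1 -> fusion_like C vC ->
  exists (p : mod_hom MA MA1) (q : mod_hom MB MB1) (iota : mod_hom MC MA),
    [/\ p vA = vA1 /\ limg p = fullv, q vB = vB1 /\ limg q = fullv,
        [/\ lker iota = 0%VS,
            iota vC = epow_coef n (b - 1) (NA A (b - 1)) vA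
          & (limg iota <= lker p)%VS]
      & mod_iso (quo_mod (ker_submod p) (img_submod iota))
                (submod_mod (ker_submod q))].
Proof.
move=> fA fA1 fB fB1 fC.
have sz1 : n = size A1 by rewrite !size_cat.
have sz2 : n = size B by rewrite !size_cat.
have sz3 : n = size B1 by rewrite !size_cat.
have wt D E : (\sum_(a <- D) a.-1 = \sum_(a <- E) a.-1)%N ->
    weight F (L ++ D) = weight F (L ++ E).
  by move=> DE; rewrite /weight !big_cat /= DE.
have [p [pv pf]] : exists f : mod_hom MA MA1, f vA = vA1 /\ limg f = fullv.
  apply: (fusion_like_hom fA fA1) => // [|k]; last by rewrite NA_shift // leq_addr.
  by apply: wt; rewrite !big_cons; clear -g_gt1 gb bd; lia.
have [q [qv qf]] : exists f : mod_hom MB MB1, f vB = vB1 /\ limg f = fullv.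
  apply: (fusion_like_hom fB fB1) => [||k]; first by rewrite -sz2.
    by apply: wt; rewrite !big_cons; clear -g_gt1 gb bd; lia.
  by rewrite NA_shift' // leq_addr.
have [r [rv rf]] : exists f : mod_hom MA MB, f vA = vB /\ limg f = fullv.
  apply: (fusion_like_hom fA fB) => // [|k]; last by rewrite NA_prev // leq_addr.
  by apply: wt; rewrite !big_cons; clear -g_gt1 gb bd; lia.
have [r' [r'v _]] : exists f : mod_hom MA1 MB1, f vA1 = vB1 /\ limg f = fullv.
  apply: (fusion_like_hom fA1 fB1) => [||k]; first by rewrite -sz1.
    by apply: wt; rewrite !big_cons; clear -g_gt1 gb bd; lia.
  by rewrite NA_prev' // leq_addr.
have comm u : q (r u) = r' (p u).
  pose qr := (q \o r)%VF; pose rp := (r' \o p)%VF.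
  have : qr =1 rp.
    apply: (fusion_like_hom_unique fA) => [j w|j w|]; rewrite !comp_lfunE ?mod_homP //.
    by rewrite rv qv pv r'v.
  by move/(_ u); rewrite !comp_lfunE.
have dp := dim_lker_onto pf; have dq := dim_lker_onto qf.
rewrite (fl_dim fA) (fl_dim fA1) in dp; rewrite (fl_dim fB) (fl_dim fB1) in dq.
pose Z := (r @: lker p)%VS.
have Zq : (Z <= lker q)%VS.
  apply/subvP => x /memv_imgP[u]; rewrite !memv_ker => /eqP pu ->.
  by rewrite comm pu linear0.
(* Modulo [Z], vB satisfies the relations of B1: those missing from B are the coefficients of degree
   N_A(k), b <= k < d, and applied to vB they are images under r of vectors killed by p. So dim M^B
   <= dim Z + dim M^B1. *)
have ZE : Z = lker q.
  apply/eqP; rewrite eqEdim Zq /= -(leq_add2r (\prod_(a <- B1) a)) dq.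
  have stabZ : stab (eact (n := n) MB) Z.
    apply: submod_eact_stab => x j _ /memv_imgP[u up ->].
    by rewrite -mod_homP memv_img // ker_subproof.
  have cB := fl_cyclic fB; have satB := fl_satisfies fB.
  have satA1 := fl_satisfies fA1.
  rewrite -sz2 in cB satB; rewrite -sz1 in satA1.
  have := @dim_cyc_le F _ _ (eact MB) (@eactD F n _) (@eactM F n _) (@eact1 F n _)
    n (evar F n) (@eact_gen F n _) B1 0 Z vB.
  rewrite (ecyc_full stabZ cB) (fl_dim fB); apply=> //; first by rewrite addn0.
  move=> k s; rewrite NA_shift' //; case: (boolP (_ && _)) => [/andP[bk kd]|_]; last first.
    by rewrite addn0 => sN; apply: (subvP (sub0v _)); apply: satB sN.
  rewrite [(_ + true)%N]addn1 ltnS leq_eqVlt => /predU1P[->|sN]; last first.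
    by apply: (subvP (sub0v _)); apply: satB sN.
  rewrite -rv -mod_hom_eact memv_img // memv_ker mod_hom_eact pv.
  rewrite -memv0; apply: satA1.
  rewrite NA_shift // NA_prev // [(k < b)%N]ltnNge bk andbF addn0.
  by rewrite kd andbT (leq_trans (leq_pred b) bk) [(_ + true)%N]addn1.
pose w : MA := epow_coef n (b - 1) (NA A (b - 1)) vA.
pose K := (lker p :&: lker r)%VS.
have pw : p w = 0.
  apply/eqP; rewrite /w mod_hom_epow pv epow_coefE -memv0 sz1.
  apply: (fl_satisfies fA1); rewrite NA_shift //; clear -g_gt1 gb bd; lia.
have rw : r w = 0.
  apply/eqP; rewrite /w mod_hom_epow rv epow_coefE -memv0 sz2.
  apply: (fl_satisfies fB); rewrite NA_prev //; clear -g_gt1 gb bd; lia.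
have stabK x j u : u \in K -> act MA x j u \in K.
  by rewrite !memv_cap => /andP[up ur]; rewrite !ker_subproof.
(* r maps ker p onto ker q with kernel [K]; [prod_contract] evaluates the difference. *)
have dK : (\dim K = \prod_(a <- C) a)%N.
  have := limg_ker_dim r (lker p); rewrite -/K -/Z ZE.
  have := prod_contract L H g_gt1 gb bd; move: dp dq.
  move: (\prod_(a <- A) a)%N (\prod_(a <- A1) a)%N (\prod_(a <- B) a)%N (\prod_(a <- B1) a)%N.
  move: (\prod_(a <- C) a)%N (\dim _) (\dim _) (\dim _); clear; lia.
(* Both p and r kill w; [emb_dim] turns the inclusion into an equality. *)
have wK : cyc (eact (n := n) MA) 0%VS w = K.
  apply/eqP; rewrite eqEdim dK emb_dim // andbT.
  apply: cyc_min; rewrite ?sub0v ?memv_cap ?memv_ker ?pw ?rw ?eqxx //.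
  exact: submod_eact_stab.
have loww : lowest (size C) (weight F C) w.
  by apply: emb_lowest => // x j u; rewrite -/w wK; apply: stabK.
have [||iota [iotav iotaw]] := lowest_hom erefl (fl_lowest fC) loww _ _
  (fl_satisfies fC) (emb_satisfies_contract fA).
- by rewrite (fl_dim fC).
- exact: fl_cyclic fC.
have iK : limg iota = K.
  apply/eqP; rewrite eqEsubv; apply/andP; split.
    apply: subv_trans iotaw _; apply: cyc_min; rewrite ?sub0v //.
      exact: submod_eact_stab.
    by rewrite -wK; apply: ecyc_id.
  rewrite -wK; apply: cyc_min; rewrite ?sub0v //.
    by apply: submod_eact_stab; apply: img_subproof.
  by rewrite -iotav memv_img ?memvf.
exists p, q, iota; split=> //.
  split=> //; last by rewrite iK capvSl.
  (* iota maps M^C onto [K], which has the same dimension, so its kernel is zero. *)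
  apply/eqP; rewrite -dimv_eq0; have := limg_ker_dim iota fullv.
  by rewrite capfv iK dK (fl_dim fC); clear; lia.
(* The isomorphism is induced by r, whose kernel on ker p is the image of iota. *)
by apply: (quo_mod_iso (f := r)) => /=; rewrite ?iK.
Qed.

End Embedding.

(** * From the indexed sequences to L, g, b, d, H *)

Lemma split_three (A : seq nat) i : (1 < i)%N -> (i < size A)%N ->
  exists L g b d H, A = L ++ [:: g, b, d & H] /\ i = (size L + 2)%N.
Proof.
case: i => [|[|i]] // _ iA; exists (take i A), (nth 0 A i)%N, (nth 0 A i.+1)%N,
  (nth 0 A i.+2)%N, (drop i.+3 A); split; last by rewrite size_takel ?addn2 //; lia.
by rewrite -!drop_nth ?cat_take_drop //; lia.
Qed.

Lemma ent_cat L s k : ent (L ++ s) (size L + k.+1) = ent s k.+1.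
Proof. by rewrite /ent nth_cat addnS /= ltnNge leq_addr addKn. Qed.

Lemma seq_shift_cat L s k : seq_shift (L ++ s) (size L + k.+1) = L ++ seq_shift s k.+1.
Proof.
rewrite /seq_shift -addnS !ent_cat catA !addnS /= take_cat drop_cat.
by rewrite ![(_ < size L)%N]ltnNge -?addnS !leq_addr !addKn.
Qed.

Lemma seq_contract_cat L s k :
  seq_contract (L ++ s) (size L + k.+2) = L ++ seq_contract s k.+2.
Proof.
rewrite /seq_contract -addnS.
have -> : ((size L + k.+2).-2 = size L + k)%N by rewrite !addnS.
have -> : (size L + k.+2).-1 = (size L + k.+1)%N by rewrite addnS.
rewrite !ent_cat take_cat drop_cat ![(_ < size L)%N]ltnNge !leq_addr !addKn /=.
by rewrite -catA.
Qed.

(* B = A_{i-1,i}; S_{i,i+1}(A) = ker p, S_{i,i+1}(B) = ker q, and M^{A_i} is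
   the image of iota. *)
Theorem proposition2p1 (R : realType) (A : seq nat) (i : nat)
    (zA zA' zB zB' zC : seq (complex R)) :
  let B := seq_shift A i.-1 in
  all (fun a => 0 < a)%N A -> sorted leq A ->
  (1 < i)%N -> (i < size A)%N ->
  ent A i <> ent A i.+1 -> (1 < ent A i.-1)%N ->
  eval_points A zA -> eval_points (seq_shift A i) zA' ->
  eval_points B zB -> eval_points (seq_shift B i) zB' ->
  eval_points (seq_contract A i) zC ->
  exists (p : mod_hom (fusion A zA) (fusion (seq_shift A i) zA'))
         (q : mod_hom (fusion B zB) (fusion (seq_shift B i) zB'))
         (iota : mod_hom (fusion (seq_contract A i) zC) (fusion A zA)),
    [/\ canonical_surj p, canonical_surj q,
        canonical_emb (ker_submod p) iota
      & mod_iso (quo_mod (ker_submod p) (img_submod iota))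
                (submod_mod (ker_submod q))].
Proof.
move=> B A0 sA i1 iA; rewrite {}/B.
(* g, b, d are a_(i-1), a_i, a_(i+1), hence [L] has length i - 2. *)
have [L [g [b [d [H [AE iE]]]]]] := split_three i1 iA; subst A i => {i1 iA}.
have -> : ((size L + 2).-1 = size L + 1)%N by rewrite addnS.
have c1 : seq_shift (L ++ [:: g, b, d & H]) (size L + 2) = L ++ [:: g, b - 1, d + 1 & H]%N.
  by rewrite (seq_shift_cat L _ 1) /seq_shift /= drop0.
have c2 : seq_shift (L ++ [:: g, b, d & H]) (size L + 1) = L ++ [:: g - 1, b + 1, d & H]%N.
  by rewrite (seq_shift_cat L _ 0).
have c3 : seq_shift (L ++ [:: g - 1, b + 1, d & H]%N) (size L + 2) =
    L ++ [:: g - 1, b, d + 1 & H]%N.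
  by rewrite (seq_shift_cat L _ 1) /seq_shift /= drop0 /ent /= addnK.
have c4 : seq_contract (L ++ [:: g, b, d & H]) (size L + 2) = L ++ (g + d - b)%N :: H.
  by rewrite (seq_contract_cat L _ 0) /seq_contract /= drop0.
have e1 : ent (L ++ [:: g, b, d & H]) (size L + 1) = g by rewrite (ent_cat L _ 0).
have e2 : ent (L ++ [:: g, b, d & H]) (size L + 2) = b by rewrite (ent_cat L _ 1).
have e3 : ent (L ++ [:: g, b, d & H]) (size L + 3) = d by rewrite (ent_cat L _ 2).
rewrite /canonical_emb /emb_vec -!addnS c1 c2 c3 c4 e1 e2 e3.
move=> /eqP bd g1 eA eA1 eB eB1 eC.
have [LR gb bd' dH] : [/\ allrel leq L [:: g, b, d & H], (g <= b)%N, (b <= d)%N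
    & all (fun a => d <= a)%N H].
  move: sA; rewrite (sorted_pairwise leq_trans) pairwise_cat /=.
  by move=> /and5P[-> _ /andP[-> _] /andP[-> _] /andP[-> _]].
have [L0 H0] : all (fun a => 0 < a)%N L /\ all (fun a => 0 < a)%N H.
  by move: A0; rewrite all_cat /= => /andP[-> /and4P[_ _ _ ->]].
have Lg : all (fun a => a <= g)%N L by apply/allP => a aL; apply: (allrelP LR); rewrite ?mem_head.
have {}bd : (b < d)%N by rewrite ltn_neqAle bd.
have B0 : all (fun a => 0 < a)%N (L ++ [:: g - 1, b + 1, d & H]%N).
  by rewrite all_cat L0 /= H0 andbT; clear -g1 gb bd; lia.
have A10 : all (fun a => 0 < a)%N (L ++ [:: g, b - 1, d + 1 & H]%N).
  by rewrite all_cat L0 /= H0 andbT; clear -g1 gb bd; lia.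
have B10 : all (fun a => 0 < a)%N (L ++ [:: g - 1, b, d + 1 & H]%N).
  by rewrite all_cat L0 /= H0 andbT; clear -g1 gb bd; lia.
have C0 : all (fun a => 0 < a)%N (L ++ (g + d - b)%N :: H).
  by rewrite all_cat L0 /= H0 andbT; clear -g1 gb bd; lia.
exact: (contracted_submodule Lg dH g1 gb bd (fusion_fusion_like A0 eA)
  (fusion_fusion_like A10 eA1) (fusion_fusion_like B0 eB)
  (fusion_fusion_like B10 eB1) (fusion_fusion_like C0 eC)).
Qed.
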